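(* Let $\mathcal{A}$ be the global attractor of the two-dimensional Bénard convection system $$\frac{du}{dt}+\nu A_0u+B_0(u,u)=\mathcal{P}_\sigma(\theta\mathbf{e}_2),\qquad \frac{d\theta}{dt}+\kappa A_1\theta+B_1(u,\theta)-u\cdot\mathbf{e}_2=0,$$ with $\nu,\kappa>0$. Let $(u_1(t;x),\theta_1(t;x))$ and $(u_2(t;x),\theta_2(t;x))$, $t\in\mathbb{R}$, be two trajectories (solutions of the system defined for all $t\in\mathbb{R}$) contained in $\mathcal{A}$. If $u_1(t;x)=u_2(t;x)$ for all $t\in\mathbb{R}$, then $\theta_1(t;x)=\theta_2(t;x)$ for all $t\in\mathbb{R}$.
   Context: Let $L>0$ and $\Omega=(0,L)\times(0,1)$; $\mathbf{e}_2=(0,1)$. The system is the functional form of the non-dimensional Boussinesq (Bénard convection) equations $\partial_tu-\nu\Delta u+(u\cdot\nabla)u+\nabla p=\theta\mathbf{e}_2$, $\partial_t\theta-\kappa\Delta\theta+(u\cdot\nabla)\theta-u\cdot\mathbf{e}_2=0$, $\nabla\cdot u=0$, with $u,\theta=0$ at $x_2=0$ and $x_2=1$, and $u,\theta,p$ periodic of period $L$ in $x_1$. Function spaces (the same notation is used for scalar and vector Lebesgue/Sobolev spaces). $\mathcal{F}$ is the set of $C^\infty(\Omega)$ functions that are trigonometric polynomials in $x_1$ with period $L$ and compactly supported in the $x_2$-direction; $\mathcal{V}=\{\phi\in\mathcal{F}\times\mathcal{F}:\nabla\cdot\phi=0\}$. $H_0$ and $H_1$ (subscripts; not Sobolev spaces)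 are the closures of $\mathcal{V}$ and $\mathcal{F}$, respectively, in $L^2(\Omega)$, with the usual $L^2$ inner products and norms. $V_0$ and $V_1$ are the closures of $\mathcal{V}$ and $\mathcal{F}$, respectively, in the Sobolev space $H^1(\Omega)$, with inner products $((u,v))_{V_0}=\sum_{i,j=1}^2\int_\Omega\partial_ju^i\,\partial_jv^i\,dx$ and $((\psi,\phi))_{V_1}=\sum_{j=1}^2\int_\Omega\partial_j\psi\,\partial_j\phi\,dx$. $V_i'$ is the dual of $V_i$. For $i=0,1$, $D(A_i)=V_i\cap H^2(\Omega)$ and $A_i:D(A_i)\to H_i$ is defined by $(A_iu,v)_{H_i}=((u,v))_{V_i}$ for all $u,v\in D(A_i)$. $\mathcal{P}_\sigma$ is the Helmholtz–Leray projector from $L^2(\Omega)$ onto $H_0$. $B_0:V_0\times V_0\to V_0'$ and $B_1:V_0\times V_1\to V_1'$ are given by $\langle B_0(u,v),w\rangle=((u\cdot\nabla)v,w)_{H_0}$ and $\langle B_1(u,\theta),\phi\rangle=((u\cdot\nabla)\theta,\phi)_{H_1}$. Known background: for $u_0\in V_0$, $\theta_0\in V_1$ the system has a unique strong solution with $u\in C([0,T];V_0)\cap L^2([0,T];D(A_0))$ and $\theta\in C([0,T];V_1)\cap L^2([0,T];D(A_1))$ for every $T>0$, and the system possesses a finite-dimensional global attractor $\mathcal{A}$, which is maximal among all bounded invariant sets and compact in $H_0\times H_1$. Solutions on $\mathcal{A}$ are bounded in $H_0\times H_1$ and in $V_0\times V_1$. *)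

(* Defs.v *)
From HB Require Import structures.
From mathcomp Require Export all_boot all_order all_algebra.
From mathcomp Require Export all_classical all_reals all_analysis.
Export Order.TTheory GRing.Theory Num.Theory.
Export numFieldNormedType.Exports.

Set Implicit Arguments.
Unset Strict Implicit.
Unset Printing Implicit Defensive.

Local Open Scope classical_set_scope.
Local Open Scope ring_scope.

(** Points of the plane are pairs.  A field with [n] components is a function
    ['I_n -> R * R -> R]: velocities have two components and temperatures one,
    so that the spaces and operators with subscripts 0 and 1 are instances of
    the same definitions.  Elements of [L^2(Omega)] are represented by
    functions on the whole plane whose values off [Omega] are irrelevant, and
    they are compared almost everywhere on [Omega]. *)

Notation field R n := ('I_n -> R * R -> R).
Notation velocity R := (field R 2).
Notation temperature R := (field R 1).
Notation state R := (velocity R * temperature R)%type.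

Section Spaces.
Variables (R : realType) (L : R).
Implicit Types (f g phi : R * R -> R) (n : nat).

Definition mu2 : {measure set (measurableTypeR R * measurableTypeR R) -> \bar R} :=
  (@lebesgue_measure R \x @lebesgue_measure R)%E.

Definition Omega : set (R * R) := `]0, L[ `*` `]0, 1[.

Definition dir (j : 'I_2) : R * R := ((j == ord0)%:R, (j == ord_max)%:R).

Fixpoint Ck (k : nat) f : Prop :=
  match k with
  | 0 => continuous f
  | k'.+1 => (forall x j, derivable f x (dir j)) /\
             (forall j, Ck k' (fun x => 'D_(dir j) f x))
  end.

Definition smooth f := forall k, Ck k f.

Definition test_fun phi := smooth phi /\
  exists K : set (R * R),
    [/\ compact K, K `<=` Omega & forall x, ~ K x -> phi x = 0].

Definition inL2 f := f \_ Omega \in Lfun mu2 2%:E.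

Definition weak_partial (j : 'I_2) f g := forall phi, test_fun phi ->
  \int[mu2]_(x in Omega) (f x * 'D_(dir j) phi x) =
  - \int[mu2]_(x in Omega) (g x * phi x).

Definition inH1 f := inL2 f /\ forall j, exists2 g, inL2 g & weak_partial j f g.

(** A square-integrable weak partial derivative of [f]; it is unique almost
    everywhere on [Omega], and exists when [inH1 f] holds. *)
Definition wpartial (j : 'I_2) f : R * R -> R :=
  xget (cst 0) [set g | inL2 g /\ weak_partial j f g].

Definition inH2 f := inH1 f /\ forall j, inH1 (wpartial j f).

Definition ip n (u v : field R n) : R :=
  \sum_(i < n) \int[mu2]_(x in Omega) (u i x * v i x).

Definition normL2 n (u : field R n) : R := Num.sqrt (ip u u).

Definition fsub n (u v : field R n) : field R n := fun i x => u i x - v i x.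

Definition grad n (u : field R n) (j : 'I_2) : field R n :=
  fun i x => 'D_(dir j) (u i) x.

Definition wgrad n (u : field R n) (j : 'I_2) : field R n :=
  fun i => wpartial j (u i).

Definition gradip n (u v : field R n) : R :=
  \sum_(j < 2) ip (wgrad u j) (wgrad v j).

(** The norm of [u - v] in [H^1(Omega)], where [Du] and [Dv] are the gradients
    of [u] and [v]: [wgrad] in general, or [grad] for a smooth field, whose
    classical derivatives are its weak ones. *)
Definition H1dist n (u : field R n) (Du : 'I_2 -> field R n)
    (v : field R n) (Dv : 'I_2 -> field R n) : R :=
  Num.sqrt (normL2 (fsub u v) ^+ 2 + \sum_(j < 2) normL2 (fsub (Du j) (Dv j)) ^+ 2).

(** Trigonometric polynomials in [x_1] of period [L], compactly supported in
    [x_2].  Smoothness is required on the plane, of the function extended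
    periodically in [x_1] and by zero in [x_2]. *)
Definition calF phi := [/\ smooth phi,
  exists (N : nat) (a b : nat -> R -> R), forall x, phi x =
    \sum_(k < N) (a k x.2 * cos (2 * pi * k%:R * x.1 / L) +
                  b k x.2 * sin (2 * pi * k%:R * x.1 / L)) &
  exists2 d : R, 0 < d & forall x, phi x != 0 -> d <= x.2 <= 1 - d].

Definition calF1 : set (temperature R) := [set phi | forall i, calF (phi i)].

Definition calV : set (velocity R) := [set phi | (forall i, calF (phi i)) /\
  forall x, \sum_(j < 2) 'D_(dir j) (phi j) x = 0].

Definition closureL2 n (S : set (field R n)) : set (field R n) :=
  [set u | (forall i, inL2 (u i)) /\
     forall e : R, 0 < e -> exists2 phi, S phi & normL2 (fsub phi u) < e].

Definition closureH1 n (S : set (field R n)) : set (field R n) :=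
  [set u | (forall i, inH1 (u i)) /\
     forall e : R, 0 < e ->
       exists2 phi, S phi & H1dist phi (grad phi) u (wgrad u) < e].

Definition spH0 := closureL2 calV.
Definition spH1 := closureL2 calF1.
Definition spV0 := closureH1 calV.
Definition spV1 := closureH1 calF1.

Definition domA n (S : set (field R n)) : set (field R n) :=
  [set u | closureH1 S u /\ forall i, inH2 (u i)].

(** [is_A S u a] means [a = A u], with [S := calV] for [A_0] and [S := calF1]
    for [A_1].  It is a relation because [V_i] intersected with [H^2(Omega)]
    contains fields with no image: those whose [x_1]-derivative is not
    periodic. *)
Definition is_A n (S : set (field R n)) (u a : field R n) :=
  [/\ domA S u, closureL2 S a & forall v, domA S v -> ip a v = gradip u v].

Definition is_leray (f p : velocity R) :=
  spH0 p /\ forall v, spH0 v -> ip (fsub f p) v = 0.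

(** [<B_0(u, v), w>] for [n = 2] and [<B_1(u, v), w>] for [n = 1]. *)
Definition formB n (u : velocity R) (v w : field R n) : R :=
  ip (fun i x => \sum_(j < 2) u j x * wgrad v j i x) w.

Definition times_e2 (theta : temperature R) : velocity R :=
  fun i x => if i == ord_max then theta ord0 x else 0.

Definition dot_e2 (u : velocity R) : temperature R := fun _ => u ord_max.

Definition field_ae_eq n (u v : field R n) :=
  forall i, ae_eq mu2 Omega (u i) (v i).

Section Evolution.
Variables nu kappa : R.
Implicit Types (I : set R) (u : R -> velocity R) (theta : R -> temperature R).

(** [g] is in [L^2(s, t; H)] for all [[s, t]] included in [I], where [H] is the
    closure of [S]; since [H] is separable, measurability of [g] is weak
    measurability. *)
Definition L2loc n (S : set (field R n)) I (g : R -> field R n) :=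
  (forall t, I t -> closureL2 S (g t)) /\
  forall s t, `[s, t] `<=` I ->
    (forall w, closureL2 S w -> measurable_fun `[s, t] (fun r => ip (g r) w)) /\
    (@lebesgue_measure R).-integrable `[s, t]
      (fun r => (normL2 (g r) ^+ 2)%:E).

(** [u] is in [C(I; V)], where [V] is the [H^1]-closure of [S]. *)
Definition contV n (S : set (field R n)) I (u : R -> field R n) :=
  forall t, I t -> closureH1 S (u t) /\
    H1dist (u s) (wgrad (u s)) (u t) (wgrad (u t)) @[s --> within I (nbhs t)]
      --> 0.

(** [du/dt = du], the integral of [du] being taken weakly. *)
Definition time_deriv n (S : set (field R n)) I (u du : R -> field R n) :=
  forall s t, s <= t -> `[s, t] `<=` I -> forall w, closureL2 S w ->
    ip (fsub (u t) (u s)) w =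
    \int[@lebesgue_measure R]_(r in `[s, t]) ip (du r) w.

(** Strong solutions on a time interval [I]; the images [au] of [u] by [A_0]
    and [ath] of [theta] by [A_1] carry the conditions
    [u \in L^2(0, T; D(A_0))] and [theta \in L^2(0, T; D(A_1))]. *)
Definition strong_solution I u theta :=
  [/\ contV calV I u, contV calF1 I theta &
   exists (du au : R -> velocity R) (dth ath : R -> temperature R),
   [/\ [/\ L2loc calV I du, L2loc calV I au & time_deriv calV I u du],
       [/\ L2loc calF1 I dth, L2loc calF1 I ath & time_deriv calF1 I theta dth],
       {ae @lebesgue_measure R, forall t, I t -> is_A calV (u t) (au t) /\
          exists2 p, is_leray (times_e2 (theta t)) p &
          forall w, spV0 w ->
            ip (du t) w + nu * ip (au t) w + formB (u t) (u t) w = ip p w} &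
       {ae @lebesgue_measure R, forall t, I t -> is_A calF1 (theta t) (ath t) /\
          forall w, spV1 w ->
            ip (dth t) w + kappa * ip (ath t) w + formB (u t) (theta t) w
              - ip (dot_e2 (u t)) w = 0}]].

Implicit Types (z : state R) (X Y : set (state R)).

(** [S(t) X] for the solution semigroup [S]: only the points of [X] in
    [V_0 * V_1], where the strong solutions start, have an image. *)
Definition evolve (t : R) X : set (state R) :=
  [set z | exists u theta, [/\ strong_solution `[0, +oo[ u theta,
     X (u 0, theta 0) & z = (u t, theta t)]].

Definition invariant_set X := forall t, 0 <= t -> evolve t X = X.

Definition Hdist (z z' : state R) : R :=
  Num.sqrt (normL2 (fsub z.1 z'.1) ^+ 2 + normL2 (fsub z.2 z'.2) ^+ 2).

Definition bounded_H X := exists M : R, forall z, X z ->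
  [/\ spH0 z.1, spH1 z.2 & Num.sqrt (normL2 z.1 ^+ 2 + normL2 z.2 ^+ 2) <= M].

(** [compact X], unfolded for the pseudometric [Hdist]. *)
Definition compact_H X :=
  (forall z, X z -> spH0 z.1 /\ spH1 z.2) /\
  forall F : set_system (state R), ProperFilter F -> F X ->
    exists2 z, X z & forall Y e, F Y -> 0 < e -> exists2 y, Y y & Hdist y z < e.

Definition attracts X Y := forall e : R, 0 < e -> exists T : R,
  forall t, 0 <= t -> T <= t ->
  forall z, evolve t Y z -> exists2 x, X x & Hdist z x < e.

Definition global_attractor X :=
  [/\ compact_H X, bounded_H X, invariant_set X,
      forall Y, bounded_H Y -> attracts X Y &
      forall Y, bounded_H Y -> invariant_set Y -> Y `<=` X].

Definition trajectory_in X u theta :=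
  strong_solution setT u theta /\ forall t, X (u t, theta t).

End Evolution.
End Spaces.

(* Main.v *)
Require Import Defs.
From mathcomp Require Import measurable_realfun ring lra.

(** Let [u] be the common velocity and [theta = theta1 - theta2].

    The momentum equation determines the projection of [theta e_2] onto [H_0].
    Subtracting the two momentum equations, tested with a field [v] of the
    class [V] of smooth divergence-free fields, cancels every term in the
    velocity; integrated over an arbitrary time interval the two time
    derivatives cancel as well, and by continuity in time [theta(t)] is
    orthogonal in [L^2(Omega)] to [v_2] for every [t] ([momentum_ortho]).
    With [v = (- D_2 psi, D_1 psi)] this says that [theta(t)] is orthogonal to
    [D_1 psi] for every [psi] in [F] ([theta_ortho]): it depends on [x_2] only.

    The temperature equations are then tested with functions [w(x_2)].
    Integrating by parts, and using that [u] is divergence-free, turns the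
    advection term into [- \int theta u_2 w'] ([formB_vert]).  Since the second
    component of a field of [V] is an [x_1]-derivative ([calV_second]), [u_2 w']
    is a limit of [x_1]-derivatives of elements of [F], so the advection of
    [theta] contributes nothing ([vert_ortho]), and what remains is the heat
    equation in [x_2] with Dirichlet conditions.  Hence the coefficient [f(t)]
    of [theta(t)] on [sin (m pi x_2)] satisfies [f' = - kappa (m pi)^2 f]
    ([mode_equation]).  Both trajectories stay for all real times in the
    attractor, which is bounded, so [f] is bounded on the whole line; nonzero
    solutions of that equation grow exponentially as [t] tends to [-oo], so
    [f = 0] ([bounded_decay0], [mode_zero]).

    An element of [F] is the sum of its mean in [x_1], a function of [x_2] with
    compact support in [(0, 1)], and of [D_1 psi] with [psi] in [F]
    ([calF_split]).  A function of the first kind is a limit in [L^2] of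
    combinations of the [sin (m pi x_2)], by Bernstein approximation in the
    variable [cos (pi x_2)] ([vprof_ortho]).  So [theta(t)] is orthogonal to
    [F]; being in the closure of [F], it vanishes.

    Three points need preparation.  The operators [A_i] are characterised by
    pairings with [D(A_i)] and by weak gradients, so smooth fields have to be
    placed in [D(A_i)] with their classical gradients, which rests on the
    uniqueness of weak derivatives ([ortho_test_ae0], [wpartial_smooth],
    [domA_smooth]).  The functions [sin (m pi x_2)] are not compactly
    supported, and are approached in [H^1] by [wsin m n]
    ([cvL2_derive_wsin]).  Finally, the definition of [F] requires the
    smoothness of a function and not that of its Fourier coefficients, which
    is recovered by combining translates in [x_1] ([coef_pprof]). *)

Set Implicit Arguments.
Unset Strict Implicit.
Unset Printing Implicit Defensive.
Local Open Scope classical_set_scope.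
Local Open Scope ring_scope.

(** * Square-integrable functions on the domain *)

Section L2.
Variables (R : realType) (L : R).
Implicit Types (f g h : R * R -> R).
Notation T2 := (measurableTypeR R * measurableTypeR R)%type.
Notation mu := (@mu2 R).
Notation Om := (Omega L).

(** The scalar product of [L^2(Omega)]; it is meaningful for arguments that
    satisfy [inL2].  The notation [sp] abbreviates it. *)
Definition dotL2 f g : R := \int[mu]_(x in Om) (f x * g x).
Notation sp := dotL2.

Lemma measurable_Omega : measurable (Om : set T2).
Proof. by apply: measurableX; exact: measurable_itv. Qed.

Lemma mu_Omega : (mu Om < +oo)%E.
Proof.
have -> : mu Om = (@lebesgue_measure R `]0%R, L[%classic * @lebesgue_measure R `]0%R, 1%R[%classic)%E.
  by apply: product_measure1E; exact: measurable_itv.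
by rewrite !lebesgue_measure_itv /=; case: ifP => _; case: ifP => _;
  rewrite ?mul0e ?mule0 // -?EFinD -?EFinM ltry.
Qed.

Lemma inL2P f : inL2 L f <-> measurable_fun (Om : set T2) f /\
  mu.-integrable Om (EFin \o (fun x => f x ^+ 2)).
Proof.
have mO := measurable_Omega.
have E : (fun x => (f \_ Om) x ^+ 2) = ((fun x => f x ^+ 2) \_ Om).
  by apply/funext => x; rewrite !patchE; case: ifP => // _; rewrite expr0n.
split => [H|[mf intf]].
- have := Lfun2_integrable_sqr H; move: (H); rewrite /inL2 inE => /andP[/[!inE]/= mf _] intf.
  split; first by apply/(measurable_restrictT _ mO).
  by apply/(integrable_mkcond _ mO); rewrite restrict_EFin -E.
- have mf' : measurable_fun [set: T2] (f \_ Om) by apply/(measurable_restrictT _ mO).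
  rewrite /inL2 inE; apply/andP; rewrite !inE /=; split => //.
  rewrite /finite_norm.
  move/(integrable_mkcond _ mO): intf; rewrite restrict_EFin -E => intf.
  rewrite unlock; apply: poweR_lty => //.
  case/integrableP: intf => _; apply: le_lt_trans.
  rewrite le_eqVlt; apply/orP; left; apply/eqP; apply: eq_integral => x _ /=.
  by rewrite powR_mulrn // normrX.
Qed.

Lemma inL2_meas f : inL2 L f -> measurable_fun (Om : set T2) f.
Proof. by case/inL2P. Qed.

Lemma inL2_mul f g : inL2 L f -> inL2 L g ->
  mu.-integrable Om (EFin \o (fun x => f x * g x)).
Proof.
move=> /inL2P[mf intf] /inL2P[mg intg].
apply: (le_integrable measurable_Omega _ _
  (integrableD measurable_Omega intf intg)).
  by apply/measurable_EFinP; exact: measurable_funM.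
move=> x _ /=; rewrite lee_fin.
have h : 0 <= f x ^+ 2 + g x ^+ 2 by rewrite addr_ge0 // sqr_ge0.
rewrite (ger0_norm h) normrM.
rewrite -(real_normK (num_real (f x))) -(real_normK (num_real (g x))).
have := sqr_ge0 (`|f x| - `|g x|); have := normr_ge0 (f x); have := normr_ge0 (g x).
by nra.
Qed.

Lemma inL2_sqr f : inL2 L f -> mu.-integrable Om (EFin \o (fun x => f x ^+ 2)).
Proof. by case/inL2P. Qed.

Lemma inL2D f g : inL2 L f -> inL2 L g -> inL2 L (fun x => f x + g x).
Proof.
move=> Hf Hg; apply/inL2P; split.
  by apply: measurable_funD; exact: inL2_meas.
have -> : EFin \o (fun x => (f x + g x) ^+ 2) =
    (fun x => (f x ^+ 2)%:E + (g x ^+ 2)%:E + (2%:E * (f x * g x)%:E))%E.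
  by apply/funext => x /=; rewrite -EFinM -!EFinD; congr (_%:E); ring.
apply: integrableD; [exact: measurable_Omega| |].
  by apply: integrableD; [exact: measurable_Omega|exact: inL2_sqr..].
by apply: integrableZl; [exact: measurable_Omega|exact: inL2_mul].
Qed.

Lemma inL2Z (c : R) f : inL2 L f -> inL2 L (fun x => c * f x).
Proof.
move=> Hf; apply/inL2P; split.
  by apply: measurable_funM; [exact: measurable_cst|exact: inL2_meas].
have -> : EFin \o (fun x => (c * f x) ^+ 2) = (fun x => (c ^+ 2)%:E * (f x ^+ 2)%:E)%E.
  by apply/funext => x /=; rewrite -EFinM exprMn.
by apply: integrableZl; [exact: measurable_Omega|exact: inL2_sqr].
Qed.

Lemma inL2B f g : inL2 L f -> inL2 L g -> inL2 L (fun x => f x - g x).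
Proof.
move=> Hf Hg; have := inL2D Hf (inL2Z (-1) Hg).
by under eq_fun do rewrite mulN1r.
Qed.

(** Multiplication by a bounded measurable function preserves [L^2(Omega)]. *)
Lemma inL2Mb (w f : R * R -> R) (C : R) : measurable_fun (Om : set T2) w ->
  (forall x, Om x -> `|w x| <= C) -> inL2 L f -> inL2 L (fun x => w x * f x).
Proof.
move=> mw bw Hf; apply/inL2P; split.
  by apply: measurable_funM => //; exact: inL2_meas.
apply: (le_integrable measurable_Omega _ _
  (integrableZl measurable_Omega (C ^+ 2) (inL2_sqr Hf))).
  apply/measurable_EFinP; apply: measurable_funX; apply: measurable_funM => //.
  exact: inL2_meas.
move=> x Ox /=; rewrite lee_fin exprMn (normrM (w x ^+ 2)) (normrM (C ^+ 2)) !normrX ler_wpM2r ?exprn_ge0 // lerXn2r ?nnegrE //.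
by rewrite (le_trans (bw _ Ox)) // ler_norm.
Qed.

Lemma inL2_bdd (w : R * R -> R) (C : R) : measurable_fun (Om : set T2) w ->
  (forall x, Om x -> `|w x| <= C) -> inL2 L w.
Proof.
move=> mw bw; apply/inL2P; split => //.
apply: measurable_bounded_integrable.
- exact: measurable_Omega.
- exact: mu_Omega.
- exact: measurable_funX.
- exists (C ^+ 2); split; first exact: num_real.
  move=> y Cy x Ox /=; rewrite (le_trans _ (ltW Cy)) // normrX.
  by rewrite lerXn2r ?nnegrE // ?(le_trans _ (bw _ Ox)) // bw.
Qed.

Lemma spC f g : sp f g = sp g f.
Proof. by rewrite /dotL2; under eq_Rintegral do rewrite mulrC. Qed.

Lemma spDl f g h : inL2 L f -> inL2 L g -> inL2 L h ->
  sp (fun x => f x + g x) h = sp f h + sp g h.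
Proof.
move=> Hf Hg Hh; rewrite /dotL2 -RintegralD; [|exact: measurable_Omega|exact: inL2_mul..].
by apply: eq_Rintegral => x _; rewrite mulrDl.
Qed.

Lemma spZl c f h : inL2 L f -> inL2 L h -> sp (fun x => c * f x) h = c * sp f h.
Proof.
move=> Hf Hh; rewrite /dotL2 -RintegralZl; [|exact: measurable_Omega|exact: inL2_mul..].
by apply: eq_Rintegral => x _; rewrite mulrA.
Qed.

Lemma spBl f g h : inL2 L f -> inL2 L g -> inL2 L h ->
  sp (fun x => f x - g x) h = sp f h - sp g h.
Proof.
move=> Hf Hg Hh; rewrite /dotL2 -RintegralB; [|exact: measurable_Omega|exact: inL2_mul..].
by apply: eq_Rintegral => x _; rewrite mulrBl.
Qed.

Lemma spBr f g h : inL2 L f -> inL2 L g -> inL2 L h ->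
  sp h (fun x => f x - g x) = sp h f - sp h g.
Proof. by move=> *; rewrite spC spBl // !(spC h). Qed.

Lemma spDr f g h : inL2 L f -> inL2 L g -> inL2 L h ->
  sp h (fun x => f x + g x) = sp h f + sp h g.
Proof. by move=> *; rewrite spC spDl // !(spC h). Qed.

Lemma spZr c f h : inL2 L f -> inL2 L h -> sp h (fun x => c * f x) = c * sp h f.
Proof. by move=> *; rewrite spC spZl // !(spC h). Qed.

Lemma sp_ge0 f : 0 <= sp f f.
Proof. by apply: Rintegral_ge0 => x _; rewrite -expr2 sqr_ge0. Qed.

Lemma sp_CS f g : inL2 L f -> inL2 L g -> sp f g ^+ 2 <= sp f f * sp g g.
Proof.
move=> Hf Hg.
have key t : 0 <= sp f f + 2 * t * sp f g + t ^+ 2 * sp g g.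
  have Hgt := inL2Z t Hg.
  have := sp_ge0 (fun x => f x + t * g x).
  rewrite spDl ?spDr ?spZl ?spZr //; try exact: inL2D.
  by rewrite (spC g f); congr (0 <= _); ring.
have [g0|g0] := eqVneq (sp g g) 0.
  rewrite g0 mulr0; have [->|fg0] := eqVneq (sp f g) 0; first by rewrite expr0n.
  have := key (- (sp f f + 1) / (2 * sp f g)); rewrite g0 mulr0 addr0.
  have -> : 2 * (- (sp f f + 1) / (2 * sp f g)) * sp f g = - (sp f f + 1) by field.
  by rewrite opprD addrA subrr add0r lerNr oppr0 ler10.
have := key (- sp f g / sp g g).
have -> : sp f f + 2 * (- sp f g / sp g g) * sp f g + (- sp f g / sp g g) ^+ 2 * sp g g
  = (sp f f * sp g g - sp f g ^+ 2) / sp g g by field.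
rewrite pmulr_lge0; last by rewrite invr_gt0 lt_def g0 sp_ge0.
by rewrite subr_ge0.
Qed.

Lemma sp_CS_sqrt f g : inL2 L f -> inL2 L g ->
  `|sp f g| <= Num.sqrt (sp f f) * Num.sqrt (sp g g).
Proof.
move=> Hf Hg; rewrite -sqrtrM ?sp_ge0 // -sqrtr_sqr.
by rewrite ler_sqrt ?mulr_ge0 ?sp_ge0 // sp_CS.
Qed.

(** Convergence of a sequence in [L^2(Omega)]. *)
Definition cvL2 (F : nat -> R * R -> R) f :=
  (forall n, inL2 L (F n)) /\
  (fun n => sp (fun x => F n x - f x) (fun x => F n x - f x)) @ \oo --> (0 : R).

Lemma cvL2_sp (F G : nat -> R * R -> R) f g : inL2 L f -> inL2 L g ->
  cvL2 F f -> cvL2 G g -> (fun n => sp (F n) (G n)) @ \oo --> sp f g.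
Proof.
move=> Hf Hg [HF cF] [HG cG].
pose a n : R := Num.sqrt (sp (fun x => F n x - f x) (fun x => F n x - f x)).
pose b n : R := Num.sqrt (sp (fun x => G n x - g x) (fun x => G n x - g x)).
have ca : a @ \oo --> (0 : R) by rewrite -(sqrtr0 R); apply: continuous_cvg => //; exact: sqrt_continuous.
have cb : b @ \oo --> (0 : R) by rewrite -(sqrtr0 R); apply: continuous_cvg => //; exact: sqrt_continuous.
have cE : (fun n => a n * b n + a n * Num.sqrt (sp g g) + Num.sqrt (sp f f) * b n) @ \oo --> (0 : R).
  have -> : (0 : R) = 0 * 0 + 0 * Num.sqrt (sp g g) + Num.sqrt (sp f f) * 0 by ring.
  apply: cvgD; first apply: cvgD; first exact: cvgM.
    by apply: cvgM => //; exact: cvg_cst.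
  by apply: cvgM => //; exact: cvg_cst.
apply: (squeeze_cvgr (f := fun n => sp f g - (a n * b n + a n * Num.sqrt (sp g g) + Num.sqrt (sp f f) * b n))
   (h := fun n => sp f g + (a n * b n + a n * Num.sqrt (sp g g) + Num.sqrt (sp f f) * b n))).
- apply: nearW => n; rewrite -ler_distl.
  have HFf := inL2B (HF n) Hf; have HGg := inL2B (HG n) Hg.
  have -> : sp (F n) (G n) - sp f g = sp (fun x => F n x - f x) (fun x => G n x - g x)
      + sp (fun x => F n x - f x) g + sp f (fun x => G n x - g x).
    by rewrite spBl // !spBr // spBl //; ring.
  apply: (le_trans (ler_normD _ _)); apply: lerD; last exact: sp_CS_sqrt.
  by apply: (le_trans (ler_normD _ _)); apply: lerD; exact: sp_CS_sqrt.
- rewrite -[X in _ --> X]subr0; apply: cvgB; first exact: cvg_cst.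
  exact: cE.
- rewrite -[X in _ --> X]addr0; apply: cvgD; first exact: cvg_cst.
  exact: cE.
Qed.

Lemma cvL2_cst f : inL2 L f -> cvL2 (fun=> f) f.
Proof.
move=> Hf; split => //.
have -> : sp (fun x => f x - f x) (fun x => f x - f x) = 0.
  by rewrite spBl ?subrr //; exact: inL2B.
exact: cvg_cst.
Qed.

Lemma cvL2Mb (w : R * R -> R) (C : R) F f : measurable_fun (Om : set T2) w ->
  (forall x, Om x -> `|w x| <= C) -> inL2 L f -> cvL2 F f ->
  cvL2 (fun n x => w x * F n x) (fun x => w x * f x).
Proof.
move=> mw bw Hf [HF cF]; split; first by move=> n; apply: inL2Mb bw _.
apply: (squeeze_cvgr (f := fun=> 0)
  (h := fun n => C ^+ 2 * sp (fun x => F n x - f x) (fun x => F n x - f x))).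
- apply: nearW => n; rewrite sp_ge0 /=.
  have H1 := inL2B (HF n) Hf; have H2 := inL2Mb mw bw H1.
  rewrite -RintegralZl; [|exact: measurable_Omega|exact: inL2_mul..].
  apply: le_Rintegral.
  + exact: measurable_Omega.
  + apply: (eq_integrable _ _ _ _ (inL2_mul H2 H2)); first exact: measurable_Omega.
    by move=> x _ /=; rewrite mulrBr.
  + apply: (eq_integrable _ _ _ _ (inL2_mul (inL2Z (C ^+ 2) H1) H1)); first exact: measurable_Omega.
    by move=> x _ /=; rewrite mulrA.
  + move=> x Ox; rewrite -mulrBr -!expr2 exprMn ler_wpM2r ?sqr_ge0 //.
    by rewrite -(real_normK (num_real (w x))) lerXn2r ?nnegrE // ?(le_trans _ (bw _ Ox)) // bw.
- exact: cvg_cst.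
- by rewrite -[X in _ --> X](mulr0 (C ^+ 2)); apply: cvgM => //; exact: cvg_cst.
Qed.

(** On [Omega], which has finite measure, uniformly bounded pointwise
    convergence implies convergence in [L^2]. *)
Lemma cvL2_dct (F : nat -> R * R -> R) f (C : R) : (forall n, measurable_fun (Om : set T2) (F n)) ->
  measurable_fun (Om : set T2) f ->
  (forall n x, Om x -> `|F n x| <= C) ->
  (forall x, Om x -> (fun n => F n x) @ \oo --> f x) -> cvL2 F f.
Proof.
move=> mF mf bF cF; split; first by move=> n; apply: inL2_bdd (bF n).
have bf x : Om x -> `|f x| <= C.
  move=> Ox; have h : `|F n x| @[n --> \oo] --> `|f x| by apply: cvg_norm; exact: cF.
  apply: (cvgr_to_le h); apply: nearW => n; exact: bF.
have mG n : measurable_fun (Om : set T2) (fun x => (F n x - f x) * (F n x - f x)).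
  by apply: measurable_funM; apply: measurable_funB.
have [] := @dominated_convergence _ _ _ mu Om measurable_Omega
  (fun n x => ((F n x - f x) * (F n x - f x))%:E) (cst 0%E) (fun=> ((C + C) ^+ 2)%:E).
- by move=> n; apply/measurable_EFinP.
- exact: measurable_cst.
- apply: aeW => x Ox; apply: cvg_EFin; first by apply: nearW.
  rewrite -[X in _ --> X](mulr0 0) /=.
  by apply: cvgM; rewrite -(subrr (f x)); apply: cvgB => //; try exact: cF; exact: cvg_cst.
- apply: (@measurable_bounded_integrable _ _ _ _ (fun=> (C + C) ^+ 2)).
  + exact: measurable_Omega.
  + exact: mu_Omega.
  + exact: measurable_cst.
  + by exists `|(C + C) ^+ 2|; split; [exact: num_real|move=> y Cy x _; exact: ltW].
- apply: aeW => x n Ox /=; rewrite lee_fin -expr2 normrX lerXn2r ?nnegrE //.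
    by rewrite addr_ge0 // (le_trans _ (bf _ Ox)).
  by rewrite (le_trans (ler_normB _ _)) // lerD // ?bF ?bf.
move=> _ _; rewrite integral0 => h.
rewrite -[X in _ --> X]/(fine 0%E).
by apply: fine_cvg.
Qed.

End L2.

Arguments measurable_Omega {R L}.
Arguments mu_Omega {R L}.

(** * Fields with several components and closures *)

Section Fields.
Variables (R : realType) (L : R).
Implicit Types (f g h : R * R -> R).
Notation T2 := (measurableTypeR R * measurableTypeR R)%type.
Notation mu := (@mu2 R).
Notation Om := (Omega L).
Notation sp := (dotL2 L).
Notation cvL2 := (cvL2 L).

Lemma ipE n (u v : field R n) : ip L u v = \sum_(i < n) sp (u i) (v i).
Proof. by []. Qed.

Lemma ip_ge0 n (u : field R n) : 0 <= ip L u u.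
Proof. by apply: sumr_ge0 => i _; exact: sp_ge0. Qed.

Lemma sqr_normL2 n (u : field R n) : normL2 L u ^+ 2 = ip L u u.
Proof. by rewrite sqr_sqrtr // ip_ge0. Qed.

Lemma sp_le_ip n (u : field R n) i : sp (u i) (u i) <= ip L u u.
Proof.
rewrite ipE (bigD1 i) //= lerDl; apply: sumr_ge0 => j _; exact: sp_ge0.
Qed.

Lemma sp_ae f f' g g' : inL2 L f -> inL2 L f' -> inL2 L g -> inL2 L g' ->
  ae_eq mu Om f f' -> ae_eq mu Om g g' -> sp f g = sp f' g'.
Proof.
move=> Hf Hf' Hg Hg' ef eg; congr fine; apply: ae_eq_integral.
- exact: measurable_Omega.
- by apply/measurable_EFinP; apply: measurable_funM; exact: inL2_meas.
- by apply/measurable_EFinP; apply: measurable_funM; exact: inL2_meas.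
- apply: filterS2 ef eg => x /= ef eg Ox; by rewrite ef // eg.
Qed.

(** The norm of [L^2(Omega)] is definite, up to equality almost everywhere. *)
Lemma sp_eq0 f : inL2 L f -> sp f f = 0 -> ae_eq mu Om f (cst 0).
Proof.
move=> Hf f0.
have intf := inL2_mul Hf Hf.
have h : (\int[mu]_(x in Om) (f x * f x)%:E = 0)%E.
  by rewrite -[LHS]fineK ?[fine _]f0 //; apply: integrable_fin_num => //; exact: measurable_Omega.
have h2 : (\int[mu]_(x in Om) `|(f x * f x)%:E| = 0)%E.
  by rewrite -[RHS]h; apply: eq_integral => x _; rewrite gee0_abs // lee_fin -expr2 sqr_ge0.
have mff : measurable_fun (Om : set T2) (fun x => (f x * f x)%:E).
  by apply/measurable_EFinP; apply: measurable_funM; exact: inL2_meas.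
move/(ae_eq_integral_abs mu measurable_Omega mff): h2.
apply: filterS => x /= fx Ox; move: (fx Ox) => /eqP.
by rewrite eqe mulf_eq0 orbb => /eqP.
Qed.

Lemma cvg_sumR (T I : Type) (F : set_system T) (FF : Filter F) (r : seq I)
    (f : I -> T -> R) (l : I -> R) :
  (forall i, f i @ F --> l i) ->
  (fun t => \sum_(i <- r) f i t) @ F --> \sum_(i <- r) l i.
Proof.
move=> h; elim: r => [|i r IH].
  by rewrite big_nil; under eq_fun do rewrite big_nil; exact: cvg_cst.
by rewrite big_cons; under eq_fun do rewrite big_cons; exact: cvgD.
Qed.

Lemma cvg0_of_le_harmonic (a : nat -> R) : (forall m, 0 <= a m) ->
  (forall m, a m <= m.+1%:R^-1) -> a @ \oo --> (0 : R).
Proof.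
move=> a0 am; apply: (squeeze_cvgr (f := fun=> 0) (h := fun m => m.+1%:R^-1)).
- by apply: nearW => m; rewrite a0 am.
- exact: cvg_cst.
- exact: cvg_harmonic.
Qed.

Lemma closureL2_of_seq n (S : set (field R n)) (phi : nat -> field R n) u :
  (forall i, inL2 L (u i)) -> (forall m, S (phi m)) ->
  (forall i, cvL2 (fun m => phi m i) (u i)) -> closureL2 L S u.
Proof.
move=> uL2 Sphi cphi; split => // e e0.
have c0 : (fun m => ip L (fsub (phi m) u) (fsub (phi m) u)) @ \oo --> (0 : R).
  have -> : (0 : R) = \sum_(i < n) 0 by rewrite big1.
  apply: cvg_sumR => i; exact: (cphi i).2.
have e2 : 0 < e ^+ 2 by rewrite exprn_gt0.
have /cvgr0_norm_lt /(_ _ e2)[m _ hm] := c0.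
exists (phi m) => //.
rewrite -(ltr_pXn2r (n := 2)) ?nnegrE ?sqrtr_ge0 ?(ltW e0) // sqr_normL2.
by have := hm m (leqnn m); rewrite ger0_norm // ip_ge0.
Qed.

Lemma closureH1_seq n (S : set (field R n)) u :
  (forall phi, S phi -> forall i, inL2 L (phi i)) ->
  (forall phi, S phi -> forall i j, inL2 L (fun x => 'D_(dir R j) (phi i) x)) ->
  closureH1 L S u ->
  exists phi : nat -> field R n, [/\ forall m, S (phi m),
    forall i, cvL2 (fun m => phi m i) (u i) &
    forall i j, cvL2 (fun m x => 'D_(dir R j) (phi m i) x) (wpartial L j (u i))].
Proof.
move=> SL2 SL2' [uH1 cu].
have /choice[phi hphi] : forall m, exists phi, S phi /\
    H1dist L phi (grad phi) u (wgrad L u) < m.+1%:R^-1.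
  by move=> m; have [//|phi Sphi h] := cu m.+1%:R^-1; exists phi.
have H m : normL2 L (fsub (phi m) u) ^+ 2 +
   \sum_(j < 2) normL2 L (fsub (grad (phi m) j) (wgrad L u j)) ^+ 2 <= m.+1%:R^-1.
  have [_ h] := hphi m.
  rewrite -[leLHS]sqr_sqrtr; last first.
    by rewrite addr_ge0 ?sqr_ge0 // sumr_ge0 // => *; rewrite sqr_ge0.
  apply: le_trans (ltW h).
  rewrite expr2 ler_piMl ?sqrtr_ge0 // (le_trans (ltW h)) //.
  by rewrite invf_le1 // ler1n.
exists phi; split; first by move=> m; case: (hphi m).
- move=> i; split; first by move=> m; apply: SL2; case: (hphi m).
  apply: cvg0_of_le_harmonic => m; first exact: sp_ge0.
  apply: le_trans (H m).
  apply: (le_trans (sp_le_ip (fsub (phi m) u) i)).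
  by rewrite -sqr_normL2 lerDl sumr_ge0 // => *; rewrite sqr_ge0.
- move=> i j; split; first by move=> m; apply: SL2'; case: (hphi m).
  apply: cvg0_of_le_harmonic => m; first exact: sp_ge0.
  apply: le_trans (H m).
  apply: (le_trans (sp_le_ip (fsub (grad (phi m) j) (wgrad L u j)) i)).
  rewrite -sqr_normL2 (bigD1 j) //= addrCA lerDl addr_ge0 ?sqr_ge0 //.
  by rewrite sumr_ge0 // => *; rewrite sqr_ge0.
Qed.

(** A Cauchy-Schwarz inequality for fields; the sum on the right is [n] times
    the product of the norms, which is all that the estimates below need. *)
Lemma ip_sqrt_CS n (u v : field R n) : (forall i, inL2 L (u i)) ->
  (forall i, inL2 L (v i)) -> `|ip L u v| <= \sum_(i < n) normL2 L u * normL2 L v.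
Proof.
move=> Hu Hv; rewrite ipE (le_trans (ler_norm_sum _ _ _)) //; apply: ler_sum => i _.
rewrite (le_trans (sp_CS_sqrt (Hu i) (Hv i))) // ler_pM ?sqrtr_ge0 //.
  by rewrite ler_wsqrtr // sp_le_ip.
by rewrite ler_wsqrtr // sp_le_ip.
Qed.

Lemma inH1_wpartial f j : inH1 L f ->
  inL2 L (wpartial L j f) /\ weak_partial L j f (wpartial L j f).
Proof.
move=> [_ /(_ j)[g Hg Wg]]; rewrite /wpartial.
by have := @xgetPex _ (cst 0) [set g | inL2 L g /\ weak_partial L j f g]; apply; exists g.
Qed.

End Fields.

(** * Smooth functions of two variables *)

Section Smooth.
Variables (R : realType).
Implicit Types (f g h : R * R -> R) (a b : R -> R) (x : R * R).
Notation d1 := (@ord0 1).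
Notation d2 := (@ord_max 1).
Notation D j f := (fun x => 'D_(dir R j) f x).
Notation DD j f x := ('D_(dir R j) f x).

Lemma ord2P (j : 'I_2) : j = ord0 \/ j = ord_max.
Proof. by case: j => [[|[|//]] p]; [left|right]; exact: val_inj. Qed.

(** The partial derivatives in the directions [dir] are derivatives of
    functions of one variable; this is the identity of difference quotients
    behind it. *)
Lemma diff_quot_fst f x (s : R) :
  ((f \o shift x) (s *: dir R ord0) - f x) = (((fun t => f (t, x.2)) \o shift x.1) (s *: 1) - f x).
Proof.
rewrite /= /dir /=; congr (f _ - f x).
case: x => x1 x2 /=; change (s *: (1, 0) + (x1, x2) = (s *: 1 + x1, x2)).
by apply: injective_projections; rewrite /= ?scaler0 ?add0r.
Qed.

Lemma diff_quot_snd f x (s : R) :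
  ((f \o shift x) (s *: dir R ord_max) - f x) = (((fun t => f (x.1, t)) \o shift x.2) (s *: 1) - f x).
Proof.
rewrite /= /dir /=; congr (f _ - f x).
case: x => x1 x2 /=; change (s *: (0, 1) + (x1, x2) = (x1, s *: 1 + x2)).
by apply: injective_projections; rewrite /= ?scaler0 ?add0r.
Qed.

Lemma derivable_fst f x : derivable f x (dir R ord0) <-> derivable (fun t => f (t, x.2)) x.1 1.
Proof.
rewrite /derivable; under eq_fun do rewrite diff_quot_fst.
by under [in X in _ <-> X]eq_fun do rewrite -[X in _ - X]/(f (x.1, x.2)) -surjective_pairing.
Qed.

Lemma derivable_snd f x : derivable f x (dir R ord_max) <-> derivable (fun t => f (x.1, t)) x.2 1.
Proof.
rewrite /derivable; under eq_fun do rewrite diff_quot_snd.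
by under [in X in _ <-> X]eq_fun do rewrite -[X in _ - X]/(f (x.1, x.2)) -surjective_pairing.
Qed.

Lemma derive_fst f x : 'D_(dir R ord0) f x = 'D_1 (fun t => f (t, x.2)) x.1.
Proof.
rewrite /derive; under eq_fun do rewrite diff_quot_fst.
by under [in X in _ = X]eq_fun do rewrite -[X in _ - X]/(f (x.1, x.2)) -surjective_pairing.
Qed.

Lemma derive_snd f x : 'D_(dir R ord_max) f x = 'D_1 (fun t => f (x.1, t)) x.2.
Proof.
rewrite /derive; under eq_fun do rewrite diff_quot_snd.
by under [in X in _ = X]eq_fun do rewrite -[X in _ - X]/(f (x.1, x.2)) -surjective_pairing.
Qed.

Lemma derive1_const (c t : R) : 'D_1 (fun _ : R => c) t = 0.
Proof. exact: derive_cst. Qed.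

Lemma derivable1_const (c t : R) : derivable (fun _ : R => c) t 1.
Proof. exact: derivable_cst. Qed.

Lemma cvg_pairR (T : topologicalType) (f g : T -> R) (t : T) :
  {for t, continuous f} -> {for t, continuous g} ->
  {for t, continuous (fun t => (f t, g t))}.
Proof. by move=> cf cg; apply: (cvg_pair (G := nbhs (f t)) (H := nbhs (g t))). Qed.

Lemma smooth_cont f : smooth f -> continuous f.
Proof. by move=> /(_ 0%N). Qed.

Lemma smooth_derivable f x j : smooth f -> derivable f x (dir R j).
Proof. by move=> /(_ 1%N) /= []. Qed.

Lemma smooth_partial f j : smooth f -> smooth (D j f).
Proof. by move=> sf k; have [_] := sf k.+1; exact. Qed.

(** A class of continuous functions with partial derivatives that is stable
    under these consists of smooth functions. *)
Lemma smooth_coind (P : (R * R -> R) -> Prop) :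
  (forall f, P f -> [/\ continuous f, forall x j, derivable f x (dir R j) &
     forall j, P (D j f)]) -> forall f, P f -> smooth f.
Proof.
move=> H f Pf k; elim: k f Pf => [|k IH] f Pf; first by have [] := H _ Pf.
by have [_ df PD] := H _ Pf; split=> // j; apply: IH.
Qed.

Lemma smooth_cst (c : R) : smooth (fun _ : R * R => c).
Proof.
apply: (smooth_coind (P := fun f => exists c, f = fun=> c)); last by exists c.
move=> _ [e ->]; split.
- exact: cst_continuous.
- by move=> x j; exact: derivable_cst.
- by move=> j; exists 0; apply/funext => x; rewrite derive_cst.
Qed.

Lemma CkD k f g : Ck k f -> Ck k g -> Ck k (fun x => f x + g x).
Proof.
elim: k f g => [|k IH] f g /=; first by move=> cf cg x; apply: cvgD; [exact: cf|exact: cg].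
move=> [df Cf] [dg Cg]; split=> [x j|j]; first exact: derivableD.
have -> : D j (fun x => f x + g x) = (fun x => D j f x + D j g x).
  by apply/funext => x; exact: deriveD.
exact: IH.
Qed.

Lemma smoothD f g : smooth f -> smooth g -> smooth (fun x => f x + g x).
Proof. by move=> sf sg k; exact: CkD. Qed.

Lemma partialD f g j x : smooth f -> smooth g -> DD j (fun x => f x + g x) x = DD j f x + DD j g x.
Proof. by move=> sf sg; apply: deriveD; exact: smooth_derivable. Qed.

Lemma partialM f g j x : smooth f -> smooth g ->
  DD j (fun x => f x * g x) x = f x * DD j g x + g x * DD j f x.
Proof. by move=> sf sg; apply: deriveM; exact: smooth_derivable. Qed.

Lemma smoothM f g : smooth f -> smooth g -> smooth (fun x => f x * g x).
Proof.
move=> sf sg k; elim: k f g sf sg => [|k IH] f g sf sg /=.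
  by move=> x; apply: cvgM; exact: smooth_cont.
split=> [x j|j]; first by apply: derivableM; exact: smooth_derivable.
have -> : D j (fun x => f x * g x) = (fun x => f x * D j g x + g x * D j f x).
  by apply/funext => x; exact: partialM.
by apply: CkD; apply: IH => //; exact: smooth_partial.
Qed.

Lemma smoothZ (c : R) f : smooth f -> smooth (fun x => c * f x).
Proof. by move=> sf; apply: smoothM => //; exact: smooth_cst. Qed.

Lemma partialZ (c : R) f j x : smooth f -> DD j (fun x => c * f x) x = c * DD j f x.
Proof.
move=> sf; rewrite partialM //; last exact: smooth_cst.
by rewrite /= derive_cst mulr0 addr0.
Qed.

Lemma smooth_sum (I : Type) (r : seq I) (F : I -> R * R -> R) :
  (forall i, smooth (F i)) -> smooth (fun x => \sum_(i <- r) F i x).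
Proof.
move=> sF; elim: r => [|i r IH].
  by under eq_fun do rewrite big_nil; exact: smooth_cst.
by under eq_fun do rewrite big_cons; exact: smoothD.
Qed.

Lemma partial_sum (I : Type) (r : seq I) (F : I -> R * R -> R) j x :
  (forall i, smooth (F i)) -> DD j (fun x => \sum_(i <- r) F i x) x = \sum_(i <- r) DD j (F i) x.
Proof.
move=> sF; elim: r => [|i r IH].
  by under eq_fun do rewrite big_nil; rewrite derive_cst big_nil.
under eq_fun do rewrite big_cons.
by rewrite partialD //; [rewrite big_cons IH|exact: smooth_sum].
Qed.

(** If a class of functions of one variable is stable under derivation, its
    members define smooth functions of either coordinate of the plane. *)
Lemma smooth_line (Q : (R -> R) -> Prop) :
  (forall a, Q a -> (forall t, derivable a t 1) /\ Q (fun t => 'D_1 a t)) ->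
  forall a, Q a -> smooth (fun x => a x.1) /\ smooth (fun x => a x.2).
Proof.
move=> H a Qa.
have H0 b t : Q b -> derivable b t 1 by case/H.
have cb b : Q b -> continuous b.
  by move=> Qb t; apply: differentiable_continuous; apply/derivable1_diffP; exact: H0.
split.
- apply: (smooth_coind (P := fun f => (exists2 b, Q b & f = fun x => b x.1) \/ f = fun=> 0)); last by left; exists a.
  move=> _ [[b Qb ->]| ->]; last first.
    split; [exact: cst_continuous|by move=> *; exact: derivable_cst|].
    by move=> j; right; apply/funext => x; rewrite derive_cst.
  split.
  + by move=> x; apply: (@continuous_comp _ _ _ fst); [exact: cvg_fst|exact: cb].
  + move=> x j; case: (ord2P j) => ->; first by apply/derivable_fst; exact: H0.
    by apply: (derivable_snd _ _).2 => /=; exact: derivable1_const.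
  + move=> j; case: (ord2P j) => ->; [left|right].
      by exists (fun t => 'D_1 b t); [case: (H _ Qb)|apply/funext => x; rewrite derive_fst].
    by apply/funext => x; rewrite derive_snd /=; exact: derive1_const.
- apply: (smooth_coind (P := fun f => (exists2 b, Q b & f = fun x => b x.2) \/ f = fun=> 0)); last by left; exists a.
  move=> _ [[b Qb ->]| ->]; last first.
    split; [exact: cst_continuous|by move=> *; exact: derivable_cst|].
    by move=> j; right; apply/funext => x; rewrite derive_cst.
  split.
  + by move=> x; apply: (@continuous_comp _ _ _ snd); [exact: cvg_snd|exact: cb].
  + move=> x j; case: (ord2P j) => ->; last by apply/derivable_snd; exact: H0.
    by apply: (derivable_fst _ _).2 => /=; exact: derivable1_const.
  + move=> j; case: (ord2P j) => ->; [right|left].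
      by apply/funext => x; rewrite derive_fst /=; exact: derive1_const.
    by exists (fun t => 'D_1 b t); [case: (H _ Qb)|apply/funext => x; rewrite derive_snd].
Qed.

Lemma partial_freeze1 f s x : DD d1 (fun x => f (s, x.2)) x = 0.
Proof. by rewrite derive_fst /=; exact: derive1_const. Qed.

Lemma partial_freeze2 f s x : DD d2 (fun x => f (s, x.2)) x = DD d2 f (s, x.2).
Proof. by rewrite !derive_snd. Qed.

Lemma smooth_freeze f (s : R) : smooth f -> smooth (fun x => f (s, x.2)).
Proof.
move=> sf; apply: (smooth_coind (P := fun h => exists2 g, smooth g & h = fun x => g (s, x.2))); last by exists f.
move=> _ [g sg ->]; split.
- move=> x; apply: (@continuous_comp _ _ _ (fun x : R * R => (s, x.2))); last exact: smooth_cont.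
  by apply: cvg_pairR; [exact: cvg_cst|exact: cvg_snd].
- move=> x j; case: (ord2P j) => ->.
    by apply: (derivable_fst _ _).2 => /=; exact: derivable1_const.
  by apply/derivable_snd; have /derivable_snd := @smooth_derivable _ (s, x.2) ord_max sg.
- move=> j; case: (ord2P j) => ->.
    by exists (fun=> 0); [exact: smooth_cst|apply/funext => x; exact: partial_freeze1].
  by exists (D d2 g); [exact: smooth_partial|apply/funext => x; exact: partial_freeze2].
Qed.

Lemma partial_shift f (s : R * R) j x : DD j (fun x => f (x + s)) x = DD j f (x + s).
Proof.
by rewrite /derive /=; under [in RHS]eq_fun do rewrite addrA.
Qed.

Lemma smooth_shift f (s : R * R) : smooth f -> smooth (fun x => f (x + s)).
Proof.
move=> sf; apply: (smooth_coind (P := fun h => exists2 g, smooth g & h = fun x => g (x + s))); last by exists f.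
move=> _ [g sg ->]; split.
- move=> x; apply: (@continuous_comp _ _ _ (fun x : R * R => x + s)); last exact: smooth_cont.
  by apply: cvgD; [exact: cvg_id|exact: cvg_cst].
- move=> x j; have := @smooth_derivable _ (x + s) j sg.
  by rewrite /derivable /=; under eq_fun do rewrite addrA.
- by move=> j; exists (D j g); [exact: smooth_partial|apply/funext => x; exact: partial_shift].
Qed.

Lemma smooth_trig (p q w : R) : 
  smooth (fun x : R * R => p * cos (w * x.1) + q * sin (w * x.1)) /\
  smooth (fun x : R * R => p * cos (w * x.2) + q * sin (w * x.2)).
Proof.
apply: (@smooth_line (fun a => exists p q, a = fun t => p * cos (w * t) + q * sin (w * t)) _
  (fun t => p * cos (w * t) + q * sin (w * t))); last by exists p, q.
move=> _ [{}p [{}q ->]].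
have H (t : R) : is_derive t (1 : R) (fun t => p * cos (w * t) + q * sin (w * t))
    ((q * w) * cos (w * t) + (- p * w) * sin (w * t)).
  apply: is_derive_eq; rewrite /GRing.scale /=; ring.
split=> [t|]; first by have [] := H t.
by exists (q * w), (- p * w); apply/funext => t; rewrite derive_val.
Qed.

End Smooth.

(** * Continuous integrands and integration by parts *)

Section Gauss.
Variables (R : realType) (L : R).
Hypothesis L_gt0 : 0 < L.
Implicit Types (f g h F : R * R -> R) (x : R * R).
Notation T2 := (measurableTypeR R * measurableTypeR R)%type.
Notation mu := (@mu2 R).
Notation leb := (@lebesgue_measure R).
Notation Om := (Omega L).
Notation DD j f x := ('D_(dir R j) f x).

Lemma open_measurable2 (U : set (R * R)) : open U -> measurable (U : set T2).
Proof.
move=> oU.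
pose rect (q : (rat * rat) * (rat * rat)) : set (R * R) :=
  `]ratr q.1.1, ratr q.1.2[ `*` `]ratr q.2.1, ratr q.2.2[.
pose F q := if `[< rect q `<=` U >] then rect q else set0.
have -> : U = \bigcup_q F q.
  apply/seteqP; split; last first.
    by move=> x [q _]; rewrite /F; case: asboolP => // h /h.
  move=> [x y] Uxy.
  have : nbhs (x, y) U by apply: open_nbhs_nbhs; split.
  case=> -[A B] /= [/nbhs_ballP[e1 /= e10 A1] /nbhs_ballP[e2 /= e20 B2]] AB.
  have [p1 hp1] := @rat_in_itvoo R (x - e1) x (ltac:(by lra)).
  have [p2 hp2] := @rat_in_itvoo R x (x + e1) (ltac:(by lra)).
  have [q1 hq1] := @rat_in_itvoo R (y - e2) y (ltac:(by lra)).
  have [q2 hq2] := @rat_in_itvoo R y (y + e2) (ltac:(by lra)).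
  move: hp1 hp2 hq1 hq2; rewrite !in_itv /= => /andP[? ?] /andP[? ?] /andP[? ?] /andP[? ?].
  exists ((p1, p2), (q1, q2)) => //; rewrite /F asboolT.
    by split; rewrite /= in_itv /=; apply/andP.
  move=> [s t] [] /=; rewrite !in_itv /= => /andP[? ?] /andP[? ?].
  apply: AB; split => /=.
    by apply: A1; rewrite /ball /= ltr_norml; apply/andP; split; lra.
  by apply: B2; rewrite /ball /= ltr_norml; apply/andP; split; lra.
apply: countable_bigcupT_measurable; first exact: countableP.
move=> q; rewrite /F; case: ifP => _; last exact: measurable0.
by apply: measurableX; exact: measurable_itv.
Qed.

Lemma continuous_measurable2 f : continuous f -> measurable_fun [set: T2] f.
Proof.
move=> cf; apply: (measurability (RGenOInfty.G (R := R))).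
  exact: RGenOInfty.measurableE.
move=> _ [_ [a -> <-]]; rewrite setTI; apply: open_measurable2.
by apply: open_comp; [move=> x _; exact: cf|exact: rray_open].
Qed.

Lemma continuous_measOm f : continuous f -> measurable_fun (Om : set T2) f.
Proof. by move=> /continuous_measurable2; apply: measurable_funS. Qed.

Lemma continuous_bddOm f : continuous f -> exists C : R, forall x, Om x -> `|f x| <= C.
Proof.
move=> cf.
have cK : compact (`[0, L] `*` `[0, 1] : set (R * R)).
  by apply: compact_setX; exact: segment_compact.
have [M [_ hM]] : bounded_set (f @` (`[0, L] `*` `[0, 1])).
  apply: compact_bounded; apply: continuous_compact => //.
  by apply: continuous_subspaceT.
exists (M + 1) => -[x y] [/= hx hy]; apply: (hM (M + 1)); first by rewrite ltrDl.
exists (x, y) => //; split => /=; apply: subset_itv_oo_cc => //.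
Qed.

Lemma continuous_inL2 f : continuous f -> inL2 L f.
Proof.
move=> cf; have [C hC] := continuous_bddOm cf.
by apply: (inL2_bdd (C := C)) => //; exact: continuous_measOm.
Qed.

Lemma smooth_inL2 f : smooth f -> inL2 L f.
Proof. by move=> sf; apply: continuous_inL2; exact: smooth_cont. Qed.

(** The integral of a derivative vanishes when the primitive takes the same
    value at both ends. *)
Lemma integral_derive_eq0 (F f : R -> R) (a b : R) : a < b ->
  (forall t : R, is_derive t (1 : R) F (f t)) -> continuous f -> F a = F b ->
  (\int[leb]_(t in `]a, b[) (f t)%:E = 0)%E.
Proof.
move=> ab dF cf Fab.
have cF : continuous F.
  move=> t; apply: differentiable_continuous; apply/derivable1_diffP.
  by have [] := dF t.
have mf := continuous_measurable_fun cf.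
have mfE D : measurable_fun D (EFin \o f).
  by apply/measurable_EFinP; apply: measurable_funS mf.
rewrite (integral_itv_obnd_cbnd (mfE _)) (integral_itv_bndo_bndc (mfE _)).
rewrite (continuous_FTC2 (F := F) ab) ?Fab ?subee //.
- exact: continuous_subspaceT.
- split; first by move=> t _; have [] := dF t.
    by apply: cvg_at_right_filter; exact: cF.
  by apply: cvg_at_left_filter; exact: cF.
- by move=> t _; rewrite derive1E derive_val.
Qed.

Lemma integrable_Om f : continuous f -> mu.-integrable Om (EFin \o f).
Proof.
move=> cf; have [C hC] := continuous_bddOm cf.
apply: measurable_bounded_integrable; [exact: measurable_Omega|exact: mu_Omega|exact: continuous_measOm|].
exists C; split; first exact: num_real.
by move=> y Cy x Ox /=; rewrite (le_trans (hC _ Ox)) // ltW.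
Qed.

(** The divergence theorem on the rectangle, for functions with equal values
    on opposite sides. *)
Lemma gauss F (j : 'I_2) : smooth F -> (forall y, F (0, y) = F (L, y)) ->
  (forall s, F (s, 0) = F (s, 1)) -> \int[mu]_(x in Om) (DD j F x) = 0.
Proof.
move=> sF F1 F2; rewrite /Rintegral.
suff -> : (\int[mu]_(x in Om) (DD j F x)%:E = 0)%E by [].
have cD : continuous (fun x => DD j F x) by apply: smooth_cont; exact: smooth_partial.
have int1 : mu.-integrable [set: T2] ((fun x => (DD j F x)%:E) \_ Om).
  by apply/(integrable_mkcond _ measurable_Omega); exact: integrable_Om.
rewrite integral_mkcond.
have pt (x y : R) : ((fun x => (DD j F x)%:E) \_ Om) (x, y) =
   if (x \in `]0, L[) && (y \in `]0, 1[) then (DD j F (x, y))%:E else 0%E.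
  rewrite patchE; case: ifPn => [/set_mem[/= -> ->] //|].
  move=> /negP h; case: ifPn => // /andP[hx hy]; case: h; apply/mem_set; split => //.
have restr (a b : R) (g : R -> R) (P : R -> bool) : (forall t, P t = (t \in `]a, b[)) ->
    (\int[leb]_t (if P t then (g t)%:E else 0))%E = (\int[leb]_(t in `]a, b[) (g t)%:E)%E.
  move=> hP; rewrite [RHS]integral_mkcond; apply: eq_integral => t _.
  by rewrite patchE mem_setE hP.
case: (ord2P j) => ej; rewrite ej in cD int1 pt *.
- rewrite -(integral21_prod_meas1 int1); apply: integral0_eq => y _.
  rewrite /fubini_G; under eq_integral do rewrite pt.
  have [hy|hy] := boolP (y \in `]0, 1[); last by apply: integral0_eq => t _; rewrite andbF.
  rewrite (restr 0 L (fun t => DD ord0 F (t, y))); last by move=> t; rewrite andbT.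
  apply: (@integral_derive_eq0 (fun t => F (t, y))) => //.
  + move=> t; have /derivable_fst /= h := @smooth_derivable _ F (t, y) ord0 sF.
    by apply: DeriveDef => //; rewrite derive_fst.
  + move=> t; apply: (@continuous_comp _ _ _ (fun t => (t, y)) (fun x => DD ord0 F x)); last exact: cD.
    by apply: cvg_pairR; [exact: cvg_id|exact: cvg_cst].
- rewrite -(integral12_prod_meas1 int1); apply: integral0_eq => s _.
  rewrite /fubini_F; under eq_integral do rewrite pt.
  have [hy|hy] := boolP (s \in `]0, L[); last by apply: integral0_eq => t _.
  rewrite (restr 0 1 (fun t => DD ord_max F (s, t))) //.
  apply: (@integral_derive_eq0 (fun t => F (s, t))) => //.
  + move=> t; have /derivable_snd /= h := @smooth_derivable _ F (s, t) ord_max sF.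
    by apply: DeriveDef => //; rewrite derive_snd.
  + move=> t; apply: (@continuous_comp _ _ _ (fun t => (s, t)) (fun x => DD ord_max F x)); last exact: cD.
    by apply: cvg_pairR; [exact: cvg_cst|exact: cvg_id].
Qed.

Lemma int_by_parts f g (j : 'I_2) : smooth f -> smooth g ->
  (forall y, f (0, y) * g (0, y) = f (L, y) * g (L, y)) ->
  (forall s, f (s, 0) * g (s, 0) = f (s, 1) * g (s, 1)) ->
  dotL2 L f (fun x => DD j g x) = - dotL2 L (fun x => DD j f x) g.
Proof.
move=> sf sg h1 h2.
have := gauss j (smoothM sf sg) h1 h2.
have -> : (fun x => DD j (fun x => f x * g x) x) = (fun x => f x * DD j g x + DD j f x * g x).
  by apply/funext => x; rewrite partialM // (mulrC (g x)).
rewrite RintegralD; [|exact: measurable_Omega| |].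
- by move=> /eqP; rewrite addr_eq0 => /eqP.
- by apply: inL2_mul; apply: smooth_inL2 => //; exact: smooth_partial.
- by apply: inL2_mul; apply: smooth_inL2 => //; exact: smooth_partial.
Qed.

End Gauss.

(** * The functions p(1/t) exp(-1/t) *)

Section Bump.
Variables (R : realType).
Implicit Types (p q : {poly R}) (t u : R).

(** The functions [p(1/t) exp(-1/t)], continued by [0] to [t <= 0]; with
    polynomial [p] they form a class stable under derivation. *)
Definition bump p t : R := if 0 < t then p.[t^-1] * expR (- t^-1) else 0.

Lemma powexp_le n u : 0 <= u -> u ^+ n * expR (- u) <= n`!%:R.
Proof.
move=> u0; rewrite expRN ler_pdivrMr ?expR_gt0 //.
case: n => [|n]; first by rewrite fact0 expr0 mul1r -expR0 ler_expR.
have := expR_ge1Dxn n u0 => h.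
have f0 : 0 < n.+1`!%:R :> R by rewrite ltr0n fact_gt0.
rewrite mulrC -ler_pdivrMr //; apply: le_trans h; by rewrite lerDr.
Qed.

Lemma polyexp_le p : exists C : R, forall u, 0 <= u -> `|p.[u]| * expR (- u) <= C.
Proof.
exists (\sum_(i < size p) `|p`_i| * i`!%:R) => u u0.
rewrite horner_coef; apply: (le_trans (y := (\sum_(i < size p) `|p`_i * u ^+ i|) * expR (- u))).
  by rewrite ler_wpM2r ?expR_ge0 // ler_norm_sum.
rewrite mulr_suml; apply: ler_sum => i _.
rewrite normrM normrX (ger0_norm u0) -mulrA ler_wpM2l //.
exact: powexp_le.
Qed.

(** Flatness at the origin, which gives the derivative there. *)
Lemma bump_le p : exists C : R, forall t, `|bump p t| <= C * t ^+ 2.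
Proof.
have [C hC] := polyexp_le (p * 'X^2).
have C0 : 0 <= C by apply: le_trans (hC 0 _) => //; rewrite mulr_ge0 // expR_ge0.
exists C => t; rewrite /bump; case: ifPn => t0; last by rewrite normr0 mulr_ge0 ?sqr_ge0.
have := hC t^-1; rewrite invr_ge0 (ltW t0) => /(_ isT).
rewrite hornerM hornerXn normrM exprVn (gtr0_norm (x := (t ^+ 2)^-1)) ?invr_gt0 ?exprn_gt0 //.
rewrite normrM (gtr0_norm (expR_gt0 _)) mulrAC ler_pdivrMr // exprn_gt0 //.
Qed.

(** The polynomial with which [bump (dbump p)] is the derivative of [bump p]. *)
Definition dbump p := 'X^2 * (p - p^`()).

Lemma is_derive_bump p t : is_derive t (1 : R) (bump p) (bump (dbump p) t).
Proof.
have [t0|t0|t0] := ltgtP t 0.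
- have e : {near t, (fun=> 0) =1 bump p}.
    near=> s; rewrite /bump ltNge; suff /ltW -> : s < 0 by [].
    by near: s; exact: lt_nbhsl.
  rewrite {2}/bump ltNge (ltW t0) /=.
  apply: (near_eq_is_derive e); exact: is_derive_cst.
- have e : {near t, (fun s => p.[s^-1] * expR (- s^-1)) =1 bump p}.
    near=> s; rewrite /bump; suff -> : 0 < s by [].
    by near: s; exact: lt_nbhsr.
  apply: (near_eq_is_derive e).
  have dV : is_derive t (1 : R) (fun s : R => s^-1) (- (t ^- 2)).
    apply: DeriveDef; first by apply: derivableV; rewrite ?gt_eqF //; exact: derivable_id.
    by rewrite deriveV ?gt_eqF // derive_id /GRing.scale /= mulr1.
  have d1 : is_derive t (1 : R) (fun s : R => p.[s^-1]) (p^`().[t^-1] * (- (t ^- 2))).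
    by apply: (is_derive1_comp (f := horner p) (g := fun s => s^-1)).
  have d2 : is_derive t (1 : R) (fun s : R => expR (- s^-1)) (expR (- t^-1) * (t ^- 2)).
    by apply: is_derive_eq; rewrite opprK.
  apply: is_derive_eq.
  rewrite /GRing.scale /= {1}/bump t0 /dbump hornerM hornerXn hornerD hornerN exprVn; ring.
- rewrite t0 {2}/bump ltxx.
  have [C hC] := bump_le p.
  have b0 : bump p 0 = 0 by rewrite /bump ltxx.
  have lim0 : (fun h => h^-1 *: ((bump p \o shift 0) (h *: 1) - bump p 0)) @ 0^' --> (0 : R).
    apply/cvgr0Pnorm_lt => e e0.
    near=> h.
    have h0 : h != 0 by near: h; exact: nbhs_dnbhs_neq.
    rewrite b0 subr0 /= addr0 /GRing.scale /= mulr1 normrM normfV.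
    rewrite ltr_pdivrMl ?normr_gt0 //; apply: le_lt_trans (hC h) _.
    rewrite -real_normK ?num_real // expr2 mulrA mulrC ltr_pM2l ?normr_gt0 //.
    apply: (@le_lt_trans _ _ ((`|C| + 1) * `|h|)).
      by rewrite ler_wpM2r // (le_trans (ler_norm _)) // lerDl.
    rewrite mulrC -ltr_pdivlMr; last by rewrite ltr_wpDl.
    by near: h; apply: dnbhs0_lt; rewrite divr_gt0 // ltr_wpDl.
  by apply: DeriveDef; [apply/cvg_ex; exists 0|exact: cvg_lim].
Unshelve. all: by end_near. Qed.

Lemma smooth_bump p (c n m : R) :
  smooth (fun x : R * R => c * bump p (n * x.1 + m)) /\
  smooth (fun x : R * R => c * bump p (n * x.2 + m)).
Proof.
apply: (@smooth_line R (fun a => exists c p, a = fun t => c * bump p (n * t + m)) _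
  (fun t => c * bump p (n * t + m))); last by exists c, p.
move=> _ [{}c [{}p ->]].
have H t : is_derive t (1 : R) (fun t => c * bump p (n * t + m)) (c * n * bump (dbump p) (n * t + m)).
  have d1 : is_derive t (1 : R) (fun t => bump p (n * t + m)) (bump (dbump p) (n * t + m) * n).
    apply: (is_derive1_comp (f := bump p) (g := fun t => n * t + m)).
      exact: is_derive_bump.
    by apply: is_derive_eq; rewrite /GRing.scale /=; ring.
  by apply: is_derive_eq; rewrite /GRing.scale /=; ring.
split=> [t|]; first by have [] := H t.
by exists (c * n), (dbump p); apply/funext => t; rewrite derive_val.
Qed.

End Bump.

(** * Smooth cut-offs of an interval *)

Section Cutoff.
Variables (R : realType).

(** A smooth function with values in [[0, 1]], supported in the interval
    [[a + 1/(n+1), b - 1/(n+1)]], that tends to the indicator function of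
    [(a, b)] as [n] tends to infinity. *)
Definition hat (n : nat) (a b t : R) : R :=
  bump 1 (n.+1%:R * (t - a) - 1) * bump 1 (n.+1%:R * (b - t) - 1).

Lemma bump1E t : bump 1 t = if 0 < t then expR (- t^-1) else 0 :> R.
Proof. by rewrite /bump hornerC mul1r. Qed.

Lemma bump1_ge0 t : 0 <= bump 1 t :> R.
Proof. by rewrite bump1E; case: ifP => // _; rewrite expR_ge0. Qed.

Lemma bump1_le1 t : bump 1 t <= 1 :> R.
Proof.
by rewrite bump1E; case: ifPn => // t0; rewrite expR_le1 oppr_le0 invr_ge0 ltW.
Qed.

Lemma bump1_cvg (s : R) : (fun n : nat => bump 1 (n.+1%:R * s - 1)) @ \oo --> ((0 < s)%R%:R : R).
Proof.
have [s0|s0] := ltP 0 s; last first.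
  suff -> : (fun n : nat => bump 1 (n.+1%:R * s - 1)) = (fun=> 0 : R) by exact: cvg_cst.
  apply/funext => n; rewrite bump1E ifF //; apply/negbTE; rewrite -leNgt subr_le0.
  by apply: le_trans ler01; rewrite mulr_ge0_le0.
apply: (squeeze_cvgr (f := fun n => 1 - (2 / s) * n.+1%:R^-1) (h := fun=> 1)).
- near=> n.
  rewrite bump1_le1 andbT bump1E.
  have hn : 2 / s < n.+1%:R.
    near: n; have [N hN] : exists N : nat, 2 / s < N%:R.
      by exists (Num.bound (2 / s)); rewrite archi_boundP // divr_ge0 // ltW.
    by exists N => // n /= Nn; apply: (lt_le_trans hN); rewrite ler_nat leqW.
  have h2 : 2 < n.+1%:R * s by rewrite -ltr_pdivrMr.
  have -> : 0 < n.+1%:R * s - 1 by lra.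
  apply: le_trans (expR_ge1Dx _); rewrite lerD2l lerN2.
  have -> : 2 / s / n.+1%:R = (n.+1%:R * s / 2)^-1 by field; rewrite gt_eqF //= pnatr_eq0.
  by rewrite lef_pV2 ?posrE; lra.
- rewrite -[X in _ --> X]subr0 -[X in _ --> _ - X](mulr0 (2 / s)).
  apply: cvgB; first exact: cvg_cst.
  by apply: cvgM; [exact: cvg_cst|exact: cvg_harmonic].
- exact: cvg_cst.
Unshelve. all: by end_near. Qed.

Lemma hat_ge0 n a b t : 0 <= hat n a b t.
Proof. by rewrite mulr_ge0 // bump1_ge0. Qed.

Lemma hat_le1 n a b t : hat n a b t <= 1.
Proof. by rewrite mulr_ile1 // ?bump1_ge0 // bump1_le1. Qed.

Lemma hat_cvg (a b t : R) : (fun n => hat n a b t) @ \oo --> ((a < t < b)%R%:R : R).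
Proof.
have := cvgM (bump1_cvg (s := t - a)) (bump1_cvg (s := b - t)).
by move=> /(_ _); rewrite !subr_gt0 -natrM mulnb; exact.
Qed.

Lemma hat_supp n a b t : hat n a b t != 0 -> a + n.+1%:R^-1 <= t <= b - n.+1%:R^-1.
Proof.
have n0 : 0 < n.+1%:R :> R by rewrite ltr0n.
rewrite mulf_eq0 negb_or !bump1E => /andP[].
case: ifP => h1; last by rewrite eqxx.
move=> _; case: ifP => h2; last by rewrite eqxx.
move=> _.
apply/andP; split.
  by rewrite -lerBrDl -[leLHS]mul1r ler_pdivrMr // mulrC; lra.
by rewrite lerBrDl -lerBrDr -[leLHS]mul1r ler_pdivrMr // mulrC; lra.
Qed.

Lemma smooth_hat n a b : smooth (fun x : R * R => hat n a b x.1) /\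
  smooth (fun x : R * R => hat n a b x.2).
Proof.
have e t : hat n a b t = (1 * bump 1 (n.+1%:R * t + (- (n.+1%:R * a) - 1))) *
    (1 * bump 1 (- n.+1%:R * t + (n.+1%:R * b - 1))).
  by rewrite /hat !mul1r; congr (bump _ _ * bump _ _); ring.
split.
  have -> : (fun x : R * R => hat n a b x.1) = (fun x => (1 * bump 1 (n.+1%:R * x.1 + (- (n.+1%:R * a) - 1))) *
    (1 * bump 1 (- n.+1%:R * x.1 + (n.+1%:R * b - 1)))) by apply/funext => x; exact: e.
  by apply: smoothM; apply: (smooth_bump _ _ _ _).1.
have -> : (fun x : R * R => hat n a b x.2) = (fun x => (1 * bump 1 (n.+1%:R * x.2 + (- (n.+1%:R * a) - 1))) *
    (1 * bump 1 (- n.+1%:R * x.2 + (n.+1%:R * b - 1)))) by apply/funext => x; exact: e.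
by apply: smoothM; apply: (smooth_bump _ _ _ _).2.
Qed.

End Cutoff.

(** * Uniqueness of weak derivatives *)

Section Fundamental.
Variables (R : realType) (L : R).
Implicit Types (f g h : R * R -> R) (x : R * R).
Notation T2 := (measurableTypeR R * measurableTypeR R)%type.
Notation mu := (@mu2 R).
Notation Om := (Omega L).
Notation sp := (dotL2 L).

Lemma test_hat n (a b c d : R) : 0 <= a -> b <= L -> 0 <= c -> d <= 1 ->
  test_fun L (fun x => hat n a b x.1 * hat n c d x.2).
Proof.
move=> a0 bL c0 d1; split.
  by apply: smoothM; [exact: (smooth_hat n a b).1|exact: (smooth_hat n c d).2].
have n0 : 0 < n.+1%:R^-1 :> R by rewrite invr_gt0 ltr0n.
have supp := @hat_supp R n; move: (n.+1%:R^-1) n0 supp => e e0 supp.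
exists (`[a + e, b - e] `*` `[c + e, d - e]); split.
- by apply: compact_setX; exact: segment_compact.
- move=> [s t] [/=]; rewrite !in_itv /= => /andP[? ?] /andP[? ?].
  by split; rewrite /= in_itv /=; apply/andP; split; lra.
- move=> [s t] /= h; apply/eqP; apply: contra_notT h.
  rewrite mulf_eq0 negb_or => /andP[/supp h1 /supp h2].
  by split; rewrite /= in_itv.
Qed.

(** Open rectangles.  They generate the Borel sets of the plane and are stable
    under intersection. *)
Definition rect (a b c d : R) : set (R * R) := `]a, b[ `*` `]c, d[.

Lemma measurable_rect a b c d : measurable (rect a b c d : set T2).
Proof. by apply: measurableX; exact: measurable_itv. Qed.

Lemma measurable_indicOm (E : set T2) : measurable E ->
  measurable_fun (Om : set T2) (\1_E : R * R -> R).
Proof. by move=> mE; apply: measurable_funTS; exact: measurable_indic. Qed.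

Lemma indic_le1 (E : set (R * R)) x : `|\1_E x| <= 1 :> R.
Proof. by rewrite indicE; case: (_ \in _); rewrite ?normr1 ?normr0. Qed.

Lemma indic_inL2 (E : set T2) : measurable E -> inL2 L (\1_E : R * R -> R).
Proof.
move=> mE; apply: (inL2_bdd (C := 1)); first exact: measurable_indicOm.
by move=> x _; exact: indic_le1.
Qed.

Lemma cvL2_sp0 f (F : nat -> R * R -> R) g : inL2 L f -> inL2 L g -> cvL2 L F g ->
  (forall n, sp f (F n) = 0) -> sp f g = 0.
Proof.
move=> Hf Hg cF F0; have H := cvL2_sp Hf Hg (cvL2_cst Hf) cF.
apply: (cvg_unique (@Rhausdorff R) H).
by have -> : (fun n => sp f (F n)) = (fun=> 0) by [apply/funext|]; exact: cvg_cst.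
Qed.

Section ortho.
Variable h : R * R -> R.
Hypothesis hL2 : inL2 L h.
Hypothesis hort : forall phi, test_fun L phi -> sp h phi = 0.

(** The indicator function of a rectangle is on [Omega] a bounded limit of
    test functions, the products of two cut-offs. *)
Lemma sp_rect a b c d : sp h (\1_(rect a b c d) : R * R -> R) = 0.
Proof.
(* The rectangle is first cut down to [Omega], for the cut-offs to be test
   functions. *)
pose a' := Num.max a 0; pose b' := Num.min b L.
pose c' := Num.max c 0; pose d' := Num.min d 1.
pose phi n x := hat n a' b' x.1 * hat n c' d' x.2.
have tphi n : test_fun L (phi n).
  by apply: test_hat; rewrite ?le_max ?ge_min ?lexx ?orbT.
have cphi : cvL2 L phi (\1_(rect a b c d) : R * R -> R).
  apply: (cvL2_dct (C := 1)).
  - by move=> n; apply: continuous_measOm; apply: smooth_cont; case: (tphi n).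
  - by apply: measurable_indicOm; exact: measurable_rect.
  - move=> n x _; rewrite ger0_norm; last by apply: mulr_ge0; exact: hat_ge0.
    by apply: mulr_ile1; rewrite ?hat_ge0 ?hat_le1.
  - move=> [s t] [/=]; rewrite !in_itv /= => /andP[s0 sL] /andP[t0 t1].
    have -> : \1_(rect a b c d) (s, t) = (a' < s < b')%R%:R * (c' < t < d')%R%:R :> R.
      rewrite indicE -natrM mulnb; congr (nat_of_bool _)%:R.
      rewrite /a' /b' /c' /d' !gt_max !lt_min s0 sL t0 t1 !andbT.
      by apply/idP/idP => [/set_mem[]|/andP[h1 h2]]; rewrite /= ?in_itv /= => *; [apply/andP|apply/mem_set; split; rewrite /= in_itv].
    by apply: cvgM; exact: hat_cvg.
apply: (cvL2_sp0 hL2 _ cphi); first exact: indic_inL2 (measurable_rect a b c d).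
by move=> n; exact: hort.
Qed.

Let G : set (set (R * R)) := [set E | exists a b c d, E = rect a b c d].
Let T' : measurableType _ := g_sigma_algebraType G.

(** Measurable sets of the plane belong to the sigma-algebra generated by the
    open rectangles. *)
Lemma gsigma_rect (E : set T2) : measurable E -> <<s G >> E.
Proof.
have m1 : measurable_fun [set: T'] (fst : T' -> R).
  apply: (measurability (RGenOInfty.G (R := R))); first exact: RGenOInfty.measurableE.
  move=> _ [_ [a -> <-]]; rewrite setTI.
  have -> : fst @^-1` `]a, +oo[ = \bigcup_n rect a n%:R (- n%:R) n%:R.
    apply/seteqP; split => [[s t] /=|[s t] [n _ [/= hs _]]]; last first.
      by move: hs; rewrite !in_itv /= andbT => /andP[].
    rewrite in_itv /= andbT => as_.
    exists (Num.bound (`|s| + `|t|)) => //.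
    have := @archi_boundP R (`|s| + `|t|) (addr_ge0 (normr_ge0 _) (normr_ge0 _)).
    have := ler_norm s; have := ler_norm t; have := ler_norm (- t); rewrite normrN.
    have := normr_ge0 s; have := normr_ge0 t => *.
    by split; rewrite /= in_itv /=; apply/andP; split; lra.
  apply: bigcupT_measurable => n; apply: sub_sigma_algebra.
  by exists a, n%:R, (- n%:R), n%:R.
have m2 : measurable_fun [set: T'] (snd : T' -> R).
  apply: (measurability (RGenOInfty.G (R := R))); first exact: RGenOInfty.measurableE.
  move=> _ [_ [a -> <-]]; rewrite setTI.
  have -> : snd @^-1` `]a, +oo[ = \bigcup_n rect (- n%:R) n%:R a n%:R.
    apply/seteqP; split => [[s t] /=|[s t] [n _ [/= _ hs]]]; last first.
      by move: hs; rewrite !in_itv /= andbT => /andP[].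
    rewrite in_itv /= andbT => as_.
    exists (Num.bound (`|s| + `|t|)) => //.
    have := @archi_boundP R (`|s| + `|t|) (addr_ge0 (normr_ge0 _) (normr_ge0 _)).
    have := ler_norm s; have := ler_norm t; have := ler_norm (- s); rewrite normrN.
    have := normr_ge0 s; have := normr_ge0 t => *.
    by split; rewrite /= in_itv /=; apply/andP; split; lra.
  apply: bigcupT_measurable => n; apply: sub_sigma_algebra.
  by exists (- n%:R), n%:R, a, n%:R.
move=> mE.
have := measurable_fun_pair m1 m2 measurableT mE.
rewrite setTI (_ : _ @^-1` E = E) //.
by apply/seteqP; split => -[].
Qed.

(** Dynkin argument: the sets with indicator function orthogonal to [h] form
    a lambda-system that contains the rectangles. *)
Lemma sp_indic (E : set T2) : measurable E -> sp h (\1_E : R * R -> R) = 0.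
Proof.
pose H : set (set (R * R)) := [set E | measurable (E : set T2) /\ sp h (\1_E : R * R -> R) = 0].
have lim (F : nat -> set (R * R)) (E0 : set (R * R)) : (forall n, H (F n)) -> measurable (E0 : set T2) ->
    (forall x, Om x -> (fun n => \1_(F n) x : R) @ \oo --> (\1_E0 x : R)) -> H E0.
  move=> HF mE cF; split => //.
  have cphi : cvL2 L (fun n => \1_(F n) : R * R -> R) (\1_E0 : R * R -> R).
    apply: (cvL2_dct (C := 1)) => //.
    - by move=> n; apply: measurable_indicOm; case: (HF n).
    - by move=> n x _; exact: indic_le1.
  by apply: (cvL2_sp0 hL2 _ cphi) => [|n]; [exact: indic_inL2|case: (HF n)].
have Hrect a b c d : H (rect a b c d).
  by split; [exact: measurable_rect|exact: sp_rect].
have HG : G `<=` H by move=> _ [a [b [c [d ->]]]].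
have GI : setI_closed G.
  move=> _ _ [a [b [c [d ->]]]] [a' [b' [c' [d' ->]]]].
  exists (Num.max a a'), (Num.min b b'), (Num.max c c'), (Num.min d d').
  apply/seteqP; split => -[s t] /=; rewrite /rect /= !in_itv /= !gt_max !lt_min.
    by move=> [[/andP[-> ->] /andP[-> ->]] [/andP[-> ->] /andP[-> ->]]].
  by move=> [/andP[/andP[-> ->] /andP[-> ->]] /andP[/andP[-> ->] /andP[-> ->]]].
have lam : lambda_system setT H.
  split=> //.
  - apply: (lim (fun=> rect 0 L 0 1)) => // x Ox.
    by rewrite !indicE (mem_set Ox) in_setT; exact: cvg_cst.
  - move=> A B BA [mA hA] [mB hB]; split; first exact: measurableD.
    have -> : (\1_(A `\` B) : R * R -> R) = (fun x => \1_A x - \1_B x).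
      apply/funext => x; rewrite !indicE in_setD.
      have [xB|xB] := boolP (x \in B); last by rewrite andbT subr0.
      by rewrite (mem_set (BA _ (set_mem xB))) andbF subrr.
    by rewrite spBr ?hA ?hB ?subr0 //; exact: indic_inL2.
  - move=> F ndF HF; apply: (lim F) => //.
      by apply: bigcupT_measurable => n; case: (HF n).
    move=> x _; rewrite !indicE.
    have [/set_mem[n _ Fnx]|xF] := boolP (x \in \bigcup_i F i).
      apply: cvg_near_cst; exists n => // m /= nm.
      rewrite indicE mem_set //; have := ndF _ _ nm; rewrite subsetEset; exact.
    apply: cvg_near_cst; apply: nearW => n; rewrite indicE memNset // => Fx.
    by move/negP: xF; apply; apply/mem_set; exists n.
move=> mE.
have [] // := lambda_system_subset GI lam HG _ (gsigma_rect mE).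
Qed.

(** The fundamental lemma of the calculus of variations. *)
Lemma ortho_test_ae0 : ae_eq mu Om h (cst 0).
Proof.
have inth : mu.-integrable Om (EFin \o h).
  have := inL2_mul hL2 (indic_inL2 (@measurableT _ T2)).
  by under eq_fun do rewrite indicE in_setT mulr1.
have : ae_eq mu Om (EFin \o h) (cst 0%E).
  apply: integral_ae_eq => //; first exact: measurable_Omega.
  move=> E EOm mE; rewrite integral0.
  have := sp_indic mE; rewrite /dotL2 /Rintegral => h0.
  have intE : mu.-integrable Om (EFin \o (fun x => h x * \1_E x)).
    by apply: inL2_mul => //; exact: indic_inL2.
  have : (\int[mu]_(x in Om) (h x * \1_E x)%:E = 0)%E.
    by rewrite -[LHS]fineK ?h0 //; apply: integrable_fin_num => //; exact: measurable_Omega.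
  rewrite -{2}(setIidr EOm) integral_mkcondr => <-; apply: eq_integral => x _.
  by rewrite patchE indicE; case: ifP; rewrite /= ?mulr1 ?mulr0.
by apply: filterS => x /= hx Ox; have /= := hx Ox; case.
Qed.
End ortho.

Lemma weak_partial_unique j f g g' : inL2 L g -> inL2 L g' ->
  weak_partial L j f g -> weak_partial L j f g' -> ae_eq mu Om g g'.
Proof.
move=> Hg Hg' W W'.
have := @ortho_test_ae0 (fun x => g x - g' x) (inL2B Hg Hg').
have H phi : test_fun L phi -> sp (fun x => g x - g' x) phi = 0.
  move=> tp; rewrite spBl //; last by apply: smooth_inL2; case: tp.
  by apply/eqP; rewrite subr_eq0 -eqr_opp; apply/eqP; rewrite -[LHS](W _ tp) (W' _ tp).
move=> /(_ H); apply: filterS => x /= hx Ox; apply/eqP.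
by rewrite -subr_eq0; apply/eqP; exact: hx.
Qed.

Lemma test_fun_boundary phi : test_fun L phi -> [/\ forall y, phi (0, y) = 0, forall y, phi (L, y) = 0,
  forall s, phi (s, 0) = 0 & forall s, phi (s, 1) = 0].
Proof.
move=> [_ [K [_ KO K0]]]; split => s; apply: K0 => /KO [/=]; rewrite !in_itv /= ?ltxx ?andbF //.
Qed.

Hypothesis L_gt0 : 0 < L.

Lemma weak_partial_smooth j f : smooth f -> weak_partial L j f (fun x => 'D_(dir R j) f x).
Proof.
move=> sf phi tp; have [h1 h2 h3 h4] := test_fun_boundary tp.
apply: (int_by_parts L_gt0 j sf tp.1).
  by move=> y; rewrite h1 h2 !mulr0.
by move=> y; rewrite h3 h4 !mulr0.
Qed.

Lemma smooth_inH1 f : smooth f -> inH1 L f.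
Proof.
move=> sf; split; first exact: smooth_inL2.
move=> j; exists (fun x => 'D_(dir R j) f x); last exact: weak_partial_smooth.
by apply: smooth_inL2; exact: smooth_partial.
Qed.

(** Weak derivatives of a smooth function are the classical ones. *)
Lemma wpartial_smooth j f : smooth f ->
  ae_eq mu Om (wpartial L j f) (fun x => 'D_(dir R j) f x).
Proof.
move=> sf; have [H1 H2] := inH1_wpartial j (smooth_inH1 sf).
apply: (weak_partial_unique H1 _ H2); last exact: weak_partial_smooth.
by apply: smooth_inL2; exact: smooth_partial.
Qed.

Lemma weak_partial_ae j f f' : inL2 L f -> inL2 L f' -> ae_eq mu Om f f' ->
  weak_partial L j f = weak_partial L j f'.
Proof.
move=> Hf Hf' e; apply/funext => g; apply/propext.
have E phi : test_fun L phi -> sp f (fun x => 'D_(dir R j) phi x) = sp f' (fun x => 'D_(dir R j) phi x).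
  move=> [sp_ _]; have H : inL2 L (fun x => 'D_(dir R j) phi x).
    by apply: smooth_inL2; exact: smooth_partial.
  by apply: sp_ae => //; exact: ae_eq_refl.
by split=> W phi tp; have := W phi tp; have := E phi tp; rewrite /dotL2 => ->.
Qed.

(** The chosen weak derivative depends on the class of [f] only: functions
    equal almost everywhere have the same set of weak derivatives, so that
    the choice is the same.  The equality is that of functions. *)
Lemma wpartial_ae j f f' : inL2 L f -> inL2 L f' -> ae_eq mu Om f f' ->
  wpartial L j f = wpartial L j f'.
Proof. by move=> Hf Hf' e; rewrite /wpartial (weak_partial_ae j Hf Hf' e). Qed.

Lemma inH1_ae f f' : inL2 L f -> inL2 L f' -> ae_eq mu Om f f' -> inH1 L f -> inH1 L f'.
Proof.
by move=> Hf Hf' e [_ H]; split => // j; rewrite -(weak_partial_ae j Hf Hf' e).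
Qed.

Lemma smooth_inH2 f : smooth f -> inH2 L f.
Proof.
move=> sf; split; first exact: smooth_inH1.
move=> j; have [H1 _] := inH1_wpartial j (smooth_inH1 sf).
have sD : smooth (fun x => 'D_(dir R j) f x) by exact: smooth_partial.
have e := ae_eq_sym (wpartial_smooth j sf).
exact: (inH1_ae (smooth_inL2 L sD) H1 e (smooth_inH1 sD)).
Qed.

(** A smooth element of [S] lies in the [H^1]-closure of [S]; its distance to
    itself compares its classical gradient with its weak one. *)
Lemma closureH1_smooth n (S : set (field R n)) u : (forall i, smooth (u i)) -> S u ->
  closureH1 L S u.
Proof.
move=> su Su; split; first by move=> i; exact: smooth_inH1.
move=> e e0; exists u => //.
suff -> : H1dist L u (grad u) u (wgrad L u) = 0 by [].
have n0 (v w : field R n) : (forall i, inL2 L (v i)) -> (forall i, inL2 L (w i)) ->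
    (forall i, ae_eq mu Om (v i) (w i)) -> normL2 L (fsub v w) = 0.
  move=> Hv Hw evw; rewrite /normL2 ipE big1 ?sqrtr0 // => i _.
  have Hi := inL2B (Hv i) (Hw i).
  rewrite (@sp_ae _ _ _ (fun=> 0) _ (fun=> 0)) //.
  - by rewrite /dotL2; under eq_Rintegral do rewrite mulr0; rewrite Rintegral_cst ?mul0r //; exact: measurable_Omega.
  - by apply: smooth_inL2; exact: smooth_cst.
  - by apply: smooth_inL2; exact: smooth_cst.
  - by apply: filterS (evw i) => x /= h Ox; rewrite /fsub h // subrr.
  - by apply: filterS (evw i) => x /= h Ox; rewrite /fsub h // subrr.
rewrite /H1dist n0 ?big1 ?expr0n ?add0r ?sqrtr0 //.
- move=> j _; rewrite n0 ?expr0n // => i.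
  + by apply: smooth_inL2; exact: smooth_partial.
  + by have [] := inH1_wpartial j (smooth_inH1 (su i)).
  + by apply: ae_eq_sym; exact: wpartial_smooth.
- by move=> i; exact: smooth_inL2.
- by move=> i; exact: smooth_inL2.
- by move=> i; exact: ae_eq_refl.
Qed.

(** Smooth elements of the class [S] belong to the domain of the operator,
    hence are admissible in the characterisation of [A]. *)
Lemma domA_smooth n (S : set (field R n)) u : (forall i, smooth (u i)) -> S u ->
  domA L S u.
Proof.
by move=> su Su; split; [exact: closureH1_smooth|move=> i; exact: smooth_inH2].
Qed.

End Fundamental.

(** * Trigonometric polynomials and divergence-free fields *)

Section Trig.
Variables (R : realType) (L : R).
Hypothesis L_gt0 : 0 < L.
Implicit Types (f g h : R * R -> R) (x : R * R).
Notation DD j f x := ('D_(dir R j) f x).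

(** Smooth functions of the vertical variable supported in [[d, 1 - d]]. *)
Definition vprof (d : R) (a : R -> R) := smooth (fun x : R * R => a x.2) /\
  forall y, a y != 0 -> d <= y <= 1 - d.

(** Smooth functions on the plane supported in the strip [d <= x_2 <= 1 - d]. *)
Definition pprof (d : R) f := smooth f /\ forall x, f x != 0 -> d <= x.2 <= 1 - d.

Lemma vprof_pprof d a : vprof d a -> pprof d (fun x => a x.2).
Proof. by move=> [? h]; split => // x; exact: h. Qed.

Lemma pprof_freeze d f s : pprof d f -> vprof d (fun y => f (s, y)).
Proof.
by move=> [sf h]; split; [exact: (smooth_freeze s sf)|move=> y; exact: (h (s, y))].
Qed.

Lemma pprofD d f g : pprof d f -> pprof d g -> pprof d (fun x => f x + g x).
Proof.
move=> [sf hf] [sg hg]; split; first exact: smoothD.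
move=> x; have [->|/hf //] := eqVneq (f x) 0; rewrite add0r; exact: hg.
Qed.

Lemma pprofM d w f : smooth w -> pprof d f -> pprof d (fun x => w x * f x).
Proof.
move=> sw [sf hf]; split; first exact: smoothM.
by move=> x; rewrite mulf_eq0 negb_or => /andP[_]; exact: hf.
Qed.

Lemma pprofZ d (c : R) f : pprof d f -> pprof d (fun x => c * f x).
Proof. by apply: pprofM; exact: smooth_cst. Qed.

Lemma pprof_shift d f s : pprof d f -> pprof d (fun x => f (x + (s, 0))).
Proof.
move=> [sf hf]; split; first exact: smooth_shift.
by move=> x /hf /=; rewrite addr0.
Qed.

Lemma pprof0 d : pprof d (fun=> 0).
Proof. by split; [exact: smooth_cst|move=> x; rewrite eqxx]. Qed.

Lemma pprof_sum d (I : Type) (r : seq I) (F : I -> R * R -> R) :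
  (forall i, pprof d (F i)) -> pprof d (fun x => \sum_(i <- r) F i x).
Proof.
move=> hF; elim: r => [|i r IH].
  by under eq_fun do rewrite big_nil; exact: pprof0.
by under eq_fun do rewrite big_cons; exact: pprofD.
Qed.

Lemma vprofZ d (c : R) a : vprof d a -> vprof d (fun y => c * a y).
Proof. by move=> /vprof_pprof ha; exact: (pprof_freeze 0 (pprofZ c ha)). Qed.

Lemma vprof0 d : vprof d (fun=> 0).
Proof. exact: (pprof_freeze 0 (pprof0 d)). Qed.

Lemma vprof_derive d a : vprof d a -> vprof d (fun y => 'D_1 a y).
Proof.
move=> [sa ha]; split.
  have := smooth_partial ord_max sa; under eq_fun do rewrite derive_snd; exact.
move=> y; apply: contra_neqT => hy.
have : \forall z \near y, (fun=> 0) z = a z.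
  move: hy; rewrite negb_and -!ltNge => /orP[hy|hy].
    near=> z; have zd : z < d by near: z; exact: lt_nbhsl.
    by apply/esym/eqP; apply: contraTT zd => /ha /andP[dz _]; rewrite -leNgt.
  near=> z; have zd : 1 - d < z by near: z; exact: lt_nbhsr.
  by apply/esym/eqP; apply: contraTT zd => /ha /andP[_ dz]; rewrite -leNgt.
by move=> /near_eq_derive <-; exact: derive_cst.
Unshelve. all: by end_near. Qed.

(** The angle [2 pi k s / L], in the form in which it occurs in the definition
    of trigonometric polynomials. *)
Definition ang (k : nat) (s : R) : R := 2 * pi * k%:R * s / L.

(** The frequency [2 pi k / L] of the [k]-th mode. *)
Definition frq (k : nat) : R := 2 * pi * k%:R / L.

Lemma angE k s : ang k s = frq k * s.
Proof. by rewrite /ang /frq mulrAC. Qed.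

Lemma angD k s t : ang k (s + t) = ang k s + ang k t.
Proof. by rewrite !angE mulrDr. Qed.

Lemma angN k s : ang k (- s) = - ang k s.
Proof. by rewrite !angE mulrN. Qed.

(** The term of frequency [k] of a trigonometric polynomial in [x_1] with
    coefficients depending on [x_2]. *)
Definition tterm (k : nat) (a b : R -> R) x : R :=
  a x.2 * cos (ang k x.1) + b x.2 * sin (ang k x.1).

(** Trigonometric polynomials in [x_1] with [N] terms, of frequencies [k < N]. *)
Definition tpoly (N : nat) (a b : nat -> R -> R) x : R :=
  \sum_(k < N) tterm k (a k) (b k) x.

Lemma smooth_cos k : smooth (fun x : R * R => cos (ang k x.1)).
Proof.
have := (smooth_trig 1 0 (frq k)).1.
by under eq_fun do rewrite mul1r mul0r addr0 -angE.
Qed.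

Lemma smooth_sin k : smooth (fun x : R * R => sin (ang k x.1)).
Proof.
have := (smooth_trig 0 1 (frq k)).1.
by under eq_fun do rewrite mul1r mul0r add0r -angE.
Qed.

Lemma pprof_tterm d k a b : vprof d a -> ((0 < k)%N -> vprof d b) -> pprof d (tterm k a b).
Proof.
move=> ha hb.
have h1 : pprof d (fun x => cos (ang k x.1) * a x.2).
  by apply: pprofM; [exact: smooth_cos|exact: vprof_pprof].
have [k0|k0] := ltnP 0 k; last first.
  have -> : tterm k a b = (fun x => cos (ang k x.1) * a x.2); last by [].
  apply/funext => x; rewrite /tterm (mulrC (cos _)); move: k0; rewrite leqn0 => /eqP ->.
  by rewrite /ang mulr0 !mul0r sin0 mulr0 addr0.
have h2 : pprof d (fun x => sin (ang k x.1) * b x.2).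
  by apply: pprofM; [exact: smooth_sin|apply: vprof_pprof; exact: hb].
have -> : tterm k a b = (fun x => cos (ang k x.1) * a x.2 + sin (ang k x.1) * b x.2).
  by apply/funext => x; rewrite /tterm !(mulrC (_ x.2)).
exact: pprofD.
Qed.

(** The coefficients of a smooth trigonometric polynomial are smooth and
    supported in the same strip.  By induction on the number of terms: the
    combination [f(x_1 + h) + f(x_1 - h) - 2 cos (ang N h) f(x_1)] multiplies
    the term of frequency [k] by [2 (cos (ang k h) - cos (ang N h))], which
    removes the last term and keeps the others.  The coefficient [b 0], which
    multiplies [sin 0], is arbitrary and has to be excluded. *)
Lemma coef_pprof d N : forall a b f, pprof d f -> (forall x, f x = tpoly N a b x) ->
  forall k, (k < N)%N -> vprof d (a k) /\ ((0 < k)%N -> vprof d (b k)).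
Proof.
elim: N => [//|N IH] a b f hf fE.
(* This shift puts the angles [ang k h], [k <= N], in [[0, pi]], where the
   cosine is injective. *)
pose h := L / (2 * N.+1%:R).
have N0 : N.+1%:R != 0 :> R by rewrite pnatr_eq0.
have angh k : ang k h = pi * (k%:R / N.+1%:R).
  by rewrite /ang /h; move: (N.+1%:R) N0 => M M0; field; rewrite M0 gt_eqF.
pose c k := 2 * (cos (ang k h) - cos (ang N h)).
have c0 k : (k < N)%N -> c k != 0.
  move=> kN; rewrite mulf_neq0 ?pnatr_eq0 // subr_eq0; apply: contraTneq kN => /cos_inj.
  have rng j : (j <= N)%N -> (0 : R) <= (pi : R) * (j%:R / N.+1%:R) <= (pi : R).
    move=> jN; rewrite mulr_ge0 ?pi_ge0 ?divr_ge0 //=.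
    by rewrite ler_piMr ?pi_ge0 // ler_pdivrMr ?ltr0n // mul1r ler_nat leqW.
  rewrite !angh !in_itv /= => H; rewrite -leqNgt.
  have [//|kN] := leqP N k.
  have /eqP := H (rng _ (ltnW kN)) (rng _ (leqnn N)).
  rewrite -subr_eq0 -mulrBr mulf_eq0 gt_eqF ?pi_gt0 //= -mulrBl mulf_eq0 invr_eq0.
  by rewrite (negbTE N0) orbF subr_eq0 eqr_nat ltn_eqF.
pose g x := f (x + (h, 0)) + f (x + (- h, 0)) + (- 2 * cos (ang N h)) * f x.
have hg : pprof d g.
  by apply: pprofD; [apply: pprofD; exact: pprof_shift|exact: pprofZ].
have gE x : g x = tpoly N (fun k y => c k * a k y) (fun k y => c k * b k y) x.
  rewrite /g !fE /tpoly !big_ord_recr /= mulrDr mulr_sumr.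
  have tE k : tterm k (a k) (b k) (x + (h, 0)) + tterm k (a k) (b k) (x + (- h, 0))
     + - 2 * cos (ang N h) * tterm k (a k) (b k) x = tterm k (fun y => c k * a k y) (fun y => c k * b k y) x.
    rewrite /tterm /= !addr0 !angD angN !cosD !sinD cosN sinN /c; ring.
  rewrite [X in X + _](addrACA) -big_split /= addrACA -big_split /=.
  rewrite tE /tterm /c subrr mulr0 !mul0r addr0 addr0.
  by apply: eq_bigr => k _; exact: tE.
have IHg := IH _ _ _ hg gE.
have ok k : (k < N)%N -> vprof d (a k) /\ ((0 < k)%N -> vprof d (b k)).
  move=> kN; have [h1 h2] := IHg k kN; have cn := c0 _ kN.
  have E (e : R -> R) : e = (fun y => (c k)^-1 * (c k * e y)).
    by apply/funext => y; rewrite mulKf.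
  split; first by rewrite (E (a k)); exact: vprofZ.
  by move=> k0; rewrite (E (b k)); apply: vprofZ; exact: h2.
pose r x := f x + - 1 * \sum_(k < N) tterm k (a k) (b k) x.
have hr : pprof d r.
  apply: pprofD => //; apply: pprofZ; apply: pprof_sum => k.
  by have [h1 h2] := ok k (ltn_ord k); exact: pprof_tterm.
have rE x : r x = tterm N (a N) (b N) x.
  by rewrite /r fE /tpoly big_ord_recr /= mulN1r addrAC subrr add0r.
move=> k; rewrite ltnS leq_eqVlt => /orP[/eqP ->|]; last exact: ok.
split.
  have -> : a N = (fun y => r (0, y)); last exact: pprof_freeze.
  by apply/funext => y; rewrite rE /tterm angE mulr0 cos0 sin0 mulr1 mulr0 addr0.
move=> N1; have -> : b N = (fun y => r (L / (4 * N%:R), y)); last exact: pprof_freeze.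
apply/funext => y; rewrite rE /tterm /=.
have -> : ang N (L / (4 * N%:R)) = pi / 2.
  by rewrite /ang; field; rewrite (gt_eqF L_gt0) pnatr_eq0 -lt0n N1.
by rewrite cos_pihalf sin_pihalf mulr0 mulr1 add0r.
Qed.

(** The elements of [F] are the trigonometric polynomials with coefficients
    that are smooth and supported in some [[d, 1 - d]] with [0 < d]. *)
Lemma calF_coef f : calF L f -> exists d N a b, [/\ 0 < d,
  forall k, vprof d (a k), forall k, vprof d (b k) & f = tpoly N a b].
Proof.
move=> [sf [N [a [b fE]]] [d d0 hd]].
have hf : pprof d f by split.
have H := coef_pprof hf fE.
pose a' k := if (k < N)%N then a k else fun=> 0.
pose b' k := if (0 < k < N)%N then b k else fun=> 0.
exists d, N, a', b'; split => //.
- by move=> k; rewrite /a'; case: ifP => [kN|_]; [case: (H k kN)|exact: vprof0].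
- move=> k; rewrite /b'; case: ifP => [/andP[k0 kN]|_]; last exact: vprof0.
  by have [_ h] := H k kN; exact: h.
- apply/funext => x; rewrite fE; apply: eq_bigr => k _.
  rewrite /tterm /a' /b' ltn_ord andbT; congr (_ + _).
  by case: ltnP => //; rewrite leqn0 => /eqP ->; rewrite /ang !(mulr0, mul0r) sin0 mulr0.
Qed.

Lemma calF_tpoly d N a b : 0 < d -> (forall k, vprof d (a k)) -> (forall k, vprof d (b k)) ->
  calF L (tpoly N a b).
Proof.
move=> d0 ha hb.
have [s1 s2] : pprof d (tpoly N a b) by apply: pprof_sum => k; exact: pprof_tterm.
by split; [|exists N, a, b|exists d].
Qed.

Lemma calF_smooth f : calF L f -> smooth f. Proof. by case. Qed.

Lemma partial1_tpoly d N a b x : (forall k, vprof d (a k)) -> (forall k, vprof d (b k)) ->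
  DD ord0 (tpoly N a b) x = tpoly N (fun k y => frq k * b k y) (fun k y => - frq k * a k y) x.
Proof.
move=> ha hb; rewrite partial_sum; last first.
  by move=> k; case: (@pprof_tterm d k (a k) (b k)).
apply: eq_bigr => k _; rewrite derive_fst /tterm /=.
apply: derive_val; apply: is_derive_eq.
by rewrite /GRing.scale /frq /=; ring.
Qed.

Lemma vprof_derivable d a (y : R) : vprof d a -> derivable a y 1.
Proof.
by move=> [sa _]; have /derivable_snd := @smooth_derivable _ _ (0, y) ord_max sa.
Qed.

Lemma partial2_tpoly d N a b x : (forall k, vprof d (a k)) -> (forall k, vprof d (b k)) ->
  DD ord_max (tpoly N a b) x = tpoly N (fun k y => 'D_1 (a k) y) (fun k y => 'D_1 (b k) y) x.
Proof.
move=> ha hb; rewrite partial_sum; last first.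
  by move=> k; case: (@pprof_tterm d k (a k) (b k)).
apply: eq_bigr => k _; rewrite derive_snd /tterm /=.
have da := derivableP (vprof_derivable (y := x.2) (ha k)).
have db := derivableP (vprof_derivable (y := x.2) (hb k)).
apply: derive_val; apply: is_derive_eq.
by rewrite /GRing.scale /=; ring.
Qed.

Lemma calF_partial f j : calF L f -> calF L (fun x => DD j f x).
Proof.
move=> /calF_coef[d [N [a [b [d0 ha hb ->]]]]].
case: (ord2P j) => ->.
  have -> : (fun x => DD ord0 (tpoly N a b) x) =
    tpoly N (fun k y => frq k * b k y) (fun k y => - frq k * a k y).
    by apply/funext => x; exact: partial1_tpoly ha hb.
  by apply: (@calF_tpoly d) => // k; exact: vprofZ.
have -> : (fun x => DD ord_max (tpoly N a b) x) =
  tpoly N (fun k y => 'D_1 (a k) y) (fun k y => 'D_1 (b k) y).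
  by apply/funext => x; exact: partial2_tpoly ha hb.
by apply: (@calF_tpoly d) => // k; exact: vprof_derive.
Qed.

Lemma calF_mul_vert f (w : R -> R) : smooth (fun x : R * R => w x.2) -> calF L f ->
  calF L (fun x => w x.2 * f x).
Proof.
move=> sw /calF_coef[d [N [a [b [d0 ha hb ->]]]]].
have -> : (fun x => w x.2 * tpoly N a b x) =
    tpoly N (fun k y => w y * a k y) (fun k y => w y * b k y).
  by apply/funext => x; rewrite /tpoly mulr_sumr; apply: eq_bigr => k _; rewrite /tterm; ring.
by apply: (@calF_tpoly d) => // k; have /vprof_pprof h := ha k; have /vprof_pprof h' := hb k;
  [exact: (pprof_freeze 0 (pprofM sw h))|exact: (pprof_freeze 0 (pprofM sw h'))].
Qed.

Lemma calF_Z c f : calF L f -> calF L (fun x => c * f x).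
Proof. by move=> hf; apply: (calF_mul_vert (w := fun=> c)) => //; exact: smooth_cst. Qed.

Lemma calF_vprof d a : 0 < d -> vprof d a -> calF L (fun x => a x.2).
Proof.
move=> d0 ha.
have -> : (fun x : R * R => a x.2) = tpoly 1 (fun=> a) (fun=> fun=> 0).
  by apply/funext => x; rewrite /tpoly big_ord1 /tterm /ang mulr0 !mul0r cos0 mulr1 addr0.
by apply: (@calF_tpoly d) => // k; exact: vprof0.
Qed.

Lemma calF_periodic f y : calF L f -> f (0, y) = f (L, y).
Proof.
move=> [_ [N [a [b fE]]] _]; rewrite !fE; apply: eq_bigr => k _ /=.
rewrite mulr0 mul0r mulfK ?gt_eqF // cos0 sin0.
have -> : 2 * pi * k%:R = 0 + (pi *+ 2) *+ k :> R by rewrite add0r -[RHS]mulr_natr mulr_natl.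
by rewrite (periodicn (@cosD2pi R)) (periodicn (@sinD2pi R)) cos0 sin0.
Qed.

Lemma calF_bdry0 f s : calF L f -> f (s, 0) = 0.
Proof.
move=> [_ _ [d d0 hf]]; apply/eqP; apply: contraT => /hf /= /andP[d00 _].
by move: (le_lt_trans d00 d0); rewrite ltxx.
Qed.

Lemma calF_bdry1 f s : calF L f -> f (s, 1) = 0.
Proof.
move=> [_ _ [d d0 hf]]; apply/eqP; apply: contraT => /hf /= /andP[_].
by rewrite lerBrDr gerDl => /(lt_le_trans d0); rewrite ltxx.
Qed.

(** An element of [F] is the sum of its mean in [x_1] and of a derivative
    with respect to [x_1]: the terms of positive frequency have a primitive. *)
Lemma calF_split f : calF L f -> exists d phi psi, [/\ 0 < d, vprof d phi, calF L psi &
  forall x, f x = phi x.2 + DD ord0 psi x].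
Proof.
move=> /calF_coef[d [N [a [b [d0 ha hb ->]]]]].
pose c (k : nat) : R := if (0 < k)%N then (frq k)^-1 else 0.
pose a' k y := - c k * b k y; pose b' k y := c k * a k y.
have ha' k : vprof d (a' k) by exact: vprofZ.
have hb' k : vprof d (b' k) by exact: vprofZ.
case: N => [|N].
  exists d, (fun=> 0), (tpoly 0 a' b'); split => //; [exact: vprof0|exact: (@calF_tpoly d)|].
  by move=> x; rewrite (partial1_tpoly _ _ ha' hb') /tpoly !big_ord0 addr0.
exists d, (a 0%N), (tpoly N.+1 a' b'); split => //; first exact: (@calF_tpoly d).
move=> x; rewrite (partial1_tpoly _ _ ha' hb') /tpoly !big_ord_recl /=.
have frq0 : frq 0 = 0 by rewrite /frq mulr0 mul0r.
have -> : tterm 0 (a 0%N) (b 0%N) x = a 0%N x.2.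
  by rewrite /tterm angE frq0 mul0r cos0 sin0 mulr1 mulr0 addr0.
have -> : tterm 0 (fun y => frq 0 * b' 0%N y) (fun y => - frq 0 * a' 0%N y) x = 0.
  by rewrite /tterm frq0 oppr0 !mul0r addr0.
rewrite add0r.
congr (_ + _); apply: eq_bigr => k _; rewrite /tterm /a' /b' /c /= /fintype.bump /=.
have f0 : frq k.+1 != 0.
  by rewrite /frq !mulf_neq0 ?invr_eq0 ?pnatr_eq0 // gt_eqF // pi_gt0.
rewrite add1n; congr (_ * _ + _ * _).
  by rewrite mulrA mulfV // mul1r.
by rewrite !mulNr mulrN opprK mulrA mulfV // mul1r.
Qed.

(** The divergence-free field with stream function [psi]. *)
Definition stream (psi : R * R -> R) : velocity R :=
  fun i x => if i == ord0 then - 1 * DD ord_max psi x else DD ord0 psi x.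

Lemma stream_calV psi : calF L psi -> calV L (stream psi).
Proof.
move=> hpsi; split.
  move=> i; case: (ord2P i) => ->; rewrite /stream /=.
    by apply: calF_Z; exact: calF_partial.
  exact: calF_partial.
move=> x; rewrite big_ord_recl big_ord1 /= (_ : lift ord0 ord0 = ord_max); last exact: val_inj.
rewrite /stream /=.
have [d [N [a [b [d0 ha hb ->]]]]] := calF_coef hpsi.
have ha' k : vprof d (fun y => 'D_1 (a k) y) by exact: vprof_derive.
have hb' k : vprof d (fun y => 'D_1 (b k) y) by exact: vprof_derive.
have hA k : vprof d (fun y => frq k * b k y) by exact: vprofZ.
have hB k : vprof d (fun y => - frq k * a k y) by exact: vprofZ.
rewrite partialZ; last by apply: smooth_partial; case: (calF_tpoly N d0 ha hb).
have -> : (fun x => DD ord_max (tpoly N a b) x) =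
    tpoly N (fun k y => 'D_1 (a k) y) (fun k y => 'D_1 (b k) y).
  by apply/funext => z; exact: partial2_tpoly ha hb.
have -> : (fun x => DD ord0 (tpoly N a b) x) =
    tpoly N (fun k y => frq k * b k y) (fun k y => - frq k * a k y).
  by apply/funext => z; exact: partial1_tpoly ha hb.
rewrite (partial1_tpoly _ _ ha' hb') (partial2_tpoly _ _ hA hB) mulN1r.
apply/eqP; rewrite addrC subr_eq0; apply/eqP; apply: eq_bigr => k _.
rewrite /tterm; congr (_ * _ + _ * _).
  have := @deriveZ _ _ _ (b k) (frq k) x.2 1 (vprof_derivable (y := x.2) (hb k)).
  exact.
have := @deriveZ _ _ _ (a k) (- frq k) x.2 1 (vprof_derivable (y := x.2) (ha k)).
exact.
Qed.

(** The second component of a divergence-free field is the [x_1]-derivative of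
    an element of [F]: its mean in [x_1] has zero derivative in [x_2] and
    vanishes at the boundary. *)
Lemma calV_second v : calV L v -> exists2 psi, calF L psi & v ord_max = (fun x => DD ord0 psi x).
Proof.
move=> [Fv div].
have [d [phi [psi [d0 hphi hpsi vE]]]] := calF_split (Fv ord_max).
exists psi => //.
suff phi0 y : phi y = 0 by apply/funext => x; rewrite vE phi0 add0r.
(* The field minus the curl of [psi] is [(G, phi)] and is divergence-free, so
   that [D_1 G = - phi'] does not depend on [x_1]; as [G] is periodic in [x_1],
   Rolle's theorem gives [phi' = 0]. *)
pose G x := v ord0 x + DD ord_max psi x.
have cG : smooth G.
  by apply: smoothD; [case: (Fv ord0)|apply: smooth_partial; case: hpsi].
have spsi : smooth psi by case: hpsi.
have d1phi (s y' : R) : DD ord0 G (s, y') = - 'D_1 phi y'.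
  have := div (s, y').
  rewrite big_ord_recl big_ord1 /= (_ : lift ord0 ord0 = ord_max); last exact: val_inj.
  have -> : v ord_max = (fun x => phi x.2 + DD ord0 psi x) by apply/funext => x; exact: vE.
  rewrite partialD; [|by case: hphi|exact: smooth_partial].
  have -> : DD ord_max (fun x => phi x.2) (s, y') = 'D_1 phi y' by rewrite derive_snd.
  rewrite /G partialD; [|by case: (Fv ord0)|exact: smooth_partial].
  have [_ /(_ (s, y'))] := stream_calV hpsi.
  rewrite big_ord_recl big_ord1 /= (_ : lift ord0 ord0 = ord_max); last exact: val_inj.
  rewrite /stream /= partialZ; last exact: smooth_partial.
  move=> /eqP; rewrite mulN1r addrC subr_eq0 => /eqP -> /eqP.
  by rewrite addrCA addr_eq0 => /eqP ->; rewrite opprK.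
have phi' y' : 'D_1 phi y' = 0.
  have dG (s : R) : derivable (fun t => G (t, y')) s 1.
    by have /derivable_fst := @smooth_derivable _ _ (s, y') ord0 cG.
  have [] := @Rolle R (fun t => G (t, y')) 0 L L_gt0.
  - by move=> t _; exact: dG.
  - apply: continuous_subspaceT => t; apply: differentiable_continuous.
    by apply/derivable1_diffP; exact: dG.
  - by rewrite /G (calF_periodic _ (Fv ord0)) (calF_periodic _ (calF_partial ord_max hpsi)).
  move=> s _ [_ h]; have := d1phi s y'; rewrite derive_fst /= h => /eqP.
  by rewrite eq_sym oppr_eq0 => /eqP.
have hd : forall z : R, is_derive z (1 : R) phi 0.
  by move=> z; apply: DeriveDef; [exact: vprof_derivable hphi|exact: phi'].
(* Any point outside [[0, 1]] gives the value of the constant. *)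
rewrite (is_derive_0_is_cst y (-1) hd).
apply/eqP; apply: contraT => /(hphi.2) /andP[dm _].
have : 0 < -1 :> R by exact: lt_le_trans d0 dm.
by rewrite ltr0N1.
Qed.

End Trig.

(** * Consequences of the momentum equation *)

Section Evol.
Variables (R : realType) (L : R).
Hypothesis L_gt0 : 0 < L.
Implicit Types (f g h : R * R -> R) (x : R * R).
Notation T2 := (measurableTypeR R * measurableTypeR R)%type.
Notation mu := (@mu2 R).
Notation leb := (@lebesgue_measure R).
Notation Om := (Omega L).
Notation sp := (dotL2 L).
Notation DD j f x := ('D_(dir R j) f x).

(** Fields with square-integrable components. *)
Definition L2field n (u : field R n) := forall i, inL2 L (u i).

Lemma ip_subl n (u v w : field R n) : L2field u -> L2field v -> L2field w ->
  ip L (fsub u v) w = ip L u w - ip L v w.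
Proof.
move=> Hu Hv Hw; rewrite !ipE -sumrB; apply: eq_bigr => i _.
by rewrite -spBl.
Qed.

Lemma L2field_sub n (u v : field R n) : L2field u -> L2field v -> L2field (fsub u v).
Proof. by move=> Hu Hv i; exact: inL2B. Qed.

Lemma closureL2_L2 n (S : set (field R n)) u : closureL2 L S u -> L2field u.
Proof. by case. Qed.

Lemma closureH1_L2 n (S : set (field R n)) u : closureH1 L S u -> L2field u.
Proof. by move=> [H _] i; case: (H i). Qed.

Lemma closureH1_wpartial_L2 n (S : set (field R n)) u i j : closureH1 L S u -> inL2 L (wpartial L j (u i)).
Proof. by move=> [H _]; have [] := inH1_wpartial j (H i). Qed.

Lemma closureL2_self n (S : set (field R n)) u : L2field u -> S u -> closureL2 L S u.
Proof. by move=> Hu Su; apply: (closureL2_of_seq (phi := fun=> u)) => // i; exact: cvL2_cst. Qed.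

Lemma calV_smooth v i : calV L v -> smooth (v i).
Proof. by case=> /(_ i)[]. Qed.

Lemma calF1_smooth (v : temperature R) i : calF1 L v -> smooth (v i).
Proof. by move=> /(_ i)[]. Qed.

(** Continuity in time with values in [V] implies continuity of the pairing
    with any square-integrable field. *)
Lemma contV_ip n (S : set (field R n)) (u : R -> field R n) w : contV L S setT u -> L2field w ->
  continuous (fun t => ip L (u t) w).
Proof.
move=> cu Hw t; have [Ht ct] := cu t I.
have Hu s : L2field (u s) by apply: closureH1_L2; exact: (cu s I).1.
apply/cvgrPdist_lt => e e0.
(* The summand [1] only serves to make [C] positive. *)
pose C := n%:R * normL2 L w + 1.
have C0 : 0 < C by rewrite ltr_wpDl // mulr_ge0 // sqrtr_ge0.
have eC : 0 < e / C by rewrite divr_gt0.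
move: ct; rewrite withinET => /cvgr0_norm_lt /(_ _ eC).
apply: filterS => s hs; rewrite distrC -ip_subl //.
apply: (le_lt_trans (ip_sqrt_CS (L2field_sub (Hu s) (Hu t)) Hw)).
rewrite sumr_const card_ord.
have h1 : normL2 L (fsub (u s) (u t)) < e / C.
  apply: le_lt_trans hs; rewrite ger0_norm ?sqrtr_ge0 // /H1dist.
  rewrite -[leLHS]ger0_norm ?sqrtr_ge0 // -sqrtr_sqr ler_wsqrtr // lerDl.
  by rewrite sumr_ge0 // => j _; rewrite sqr_ge0.
rewrite -mulr_natl mulrCA.
apply: (@le_lt_trans _ _ (normL2 L (fsub (u s) (u t)) * C)).
  by rewrite ler_wpM2l ?sqrtr_ge0 // lerDl.
by rewrite -ltr_pdivlMr.
Qed.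

Lemma L2loc_int n (S : set (field R n)) (g : R -> field R n) w s t : L2loc L S setT g ->
  closureL2 L S w -> leb.-integrable `[s, t] (EFin \o (fun r => ip L (g r) w)).
Proof.
move=> [Sg gl] Sw; have [mg ig] := gl s t (@subsetT _ _).
pose C := n%:R * normL2 L w.
have C0 : 0 <= C by rewrite mulr_ge0 // sqrtr_ge0.
have mI : measurable (`[s, t] : set (measurableTypeR R)) by exact: measurable_itv.
have i1 : leb.-integrable `[s, t] (EFin \o (fun=> 1 : R)).
  apply: continuous_compact_integrable; first exact: segment_compact.
  by apply: continuous_subspaceT; exact: cst_continuous.
have i2 := integrableZl mI C (integrableD mI i1 ig).
apply: (le_integrable mI _ _ i2); first by apply/measurable_EFinP; exact: mg.
move=> r _ /=; rewrite lee_fin [leRHS]ger0_norm; last by rewrite mulr_ge0 // addr_ge0 // sqr_ge0.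
apply: (le_trans (ip_sqrt_CS (closureL2_L2 (Sg r I)) (closureL2_L2 Sw))).
rewrite sumr_const card_ord -mulr_natl mulrCA -/C mulrC ler_wpM2l //.
have := sqr_ge0 (normL2 L (g r) - 1); have := sqr_ge0 (normL2 L (g r)); nra.
Qed.

(** A continuous function with zero integral over every interval vanishes. *)
Lemma Rintegral_cont0 (g : R -> R) : continuous g ->
  (forall s t, s <= t -> \int[leb]_(r in `[s, t]) g r = 0) -> forall t, g t = 0.
Proof.
move=> cg g0 t.
have mI : leb.-integrable `[t - 1, t + 1] (EFin \o g).
  apply: continuous_compact_integrable; first exact: segment_compact.
  exact: continuous_subspaceT.
have [||_] := @continuous_FTC1_closed R g (t - 1) t (t + 1) _ mI _ (cg t); try lra.
have -> : (fun z : R => \int[leb]_(r in `[t - 1, z]) g r) = cst 0.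
  apply/funext => z; have [h|h] := leP (t - 1) z; first exact: g0.
  by rewrite set_itv_ge ?Rintegral_set0 // bnd_simp -ltNge.
by rewrite derive1E derive_cst.
Qed.

Lemma calV_L2 v : calV L v -> L2field v.
Proof. by move=> hv i; apply: smooth_inL2; exact: calV_smooth. Qed.

Lemma calV_H0 v : calV L v -> spH0 L v.
Proof. by move=> hv; apply: closureL2_self => //; exact: calV_L2. Qed.

Lemma calV_V0 v : calV L v -> spV0 L v.
Proof. by move=> hv; apply: closureH1_smooth => // i; exact: calV_smooth. Qed.

Lemma calF1_L2 (v : temperature R) : calF1 L v -> L2field v.
Proof. by move=> hv i; apply: smooth_inL2; exact: calF1_smooth. Qed.

Lemma calF1_V1 (v : temperature R) : calF1 L v -> spV1 L v.
Proof. by move=> hv; apply: closureH1_smooth => // i; exact: calF1_smooth. Qed.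

Lemma times_e2_L2 (theta : temperature R) : L2field theta -> L2field (times_e2 theta).
Proof.
move=> H i; rewrite /times_e2; case: (ord2P i) => -> /=.
  by apply: smooth_inL2; exact: smooth_cst.
exact: H.
Qed.

Lemma ip2E (u v : velocity R) : ip L u v = sp (u ord0) (v ord0) + sp (u ord_max) (v ord_max).
Proof.
rewrite ipE big_ord_recl big_ord1 (_ : lift ord0 ord0 = ord_max) //; exact: val_inj.
Qed.

Lemma ip1E (u v : temperature R) : ip L u v = sp (u ord0) (v ord0).
Proof. by rewrite ipE big_ord1. Qed.

Lemma sp0l f : sp (fun=> 0) f = 0.
Proof.
rewrite /dotL2; under eq_Rintegral do rewrite mul0r.
by rewrite Rintegral_cst ?mul0r //; exact: measurable_Omega.
Qed.

Lemma ip_times_e2 (theta : temperature R) v : ip L (times_e2 theta) v = sp (theta ord0) (v ord_max).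
Proof. by rewrite ip2E /times_e2 /= sp0l add0r. Qed.

(** Fields of [V] do not see the Leray projector. *)
Lemma leray_ip (theta : temperature R) p v : L2field theta -> is_leray L (times_e2 theta) p -> calV L v ->
  ip L p v = sp (theta ord0) (v ord_max).
Proof.
move=> Ht [Hp hp] hv; have := hp v (calV_H0 hv).
rewrite ip_subl; [|exact: times_e2_L2|exact: closureL2_L2 Hp|exact: calV_L2].
by rewrite ip_times_e2 => /eqP; rewrite subr_eq0 => /eqP.
Qed.

Lemma gradip_ae n (u1 u2 v : field R n) : L2field u1 -> L2field u2 -> field_ae_eq L u1 u2 ->
  gradip L u1 v = gradip L u2 v.
Proof.
move=> H1 H2 e.
have ew j : wgrad L u1 j = wgrad L u2 j.
  by apply/funext => i; rewrite /wgrad; apply: wpartial_ae => //; exact: e.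
by rewrite /gradip; apply: eq_bigr => j _; rewrite ew.
Qed.

(** The advection term [B_0(u, u)] depends on the class of [u] only. *)
Lemma formB_self_ae (S : set (velocity R)) (u1 u2 v : velocity R) : closureH1 L S u1 -> closureH1 L S u2 ->
  field_ae_eq L u1 u2 -> L2field v -> formB L u1 u1 v = formB L u2 u2 v.
Proof.
move=> S1 S2 e Hv.
have H1 := closureH1_L2 S1; have H2 := closureH1_L2 S2.
have ew i j : wgrad L u1 j i = wgrad L u2 j i by rewrite /wgrad; apply: wpartial_ae => //; exact: e.
have mB (u : velocity R) i : closureH1 L S u ->
    measurable_fun (Om : set T2) (fun x => (\sum_(j < 2) u j x * wgrad L u j i x) * v i x).
  move=> Su; apply: measurable_funM; last by apply: inL2_meas; exact: Hv.
  apply: measurable_sum => j; apply: measurable_funM; apply: inL2_meas.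
    exact: (closureH1_L2 Su).
  exact: closureH1_wpartial_L2 Su.
rewrite /formB /ip; apply: eq_bigr => i _.
rewrite /Rintegral; apply: (congr1 fine).
apply: ae_eq_integral.
- exact: measurable_Omega.
- by apply/measurable_EFinP; exact: mB S1.
- by apply/measurable_EFinP; exact: mB S2.
- have e0 := e ord0; have e1 := e ord_max.
  apply: filterS2 e0 e1 => x /= e0 e1 Ox; congr (_ * _)%:E.
  by apply: eq_bigr => j _; rewrite ew; case: (ord2P j) => ->; rewrite ?e0 ?e1.
Qed.

Section Momentum.
Variables (nu kappa : R) (u1 u2 : R -> velocity R) (theta1 theta2 : R -> temperature R).
Hypothesis sol1 : strong_solution L nu kappa setT u1 theta1.
Hypothesis sol2 : strong_solution L nu kappa setT u2 theta2.
Hypothesis equ : forall t : R, field_ae_eq L (u1 t) (u2 t).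

(** The buoyancy term is determined by the velocity: [theta1 - theta2] is
    orthogonal to the second components of the fields of [V], for every [t]. *)
Lemma momentum_ortho v : calV L v -> forall t,
  sp (theta1 t ord0) (v ord_max) - sp (theta2 t ord0) (v ord_max) = 0.
Proof.
move=> hv.
have [cu1 cth1 [du1 [au1 [dth1 [ath1 [[Ldu1 _ tu1] _ m1 _]]]]]] := sol1.
have [cu2 cth2 [du2 [au2 [dth2 [ath2 [[Ldu2 _ tu2] _ m2 _]]]]]] := sol2.
have Hu1 t : closureH1 L (calV L) (u1 t) by exact: (cu1 t I).1.
have Hu2 t : closureH1 L (calV L) (u2 t) by exact: (cu2 t I).1.
have Ht1 t : L2field (theta1 t) by apply: closureH1_L2; exact: (cth1 t I).1.
have Ht2 t : L2field (theta2 t) by apply: closureH1_L2; exact: (cth2 t I).1.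
have vL2 := calV_L2 hv.
have contsp (th : R -> temperature R) : contV L (calF1 L) setT th ->
    continuous (fun t => sp (th t ord0) (v ord_max)).
  move=> ct; have := contV_ip ct (w := fun=> v ord_max) (fun=> vL2 ord_max).
  by under eq_fun do rewrite ip1E.
apply: Rintegral_cont0; first by move=> t; apply: cvgB; exact: contsp.
move=> s t st.
have mI : measurable (`[s, t] : set (measurableTypeR R)) by exact: measurable_itv.
have I1 := L2loc_int s t Ldu1 (calV_H0 hv).
have I2 := L2loc_int s t Ldu2 (calV_H0 hv).
transitivity (\int[leb]_(r in `[s, t]) (ip L (du1 r) v - ip L (du2 r) v)).
  congr fine; apply: ae_eq_integral => //.
  - apply/measurable_EFinP; apply: measurable_funTS; apply: continuous_measurable_fun.
    by move=> r; apply: cvgB; exact: contsp.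
  - apply/measurable_EFinP; apply: measurable_funB; apply/measurable_EFinP.
      exact: measurable_int I1.
    exact: measurable_int I2.
  - have FF := @ae_filter_ringOfSetsType _ _ _ leb.
    apply: (filterS2 _ _ m1 m2) => r /= /(_ I)[[_ _ A1] [p1 P1 E1]] /(_ I)[[_ _ A2] [p2 P2 E2]] _.
    rewrite -(leray_ip (Ht1 r) P1 hv) -(leray_ip (Ht2 r) P2 hv).
    rewrite -(E1 _ (calV_V0 hv)) -(E2 _ (calV_V0 hv)).
    have Dv : domA L (calV L) v by apply: domA_smooth => // i; exact: calV_smooth.
    rewrite A1 // A2 // (gradip_ae v (closureH1_L2 (Hu1 r)) (closureH1_L2 (Hu2 r)) (equ r)).
    rewrite (formB_self_ae (Hu1 r) (Hu2 r) (equ r) vL2); congr EFin; ring.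
rewrite RintegralB // -(tu1 s t st _ _ (calV_H0 hv)) // -(tu2 s t st _ _ (calV_H0 hv)) //.
rewrite !ip_subl; try exact: closureH1_L2; try by [].
have e r : ip L (u1 r) v = ip L (u2 r) v.
  rewrite !ipE; apply: eq_bigr => i _; apply: sp_ae => //.
  - exact: closureH1_L2 (Hu1 r) i.
  - exact: closureH1_L2 (Hu2 r) i.
  - exact: equ.
  - exact: ae_eq_refl.
by rewrite !e subrr.
Qed.

(** The difference of the temperatures depends, in the weak sense, on [x_2]
    only. *)
Lemma theta_ortho psi t : calF L psi ->
  sp (fun x => theta1 t ord0 x - theta2 t ord0 x) (fun x => DD ord0 psi x) = 0.
Proof.
move=> hpsi.
have [_ cth1 _] := sol1; have [_ cth2 _] := sol2.
have Ht1 : L2field (theta1 t) by apply: closureH1_L2; exact: (cth1 t I).1.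
have Ht2 : L2field (theta2 t) by apply: closureH1_L2; exact: (cth2 t I).1.
have hv := stream_calV L_gt0 hpsi.
rewrite spBl //; last exact: (calV_L2 hv ord_max).
exact: (momentum_ortho hv t).
Qed.

End Momentum.

End Evol.

(** * The temperature equation tested with functions of the vertical variable *)

Section Heat.
Variables (R : realType) (L : R).
Hypothesis L_gt0 : 0 < L.
Implicit Types (f g h : R * R -> R) (x : R * R).
Notation T2 := (measurableTypeR R * measurableTypeR R)%type.
Notation mu := (@mu2 R).
Notation leb := (@lebesgue_measure R).
Notation Om := (Omega L).
Notation sp := (dotL2 L).
Notation cvL2 := (cvL2 L).
Notation DD j f x := ('D_(dir R j) f x).

(** An element of [V_0] is a limit of smooth divergence-free fields.  Only the
    convergence in [L^2] is needed for velocities. *)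
Lemma seqV0 u : spV0 L u -> exists2 v : nat -> velocity R, (forall n, calV L (v n)) &
  forall i, cvL2 (fun n => v n i) (u i).
Proof.
move=> Hu; have [||v [hv cv _]] := closureH1_seq _ _ Hu.
- by move=> phi hphi i; exact: calV_L2.
- by move=> phi hphi i j; apply: smooth_inL2; apply: smooth_partial; exact: calV_smooth hphi.
- by exists v.
Qed.

(** An element of [V_1] is a limit of elements of [F] in [H^1]. *)
Lemma seqV1 theta : spV1 L theta -> exists phi : nat -> temperature R,
  [/\ forall n, calF1 L (phi n), cvL2 (fun n => phi n ord0) (theta ord0) &
   forall j, cvL2 (fun n x => DD j (phi n ord0) x) (wpartial L j (theta ord0))].
Proof.
move=> Ht; have [||v [hv cv cv']] := closureH1_seq _ _ Ht.
- by move=> phi hphi i; exact: calF1_L2.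
- by move=> phi hphi i j; apply: smooth_inL2; apply: smooth_partial; exact: calF1_smooth hphi.
- by exists v; split.
Qed.

(** A function of [x_2] seen as a function on the plane. *)
Definition vfun (w : R -> R) : R * R -> R := fun x => w x.2.

Lemma partial1_vfun w x : DD ord0 (vfun w) x = 0.
Proof. by rewrite derive_fst /vfun /=; exact: derive1_const. Qed.

Lemma partial2_vfun w x : DD ord_max (vfun w) x = vfun (fun y => 'D_1 w y) x.
Proof. by rewrite derive_snd. Qed.

Lemma smooth_vfunD w : smooth (vfun w) -> smooth (vfun (fun y => 'D_1 w y)).
Proof.
by move=> sw; have := smooth_partial ord_max sw; under eq_fun do rewrite partial2_vfun.
Qed.

Lemma cvL2_vfun w (F : nat -> R * R -> R) f : smooth (vfun w) -> inL2 L f -> cvL2 F f ->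
  cvL2 (fun n x => w x.2 * F n x) (fun x => w x.2 * f x).
Proof.
move=> sw Hf cF; have [C hC] := continuous_bddOm L (smooth_cont sw).
exact: (cvL2Mb (continuous_measOm (smooth_cont sw)) hC Hf cF).
Qed.

Lemma inL2_vfun w f : smooth (vfun w) -> inL2 L f -> inL2 L (fun x => w x.2 * f x).
Proof.
move=> sw Hf; have [C hC] := continuous_bddOm L (smooth_cont sw).
exact: (inL2Mb (continuous_measOm (smooth_cont sw)) hC Hf).
Qed.

(** Passage to the limit in an identity between scalar products. *)
Lemma sp_lim f g (F G : nat -> R * R -> R) f' g' (F' G' : nat -> R * R -> R) :
  inL2 L f -> inL2 L g -> inL2 L f' -> inL2 L g' ->
  cvL2 F f -> cvL2 G g -> cvL2 F' f' -> cvL2 G' g' ->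
  (forall n, sp (F n) (G n) = - sp (F' n) (G' n)) -> sp f g = - sp f' g'.
Proof.
move=> Hf Hg Hf' Hg' cF cG cF' cG' e.
have h1 := cvL2_sp Hf Hg cF cG.
have h2 : (fun n => sp (F n) (G n)) @ \oo --> - sp f' g'.
  have -> : (fun n => sp (F n) (G n)) = (fun n => - sp (F' n) (G' n)) by apply/funext => n; exact: e.
  by apply: cvgN; exact: cvL2_sp.
exact: (cvg_unique (@Rhausdorff R) h1 h2).
Qed.

(** Integration by parts against a function of [x_2]; there is no boundary
    term because the elements of [V_1] are periodic in [x_1] and vanish on the
    horizontal sides; [w] need not vanish there. *)
Lemma wpartial_vert theta j w : spV1 L theta -> smooth (vfun w) ->
  sp (wpartial L j (theta ord0)) (vfun w) = - sp (theta ord0) (fun x => DD j (vfun w) x).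
Proof.
move=> Ht sw; have [phi [hphi c1 c2]] := seqV1 Ht.
have Hw := smooth_inL2 L sw; have HDw := smooth_inL2 L (smooth_partial j sw).
have Htheta := closureH1_L2 Ht ord0; have Hwp := closureH1_wpartial_L2 ord0 j Ht.
apply: (sp_lim Hwp Hw Htheta HDw (c2 j) (cvL2_cst Hw) c1 (cvL2_cst HDw)) => n.
have Fn := hphi n ord0.
rewrite (int_by_parts L_gt0 j (calF_smooth Fn) sw) ?opprK //.
- by move=> y; rewrite (calF_periodic L_gt0 _ Fn).
- by move=> s; rewrite (calF_bdry0 _ Fn) (calF_bdry1 _ Fn) !mul0r.
Qed.

(** The advection identity for smooth fields. *)
Lemma trilinear_smooth v phi d w : calV L v -> calF L phi -> vprof d w ->
  sp (fun x => DD ord0 phi x) (fun x => w x.2 * v ord0 x) +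
  sp (fun x => DD ord_max phi x) (fun x => w x.2 * v ord_max x) =
  - sp phi (fun x => 'D_1 w x.2 * v ord_max x).
Proof.
move=> hv hphi hw.
have sw : smooth (vfun w) by case: hw.
have svj j : smooth (v j) by exact: calV_smooth hv.
have sphi : smooth phi by case: hphi.
have swv j : smooth (fun x => w x.2 * v j x) by apply: smoothM.
have H j : sp phi (fun x => DD j (fun x => w x.2 * v j x) x) = - sp (fun x => DD j phi x) (fun x => w x.2 * v j x).
  apply: (int_by_parts L_gt0 j sphi (swv j)).
    by move=> y /=; rewrite (calF_periodic L_gt0 y hphi) (calF_periodic L_gt0 y (hv.1 j)).
  by move=> s /=; rewrite (calF_bdry0 _ hphi) (calF_bdry1 _ hphi) !mul0r.
rewrite -[LHS]opprK opprD -!H -spDr; first last.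
- exact: smooth_inL2.
- by apply: smooth_inL2; apply: smooth_partial.
- by apply: smooth_inL2; apply: smooth_partial.
congr (- sp _ _); apply/funext => x.
rewrite !(partialM _ _ sw) // partial1_vfun partial2_vfun mulr0 addr0 addrA -mulrDr.
have := hv.2 x; rewrite big_ord_recl big_ord1 /= (_ : lift ord0 ord0 = ord_max); last exact: val_inj.
by move=> ->; rewrite mulr0 add0r mulrC.
Qed.

(** The advection term tested with a function [w(x_2)] is [- \int theta u_2 w'].
    The identity passes from smooth fields to their limits since both sides
    are continuous for the [L^2] convergence of [u], of [theta] and of the
    gradient of [theta], the factors in [w] being bounded. *)
Lemma formB_vert u theta d w : spV0 L u -> spV1 L theta -> vprof d w ->
  formB L u theta (fun=> vfun w) = - sp (theta ord0) (fun x => 'D_1 w x.2 * u ord_max x).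
Proof.
move=> Hu Ht hw.
have sw : smooth (vfun w) by case: hw.
have uL2 j : inL2 L (u j) by exact: closureH1_L2 Hu j.
have tL2 : inL2 L (theta ord0) by exact: closureH1_L2 Ht ord0.
have wL2 j : inL2 L (wpartial L j (theta ord0)) by exact: closureH1_wpartial_L2 Ht.
have wuL2 j : inL2 L (fun x => w x.2 * u j x) by exact: inL2_vfun.
have -> : formB L u theta (fun=> vfun w) =
    sp (wpartial L ord0 (theta ord0)) (fun x => w x.2 * u ord0 x) +
    sp (wpartial L ord_max (theta ord0)) (fun x => w x.2 * u ord_max x).
  rewrite /formB /ip big_ord1 /dotL2 -RintegralD; [|exact: measurable_Omega|exact: inL2_mul..].
  apply: eq_Rintegral => x _.
  rewrite big_ord_recl big_ord1 (_ : lift ord0 ord0 = ord_max); last exact: val_inj.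
  rewrite /wgrad /vfun.
  move: (wpartial L ord0 _ x) (wpartial L ord_max _ x) (u ord0 x) (u ord_max x) (w x.2) => a b c e z.
  ring.
have [v hv cv] := seqV0 Hu; have [phi [hphi c1 c2]] := seqV1 Ht.
have sw' : smooth (vfun (fun y => 'D_1 w y)) by exact: smooth_vfunD.
have w'L2 : inL2 L (fun x => 'D_1 w x.2 * u ord_max x).
  by apply: (inL2_vfun (w := fun y => 'D_1 w y)).
have l1 j := cvL2_sp (wL2 j) (wuL2 j) (c2 j) (cvL2_vfun sw (uL2 j) (cv j)).
have l2 := cvL2_sp tL2 w'L2 c1 (cvL2_vfun sw' (uL2 ord_max) (cv ord_max)).
pose A n := sp (fun x => DD ord0 (phi n ord0) x) (fun x => w x.2 * v n ord0 x) +
  sp (fun x => DD ord_max (phi n ord0) x) (fun x => w x.2 * v n ord_max x).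
have l4 : A @ \oo --> sp (wpartial L ord0 (theta ord0)) (fun x => w x.2 * u ord0 x) +
    sp (wpartial L ord_max (theta ord0)) (fun x => w x.2 * u ord_max x).
  by apply: cvgD; exact: l1.
have l3 : A @ \oo --> - sp (theta ord0) (fun x => 'D_1 w x.2 * u ord_max x).
  have -> : A = fun n => - sp (phi n ord0) (fun x => 'D_1 w x.2 * v n ord_max x).
    by apply/funext => n; exact: trilinear_smooth (hv n) (hphi n ord0) hw.
  exact: cvgN.
exact: (cvg_unique (@Rhausdorff R) l4 l3).
Qed.

(** If [f] is orthogonal to all [D_1 psi], it is orthogonal to [w(x_2) u_2]:
    for smooth divergence-free [u] this function is the [x_1]-derivative of
    [w psi], where [u_2 = D_1 psi]. *)
Lemma vert_ortho u f w : spV0 L u -> inL2 L f -> smooth (vfun w) ->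
  (forall psi, calF L psi -> sp f (fun x => DD ord0 psi x) = 0) ->
  sp f (fun x => w x.2 * u ord_max x) = 0.
Proof.
move=> Hu Hf sw H; have [v hv cv] := seqV0 Hu.
have uL2 : inL2 L (u ord_max) by exact: closureH1_L2 Hu ord_max.
apply: (cvL2_sp0 Hf (inL2_vfun sw uL2) (cvL2_vfun sw uL2 (cv ord_max))) => n.
have [psi hpsi ->] := calV_second L_gt0 (hv n).
have spsi : smooth psi by case: hpsi.
rewrite -(H _ (calF_mul_vert L_gt0 sw hpsi)).
have -> : (fun x => w x.2 * DD ord0 psi x) = (fun x => DD ord0 (fun x => w x.2 * psi x) x); last by [].
by apply/funext => x; rewrite (partialM _ _ sw spsi) partial1_vfun mulr0 addr0.
Qed.

Lemma sum2E (F : 'I_2 -> R) : \sum_(j < 2) F j = F ord0 + F ord_max.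
Proof.
rewrite big_ord_recl big_ord1; congr (_ + F _); exact: val_inj.
Qed.

Lemma gradip1E (u v : temperature R) : gradip L u v =
  sp (wpartial L ord0 (u ord0)) (wpartial L ord0 (v ord0)) +
  sp (wpartial L ord_max (u ord0)) (wpartial L ord_max (v ord0)).
Proof.
rewrite /gradip sum2E.
exact: (f_equal2 (fun a b => a + b) (ip1E L (wgrad L u ord0) (wgrad L v ord0))
  (ip1E L (wgrad L u ord_max) (wgrad L v ord_max))).
Qed.

Section Eq.
Variables (nu kappa : R) (u1 u2 : R -> velocity R) (theta1 theta2 : R -> temperature R).
Hypothesis sol1 : strong_solution L nu kappa setT u1 theta1.
Hypothesis sol2 : strong_solution L nu kappa setT u2 theta2.
Hypothesis equ : forall t : R, field_ae_eq L (u1 t) (u2 t).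

(** The difference of the two temperatures at time [t]. *)
Definition theta_diff (t : R) : R * R -> R := fun x => theta1 t ord0 x - theta2 t ord0 x.

Lemma theta1_V1 t : spV1 L (theta1 t).
Proof. by have [_ c _] := sol1; exact: (c t I).1. Qed.
Lemma theta2_V1 t : spV1 L (theta2 t).
Proof. by have [_ c _] := sol2; exact: (c t I).1. Qed.
Lemma u1_V0 t : spV0 L (u1 t).
Proof. by have [c _ _] := sol1; exact: (c t I).1. Qed.
Lemma u2_V0 t : spV0 L (u2 t).
Proof. by have [c _ _] := sol2; exact: (c t I).1. Qed.

Lemma theta_diff_L2 t : inL2 L (theta_diff t).
Proof.
by apply: inL2B; [exact: closureH1_L2 (theta1_V1 t) ord0|exact: closureH1_L2 (theta2_V1 t) ord0].
Qed.

Lemma theta_diff_continuous w : inL2 L w -> continuous (fun t => sp (theta_diff t) w).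
Proof.
move=> Hw.
have [_ c1 _] := sol1; have [_ c2 _] := sol2.
have -> : (fun t => sp (theta_diff t) w) = (fun t => ip L (theta1 t) (fun=> w) - ip L (theta2 t) (fun=> w)).
  apply/funext => t; rewrite !ip1E /theta_diff spBl //.
    exact: closureH1_L2 (theta1_V1 t) ord0.
  exact: closureH1_L2 (theta2_V1 t) ord0.
by move=> t; apply: cvgB; [exact: (contV_ip c1 (w := fun=> w))|exact: (contV_ip c2 (w := fun=> w))].
Qed.

(** The temperature equation at a fixed time, tested with a function of [x_2]
    with compact support in [(0, 1)]. *)
Lemma heat_equation_vert u theta a dth d w : spV0 L u -> spV1 L theta ->
  is_A L (calF1 L) theta a -> 0 < d -> vprof d w ->
  (forall w, spV1 L w -> ip L dth w + kappa * ip L a w + formB L u theta w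
              - ip L (dot_e2 u) w = 0) ->
  sp (dth ord0) (vfun w) =
   - (kappa * sp (wpartial L ord_max (theta ord0)) (vfun (fun y => 'D_1 w y)))
   + sp (theta ord0) (fun x => 'D_1 w x.2 * u ord_max x) + sp (u ord_max) (vfun w).
Proof.
move=> Hu Ht [_ _ HA] d0 hw Heq.
have Fw : calF1 L (fun=> vfun w) by move=> i; exact: calF_vprof d0 hw.
have sw : smooth (vfun w) by case: hw.
have := Heq _ (calF1_V1 L_gt0 Fw).
rewrite HA; last by apply: domA_smooth.
rewrite (formB_vert Hu Ht hw) !ip1E.
have -> : gradip L theta (fun=> vfun w) = sp (wpartial L ord_max (theta ord0)) (vfun (fun y => 'D_1 w y)).
  rewrite gradip1E.
  have E j : sp (wpartial L j (theta ord0)) (wpartial L j (vfun w)) =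
      sp (wpartial L j (theta ord0)) (fun x => DD j (vfun w) x).
    apply: sp_ae.
    - exact: closureH1_wpartial_L2 Ht.
    - exact: closureH1_wpartial_L2 Ht.
    - by have [] := inH1_wpartial j (smooth_inH1 L_gt0 sw).
    - by apply: smooth_inL2; exact: smooth_partial.
    - exact: ae_eq_refl.
    - exact: wpartial_smooth.
  have E0 : sp (wpartial L ord0 (theta ord0)) (wpartial L ord0 (vfun w)) = 0.
    rewrite (E ord0).
    have -> : (fun x => DD ord0 (vfun w) x) = fun=> 0 by apply/funext => x; exact: partial1_vfun.
    by rewrite spC sp0l.
  have E1 : sp (wpartial L ord_max (theta ord0)) (wpartial L ord_max (vfun w)) =
      sp (wpartial L ord_max (theta ord0)) (vfun (fun y => 'D_1 w y)).
    rewrite (E ord_max).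
    by have -> : (fun x => DD ord_max (vfun w) x) = vfun (fun y => 'D_1 w y) by apply/funext => x; exact: partial2_vfun.
  by rewrite (f_equal2 (fun a b => a + b) E0 E1) add0r.
rewrite /dot_e2 => h; apply/eqP; rewrite -subr_eq0 -h; apply/eqP; ring.
Qed.

End Eq.
End Heat.

(** * Sine modes as limits of compactly supported functions *)

Section Sine.
Variables (R : realType) (L : R).
Hypothesis L_gt0 : 0 < L.

(** The vertical sine mode [sin (m pi y)]. *)
Definition sinm (m : nat) (y : R) : R := sin (pi * m%:R * y).

Lemma is_derive_sinm m (y : R) :
  is_derive y (1 : R) (sinm m) (pi * m%:R * cos (pi * m%:R * y)).
Proof. by apply: is_derive_eq; rewrite /GRing.scale /=; ring. Qed.

Lemma smooth_sinm m : smooth (vfun (sinm m)).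
Proof.
have := (smooth_trig 0 1 (pi * m%:R : R)).2.
by under eq_fun do rewrite mul0r add0r mul1r.
Qed.

Lemma derive_sinmE m (y : R) : 'D_1 (sinm m) y = pi * m%:R * cos (pi * m%:R * y).
Proof. by have H := is_derive_sinm m y; rewrite derive_val. Qed.

Lemma derive_sinm m : (fun y => 'D_1 (sinm m) y) = fun y => pi * m%:R * cos (pi * m%:R * y).
Proof. by apply/funext => y; exact: derive_sinmE. Qed.

Lemma derive2_sinm m : (fun y => 'D_1 (fun y => 'D_1 (sinm m) y) y) = fun y => - (pi * m%:R) ^+ 2 * sinm m y.
Proof.
apply/funext => y; rewrite derive_sinm.
have H : is_derive y (1 : R) (fun y => pi * m%:R * cos (pi * m%:R * y)) (- (pi * m%:R) ^+ 2 * sinm m y).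
  by apply: is_derive_eq; rewrite /GRing.scale /sinm /=; ring.
by rewrite derive_val.
Qed.

Lemma sin_lip (a b : R) : `|sin a - sin b| <= `|a - b|.
Proof.
wlog ab : a b / a < b.
  move=> H; have [ab|ab|->] := ltgtP a b; last by rewrite !subrr.
    exact: H.
  by rewrite distrC (distrC a); exact: H.
have [c _ E] := @MVT R sin cos a b ab (fun x _ => is_derive_sin x)
  (continuous_subspaceT (@continuous_sin R)).
rewrite distrC E normrM distrC ler_piMl //; exact: cos_max.
Qed.

Lemma sinm_lip m (a b : R) : `|sinm m a - sinm m b| <= pi * m%:R * `|a - b|.
Proof.
apply: (le_trans (sin_lip _ _)); rewrite -mulrBr normrM ger0_norm //.
by rewrite mulr_ge0 ?pi_ge0.
Qed.

Lemma sinm0 m : sinm m 0 = 0. Proof. by rewrite /sinm mulr0 sin0. Qed.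

Lemma sinm1 m : sinm m 1 = 0.
Proof.
rewrite /sinm mulr1; elim: m => [|m IH]; first by rewrite mulr0 sin0.
by rewrite -natr1 mulrDr mulr1 sinDpi IH oppr0.
Qed.

(** The derivative of [bump 1], that is [exp(-1/z) / z^2] for [z > 0]. *)
Definition bump_deriv (z : R) := bump (dbump 1) z.

Lemma bump_derivE z : bump_deriv z = if 0 < z then z^-1 ^+ 2 * expR (- z^-1) else 0.
Proof.
rewrite /bump_deriv /bump /dbump; case: ifP => // _; congr (_ * _).
by rewrite derivC subr0 mulr1 hornerXn.
Qed.

Lemma bump_deriv_bound z : 0 <= (z + 1) * bump_deriv z <= 3.
Proof.
rewrite bump_derivE; case: ifPn => z0; last by rewrite mulr0 lexx ler0n.
have u0 : 0 <= z^-1 by rewrite invr_ge0 ltW.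
have -> : (z + 1) * (z^-1 ^+ 2 * expR (- z^-1)) = z^-1 ^+ 1 * expR (- z^-1) + z^-1 ^+ 2 * expR (- z^-1).
  have z1 : z != 0 by rewrite gt_eqF.
  rewrite mulrDl mul1r; congr (_ + _); rewrite mulrA; congr (_ * _).
  by rewrite expr2 expr1 mulrA mulfV // mul1r.
have h1 := powexp_le 1 u0; have h2 := powexp_le 2 u0.
apply/andP; split; first by rewrite addr_ge0 // mulr_ge0 ?exprn_ge0 ?expR_ge0.
by have := lerD h1 h2; rewrite -natrD.
Qed.

Lemma bump_deriv_small z : 1 <= z -> (z + 1) * bump_deriv z <= 2 / z.
Proof.
move=> z1; have z0 : 0 < z by lra.
rewrite bump_derivE z0.
have e1 : expR (- z^-1) <= 1 by rewrite expR_le1 oppr_le0 invr_ge0 ltW.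
apply: (@le_trans _ _ ((z + 1) * (z^-1 ^+ 2))).
  by rewrite mulrA ler_piMr // mulr_ge0 ?sqr_ge0 //; lra.
have -> : 2 / z = (2 * z) * z^-1 ^+ 2 by field; rewrite gt_eqF.
by rewrite ler_wpM2r ?sqr_ge0 //; lra.
Qed.

(** The quantity [s] times the derivative at [s] of the cut-off factor
    [bump 1 ((n+1) s - 1)].  It is bounded, and tends to [0] for fixed
    [s > 0]. *)
Definition rbump (n : nat) (s : R) := n.+1%:R * s * bump_deriv (n.+1%:R * s - 1).

Lemma rbump_bound n s : `|rbump n s| <= 3.
Proof.
have := bump_deriv_bound (n.+1%:R * s - 1); rewrite subrK -/(rbump n s) => /andP[h0 h3].
by rewrite ger0_norm.
Qed.

Lemma rbump_cvg s : 0 < s -> rbump n s @[n --> \oo] --> (0 : R).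
Proof.
move=> s0; apply: (squeeze_cvgr (f := fun=> 0) (h := fun n => (4 / s) * n.+1%:R^-1)).
- near=> n.
  have := bump_deriv_bound (n.+1%:R * s - 1); rewrite subrK -/(rbump n s) => /andP[-> _] /=.
  have hn : 2 / s < n.+1%:R.
    near: n; have [N hN] : exists N : nat, 2 / s < N%:R.
      by exists (Num.bound (2 / s)); rewrite archi_boundP // divr_ge0 // ltW.
    by exists N => // n /= Nn; apply: (lt_le_trans hN); rewrite ler_nat leqW.
  have h2 : 2 < n.+1%:R * s by rewrite -ltr_pdivrMr.
  have := @bump_deriv_small (n.+1%:R * s - 1) _; rewrite subrK -/(rbump n s) => H.
  apply: (le_trans (H _)); first by lra.
  have -> : 4 / s / n.+1%:R = 2 / (n.+1%:R * s / 2).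
    by move: (n.+1%:R) hn => M hn; field; rewrite !gt_eqF //=; apply: lt_trans hn; rewrite divr_gt0.
  by rewrite ler_pM2l // lef_pV2 ?posrE; lra.
- exact: cvg_cst.
- by rewrite -[X in _ --> X](mulr0 (4 / s)); apply: cvgM; [exact: cvg_cst|exact: cvg_harmonic].
Unshelve. all: by end_near. Qed.

(** A compactly supported approximation of [sinm m]. *)
Definition wsin (m n : nat) (y : R) := hat n 0 1 y * sinm m y.

Lemma vprof_wsin m n : vprof (n.+1%:R^-1) (wsin m n).
Proof.
split; first by apply: smoothM; [exact: (smooth_hat n 0 1).2|exact: smooth_sinm].
by move=> y; rewrite mulf_eq0 negb_or => /andP[/hat_supp]; rewrite add0r.
Qed.

Lemma is_derive_hat n (y : R) : is_derive y (1 : R) (hat n 0 1)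
  (n.+1%:R * bump_deriv (n.+1%:R * y - 1) * bump 1 (n.+1%:R * (1 - y) - 1)
   - bump 1 (n.+1%:R * y - 1) * (n.+1%:R * bump_deriv (n.+1%:R * (1 - y) - 1))).
Proof.
have d1 : is_derive y (1 : R) (fun t => bump 1 (n.+1%:R * (t - 0) - 1)) (bump_deriv (n.+1%:R * (y - 0) - 1) * n.+1%:R).
  apply: (is_derive1_comp (f := bump 1) (g := fun t => n.+1%:R * (t - 0) - 1)).
    exact: is_derive_bump.
  by apply: is_derive_eq; rewrite /GRing.scale /=; ring.
have d2 : is_derive y (1 : R) (fun t => bump 1 (n.+1%:R * (1 - t) - 1)) (bump_deriv (n.+1%:R * (1 - y) - 1) * - n.+1%:R).
  apply: (is_derive1_comp (f := bump 1) (g := fun t => n.+1%:R * (1 - t) - 1)).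
    exact: is_derive_bump.
  by apply: is_derive_eq; rewrite /GRing.scale /=; ring.
rewrite /hat; apply: is_derive_eq; rewrite /GRing.scale /= subr0; ring.
Qed.

(** The derivative of the cut-off is unbounded in [n] near [0] and [1]; it is
    multiplied by [y] or [1 - y], which makes it bounded, and the quotient of
    [sinm m y] by that factor remains bounded as well. *)
Lemma derive_wsin m n y : 0 < y < 1 -> 'D_1 (wsin m n) y =
  rbump n y * bump 1 (n.+1%:R * (1 - y) - 1) * (sinm m y / y)
  - bump 1 (n.+1%:R * y - 1) * rbump n (1 - y) * (sinm m y / (1 - y))
  + hat n 0 1 y * (pi * m%:R * cos (pi * m%:R * y)).
Proof.
move=> /andP[y0 y1].
have dh := is_derive_hat n y; have ds := is_derive_sinm m y.
rewrite /wsin; apply: derive_val; apply: is_derive_eq.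
rewrite /GRing.scale /= /rbump.
move: (bump_deriv (n.+1%:R * y - 1)) (bump_deriv (n.+1%:R * (1 - y) - 1)) (bump 1 (n.+1%:R * (1 - y) - 1))
  (bump 1 (n.+1%:R * y - 1)) (hat n 0 1 y) (n.+1%:R) (sinm m y) (pi * m%:R * cos _) => b1 b2 b3 b4 h N s k.
by field; rewrite (gt_eqF y0) subr_eq0 gt_eqF.
Qed.

Lemma Omega_snd (x : R * R) : Omega L x -> 0 < x.2 < 1.
Proof. by move=> [_ /=]; rewrite in_itv. Qed.

Lemma sinm_div m y : 0 < y < 1 -> `|sinm m y / y| <= pi * m%:R.
Proof.
move=> /andP[y0 _]; rewrite normrM normfV (gtr0_norm y0) ler_pdivrMr //.
by have := sinm_lip m y 0; rewrite sinm0 !subr0 (gtr0_norm y0).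
Qed.

Lemma sinm_div1 m y : 0 < y < 1 -> `|sinm m y / (1 - y)| <= pi * m%:R.
Proof.
move=> /andP[_ y1]; have y0 : 0 < 1 - y by rewrite subr_gt0.
rewrite normrM normfV (gtr0_norm y0) ler_pdivrMr //.
by have := sinm_lip m y 1; rewrite sinm1 subr0 distrC (gtr0_norm y0).
Qed.

Lemma cvL2_wsin m : cvL2 L (fun n => vfun (wsin m n)) (vfun (sinm m)).
Proof.
apply: (cvL2_dct (C := 1)).
- by move=> n; apply: continuous_measOm; apply: smooth_cont; case: (vprof_wsin m n).
- by apply: continuous_measOm; apply: smooth_cont; exact: smooth_sinm.
- move=> n x _; rewrite normrM (ger0_norm (hat_ge0 _ _ _ _)).
  by apply: mulr_ile1; rewrite ?hat_ge0 ?hat_le1 ?sin_max.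
- move=> x Ox; rewrite /vfun /wsin -[X in _ --> X]mul1r.
  apply: cvgM; last exact: cvg_cst.
  by have := @hat_cvg R 0 1 x.2; rewrite (Omega_snd Ox).
Qed.

(** Together with [cvL2_wsin]: [sin (m pi x_2)] is the limit of [wsin m n] in
    the [H^1] norm. *)
Lemma cvL2_derive_wsin m : cvL2 L (fun n => vfun (fun y => 'D_1 (wsin m n) y)) (vfun (fun y => 'D_1 (sinm m) y)).
Proof.
have p0 : 0 <= pi * m%:R :> R by rewrite mulr_ge0 ?pi_ge0.
apply: (cvL2_dct (C := 7 * (pi * m%:R))).
- move=> n; apply: continuous_measOm; apply: smooth_cont; apply: smooth_vfunD.
  by case: (vprof_wsin m n).
- by apply: continuous_measOm; apply: smooth_cont; apply: smooth_vfunD; exact: smooth_sinm.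
- move=> n x Ox; rewrite /vfun derive_wsin; last exact: Omega_snd.
  have b1 (z : R) : `|bump 1 z| <= 1 by rewrite ger0_norm ?bump1_ge0 ?bump1_le1.
  have := sinm_div m (Omega_snd Ox); have := sinm_div1 m (Omega_snd Ox).
  move: (sinm m x.2 / x.2) (sinm m x.2 / (1 - x.2)) => q1 q2 h2 h1.
  have -> : 7 * (pi * m%:R) = 3 * 1 * (pi * m%:R) + 1 * 3 * (pi * m%:R) + 1 * (pi * m%:R) :> R by ring.
  apply: (le_trans (ler_normD _ _)); apply: lerD.
    apply: (le_trans (ler_normB _ _)); apply: lerD.
      rewrite normrM ler_pM ?normr_ge0 // normrM ler_pM ?normr_ge0 //; exact: rbump_bound.
    rewrite normrM ler_pM ?normr_ge0 // normrM ler_pM ?normr_ge0 //; exact: rbump_bound.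
  rewrite normrM ler_pM ?normr_ge0 //; first by rewrite ger0_norm ?hat_ge0 ?hat_le1.
  by rewrite normrM (ger0_norm p0) ler_piMr // cos_max.
- move=> x Ox; rewrite /vfun derive_sinmE; have /andP[x0 x1] := Omega_snd Ox.
  have e n : 'D_1 (wsin m n) x.2 = _ := derive_wsin m n (Omega_snd Ox).
  under eq_fun do rewrite e.
  have x1' : 0 < 1 - x.2 by rewrite subr_gt0.
  have lb1 : bump 1 (n.+1%:R * (1 - x.2) - 1) @[n --> \oo] --> (1 : R).
    by have := @bump1_cvg R (1 - x.2); rewrite x1'.
  have lb2 : bump 1 (n.+1%:R * x.2 - 1) @[n --> \oo] --> (1 : R).
    by have := @bump1_cvg R x.2; rewrite x0.
  have lh : hat n 0 1 x.2 @[n --> \oo] --> (1 : R).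
    by have := @hat_cvg R 0 1 x.2; rewrite (Omega_snd Ox).
  move: (sinm m x.2 / x.2) (sinm m x.2 / (1 - x.2)) (pi * m%:R * cos _) => q1 q2 k.
  have E : 0 * 1 * q1 - 1 * 0 * q2 + 1 * k = k by ring.
  suff : (fun n => rbump n x.2 * bump 1 (n.+1%:R * (1 - x.2) - 1) * q1 -
      bump 1 (n.+1%:R * x.2 - 1) * rbump n (1 - x.2) * q2 + hat n 0 1 x.2 * k) @ \oo
      --> 0 * 1 * q1 - 1 * 0 * q2 + 1 * k by rewrite E.
  apply: cvgD; last by apply: cvgM; [exact: lh|exact: cvg_cst].
  apply: cvgB.
    by apply: cvgM; [apply: cvgM; [exact: rbump_cvg|exact: lb1]|exact: cvg_cst].
  by apply: cvgM; [apply: cvgM; [exact: lb2|exact: rbump_cvg]|exact: cvg_cst].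
Qed.

Lemma sinm_H1 m : spH1 L (fun=> vfun (sinm m)).
Proof.
apply: (closureL2_of_seq (phi := fun n => fun=> vfun (wsin m n))).
- by move=> _; apply: smooth_inL2; exact: smooth_sinm.
- move=> n i; have d0 : 0 < n.+1%:R^-1 :> R by rewrite invr_gt0 ltr0n.
  exact: calF_vprof d0 (vprof_wsin m n).
- by move=> _; exact: cvL2_wsin.
Qed.

End Sine.

(** * Bounded solutions of a linear decay equation on the whole line *)

Section Decay.
Variable R : realType.
Notation leb := (@lebesgue_measure R).

(** The equation [f' = - c f] with [0 < c], in integrated form, has no nonzero
    solution that is bounded on the whole line. *)
Lemma bounded_decay0 (f : R -> R) (c M : R) : 0 < c -> continuous f ->
  (forall t, `|f t| <= M) ->
  (forall s t, s <= t -> f t - f s = \int[leb]_(r in `[s, t]) (- c * f r)) ->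
  forall t, f t = 0.
Proof.
move=> c0 cf bf fint.
have df t : is_derive t (1 : R) f (- c * f t).
  pose g r := - c * f r.
  have cg : continuous g by move=> r; apply: cvgM; [exact: cvg_cst|exact: cf].
  have mI : leb.-integrable `[t - 1, t + 1] (EFin \o g).
    apply: continuous_compact_integrable; first exact: segment_compact.
    exact: continuous_subspaceT.
  pose F (z : R) := \int[leb]_(r in `[t - 1, z]) g r.
  have [d1 d2] : derivable F t 1 /\ (F^`())%classic t = g t.
    by apply: (@continuous_FTC1_closed R g (t - 1) t (t + 1) _ mI _ (cg t)); lra.
  have FE z : t - 1 <= z -> f (t - 1) + F z = f z.
    by move=> tz; rewrite /F /g -(fint _ _ tz) addrC subrK.
  move: F d1 d2 FE => F d1 d2 FE.
  have e : \forall z \near t, f (t - 1) + F z = f z.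
    near=> z; apply: FE.
    by apply: ltW; near: z; apply: lt_nbhsr; lra.
  apply: (near_eq_is_derive e).
  rewrite derive1E in d2.
  have H : is_derive t (1 : R) F (- c * f t) by apply: DeriveDef.
  by have := is_deriveD (is_derive_cst (f (t - 1)) t (1 : R)) H; rewrite add0r.
have dE t : is_derive t (1 : R) (fun s => f s * expR (c * s)) 0.
  have H := df t.
  by apply: is_derive_eq; rewrite /GRing.scale /=; ring.
have E s t : f t = f s * expR (- (c * (t - s))).
  have h : f t * expR (c * t) = f s * expR (c * s) := is_derive_0_is_cst t s dE.
  have -> : - (c * (t - s)) = c * s - c * t by ring.
  by rewrite expRB mulrA -h mulfK // expR_eq0.
move=> t; apply/eqP; apply: contraT => ft.
have f0 : 0 < `|f t| by rewrite normr_gt0.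
have M0 : 0 <= M by apply: le_trans (bf t).
(* At the earlier time [t - x / c] the modulus of [f] is [|f t| * expR x],
   which is at least [|f t| + M] for this [x]. *)
pose x := M / `|f t|.
have x0 : 0 <= x by rewrite divr_ge0.
have := E (t - x / c) t.
have -> : c * (t - (t - x / c)) = x by field; rewrite gt_eqF.
move=> h.
have : `|f t| * expR x <= M.
  rewrite h normrM (gtr0_norm (expR_gt0 _)) -mulrA -expRD addNr expR0 mulr1.
  exact: bf.
rewrite mulrC -ler_pdivlMr // -/x => h2.
by have := expR_ge1Dx x; rewrite addrC => /le_trans /(_ h2); rewrite gerDl ler10.
Unshelve. all: by end_near. Qed.

End Decay.

(** * The sine modes of the temperature difference vanish *)

Section Modes.
Variables (R : realType) (L : R).
Hypothesis L_gt0 : 0 < L.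
Notation leb := (@lebesgue_measure R).
Notation sp := (dotL2 L).
Variables (nu kappa : R) (u1 u2 : R -> velocity R) (theta1 theta2 : R -> temperature R).
Hypothesis kappa_gt0 : 0 < kappa.
Hypothesis sol1 : strong_solution L nu kappa setT u1 theta1.
Hypothesis sol2 : strong_solution L nu kappa setT u2 theta2.
Hypothesis equ : forall t : R, field_ae_eq L (u1 t) (u2 t).
Notation delta := (theta_diff theta1 theta2).

(** The temperature equations of the two solutions at time [t], subtracted and
    tested with [sin (m pi x_2)].  They are first tested with [wsin m n]; the
    two advection terms then have the same value by [vert_ortho], and the
    velocities cancel before [n] tends to infinity. *)
Lemma mode_equation t (a1 a2 dth1 dth2 : temperature R) m :
  L2field L dth1 -> L2field L dth2 ->
  is_A L (calF1 L) (theta1 t) a1 -> is_A L (calF1 L) (theta2 t) a2 ->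
  (forall w, spV1 L w -> ip L dth1 w + kappa * ip L a1 w + formB L (u1 t) (theta1 t) w
              - ip L (dot_e2 (u1 t)) w = 0) ->
  (forall w, spV1 L w -> ip L dth2 w + kappa * ip L a2 w + formB L (u2 t) (theta2 t) w
              - ip L (dot_e2 (u2 t)) w = 0) ->
  sp (dth1 ord0) (vfun (sinm m)) - sp (dth2 ord0) (vfun (sinm m)) =
  - (kappa * (pi * m%:R) ^+ 2) * sp (delta t) (vfun (sinm m)).
Proof.
move=> Hd1 Hd2 A1 A2 E1 E2.
have V1 := theta1_V1 sol1 t; have V2 := theta2_V1 sol2 t.
have U1 := u1_V0 sol1 t; have U2 := u2_V0 sol2 t.
have uL1 : inL2 L (u1 t ord_max) := closureH1_L2 U1 ord_max.
have uL2 : inL2 L (u2 t ord_max) := closureH1_L2 U2 ord_max.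
have tL1 : inL2 L (theta1 t ord0) := closureH1_L2 V1 ord0.
have tL2 : inL2 L (theta2 t ord0) := closureH1_L2 V2 ord0.
pose p1 := wpartial L ord_max (theta1 t ord0); pose p2 := wpartial L ord_max (theta2 t ord0).
have pL1 : inL2 L p1 := closureH1_wpartial_L2 ord0 ord_max V1.
have pL2 : inL2 L p2 := closureH1_wpartial_L2 ord0 ord_max V2.
have ss := smooth_sinm R m.
have sL2 := smooth_inL2 L ss.
have sD := smooth_vfunD ss.
have DL2 := smooth_inL2 L sD.
pose D x := dth1 ord0 x - dth2 ord0 x.
pose W x := kappa * (p1 x - p2 x).
have HD : inL2 L D by exact: inL2B.
have HW : inL2 L W by apply: inL2Z; exact: inL2B.
have key n : sp D (vfun (wsin m n)) = - sp W (vfun (fun y => 'D_1 (wsin m n) y)).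
  have d0 : 0 < n.+1%:R^-1 :> R by rewrite invr_gt0 ltr0n.
  have hw := vprof_wsin R m n.
  have sw : smooth (vfun (wsin m n)) := hw.1.
  have sw' := smooth_vfunD sw.
  have wL2 := smooth_inL2 L sw; have w'L2 := smooth_inL2 L sw'.
  have h1 := heat_equation_vert L_gt0 U1 V1 A1 d0 hw E1.
  have h2 := heat_equation_vert L_gt0 U2 V2 A2 d0 hw E2.
  have ue : sp (u1 t ord_max) (vfun (wsin m n)) = sp (u2 t ord_max) (vfun (wsin m n)).
    by apply: sp_ae => //; [exact: equ|exact: ae_eq_refl].
  have B1 : inL2 L (fun x => 'D_1 (wsin m n) x.2 * u1 t ord_max x).
    by apply: (inL2_vfun (w := fun y => 'D_1 (wsin m n) y)).
  have B2 : inL2 L (fun x => 'D_1 (wsin m n) x.2 * u2 t ord_max x).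
    by apply: (inL2_vfun (w := fun y => 'D_1 (wsin m n) y)).
  have te : sp (theta2 t ord0) (fun x => 'D_1 (wsin m n) x.2 * u2 t ord_max x) =
      sp (theta2 t ord0) (fun x => 'D_1 (wsin m n) x.2 * u1 t ord_max x).
    apply: sp_ae => //; first exact: ae_eq_refl.
    by apply: filterS (equ t ord_max) => x /= ex Ox; rewrite ex.
  have := vert_ortho L_gt0 U1 (theta_diff_L2 sol1 sol2 t) sw' (fun psi => theta_ortho L_gt0 sol1 sol2 equ t (psi := psi)).
  rewrite spBl // => ho.
  rewrite /D /W spBl // spZl //; last exact: inL2B.
  rewrite spBl // h1 h2 ue te -/p1 -/p2.
  move: ho => /eqP; rewrite subr_eq0 => /eqP ->.
  move: (sp p1 _) (sp p2 _) (sp (theta2 t ord0) _) (sp (u2 t ord_max) _) => a b c e.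
  by ring.
have lim := sp_lim HD sL2 HW DL2 (cvL2_cst HD) (cvL2_wsin L m) (cvL2_cst HW) (cvL2_derive_wsin L m) key.
have := lim; rewrite {1}/D {1}/W spBl // spZl //; last exact: inL2B.
rewrite spBl // => ->.
have ws (th : temperature R) : spV1 L th ->
    sp (wpartial L ord_max (th ord0)) (vfun (fun y => 'D_1 (sinm m) y)) = (pi * m%:R) ^+ 2 * sp (th ord0) (vfun (sinm m)).
  move=> Vth; rewrite (wpartial_vert L_gt0 _ Vth sD).
  have -> : (fun x => 'D_(dir R ord_max) (vfun (fun y => 'D_1 (sinm m) y)) x) =
      (fun x => - (pi * m%:R) ^+ 2 * vfun (sinm m) x).
    apply/funext => x; rewrite partial2_vfun /vfun.
    exact: (congr1 (fun g => g x.2) (derive2_sinm R m)).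
  by rewrite spZr ?mulNr ?opprK //; exact: closureH1_L2 Vth ord0.
rewrite /p1 /p2 (ws _ V1) (ws _ V2) /theta_diff spBl //.
by ring.
Qed.

Hypothesis bnd : exists M, forall t, normL2 L (theta1 t) <= M /\ normL2 L (theta2 t) <= M.

(** The sine coefficients of the difference of the temperatures vanish. *)
Lemma mode_zero m t : sp (delta t) (vfun (sinm m)) = 0.
Proof.
have [->|m0] := eqVneq m 0%N.
  have -> : vfun (sinm 0) = fun=> 0 :> R.
    by apply/funext => x; rewrite /vfun /sinm mulr0 mul0r sin0.
  by rewrite spC sp0l.
have ss := smooth_sinm R m.
have sL2 := smooth_inL2 L ss.
have SH1 := sinm_H1 L m.
have [_ cth1 [du1 [au1 [dth1 [ath1 [_ [Ld1 _ td1] _ m1]]]]]] := sol1.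
have [_ cth2 [du2 [au2 [dth2 [ath2 [_ [Ld2 _ td2] _ m2]]]]]] := sol2.
have V1 t := theta1_V1 sol1 t; have V2 t := theta2_V1 sol2 t.
have [M bM] := bnd.
move: t; apply: (@bounded_decay0 R _ (kappa * (pi * m%:R) ^+ 2) ((M + M) * Num.sqrt (sp (vfun (sinm m)) (vfun (sinm m))))).
- by rewrite mulr_gt0 // exprn_gt0 // mulr_gt0 ?pi_gt0 // ltr0n lt0n.
- exact: theta_diff_continuous sol1 sol2 _ sL2.
- move=> t; rewrite /theta_diff spBl //; [|exact: closureH1_L2 (V1 t) ord0|exact: closureH1_L2 (V2 t) ord0].
  have H (th : temperature R) : spV1 L th -> normL2 L th <= M ->
      `|sp (th ord0) (vfun (sinm m))| <= M * Num.sqrt (sp (vfun (sinm m)) (vfun (sinm m))).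
    move=> Vth hM; apply: (le_trans (sp_CS_sqrt (closureH1_L2 Vth ord0) sL2)).
    by rewrite ler_wpM2r ?sqrtr_ge0 // (le_trans _ hM) // /normL2 ip1E.
  rewrite mulrDl (le_trans (ler_normB _ _)) // lerD //; apply: H => //; by case: (bM t).
move=> s t st.
have I1 := L2loc_int s t Ld1 SH1; have I2 := L2loc_int s t Ld2 SH1.
have mI : measurable (`[s, t] : set (measurableTypeR R)) by exact: measurable_itv.
transitivity (\int[leb]_(r in `[s, t]) (ip L (dth1 r) (fun=> vfun (sinm m)) - ip L (dth2 r) (fun=> vfun (sinm m)))).
  rewrite RintegralB // -(td1 s t st _ _ SH1) // -(td2 s t st _ _ SH1) // !ip1E /theta_diff.
  have h1 r : inL2 L (theta1 r ord0) := closureH1_L2 (V1 r) ord0.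
  have h2 r : inL2 L (theta2 r ord0) := closureH1_L2 (V2 r) ord0.
  rewrite !spBl //; ring.
apply: (congr1 fine); apply: ae_eq_integral => //.
- apply/measurable_EFinP; apply: measurable_funB; apply/measurable_EFinP.
    exact: measurable_int I1.
  exact: measurable_int I2.
- apply/measurable_EFinP; apply: measurable_funTS; apply: continuous_measurable_fun.
  move=> r; apply: cvgM; first exact: cvg_cst.
  exact: (theta_diff_continuous sol1 sol2 sL2).
- have FF := @ae_filter_ringOfSetsType _ _ _ leb.
  apply: (filterS2 _ _ m1 m2) => r /= /(_ I)[A1 E1] /(_ I)[A2 E2] _.
  rewrite !ip1E (mode_equation m _ _ A1 A2 E1 E2) //.
    exact: closureL2_L2 (Ld1.1 r I).
  exact: closureL2_L2 (Ld2.1 r I).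
Qed.

End Modes.

(** * Bernstein polynomials *)

Section Bernstein.
Variable R : realType.
Implicit Types (g h : nat -> R) (x : R).

(** The value at [x] of the [n]-th Bernstein polynomial of the data
    [g 0, ..., g n], by de Casteljau recursion; [g k] stands for the value
    at [k / n] of the function to be approximated. *)
Fixpoint bernstein (n : nat) g x : R :=
  if n is n'.+1 then x * bernstein n' (g \o S) x + (1 - x) * bernstein n' g x else g 0%N.

Lemma bernstein_le n g h x : 0 <= x <= 1 -> (forall k, (k <= n)%N -> g k <= h k) ->
  bernstein n g x <= bernstein n h x.
Proof.
move=> /andP[x0 x1]; elim: n g h => [|n IH] g h gh /=; first exact: gh.
apply: lerD; apply: ler_wpM2l => //; rewrite ?subr_ge0 //.
  by apply: IH => k kn; exact: gh.
by apply: IH => k kn; apply: gh; exact: leqW.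
Qed.

Lemma bernstein_affine n (a b : R) g x : bernstein n (fun k => a + b * g k) x = a + b * bernstein n g x.
Proof.
elim: n g => [//|n IH] g /=.
have -> : (fun k => a + b * g k) \o S = (fun k => a + b * (g \o S) k) by [].
by rewrite !IH; ring.
Qed.

(** The second moment of the binomial distribution about [a]. *)
Lemma bernstein_var n (a : R) x :
  bernstein n (fun k => (k%:R - a) ^+ 2) x = n%:R * x * (1 - x) + (n%:R * x - a) ^+ 2.
Proof.
elim: n a => [|n IH] a /=; first by ring.
have -> : (fun k => (k%:R - a) ^+ 2) \o S = (fun k => (k%:R - (a - 1)) ^+ 2).
  by apply/funext => k /=; rewrite -natr1; ring.
by rewrite !IH -natr1; ring.
Qed.

Lemma bernstein_bound n (M : R) g x : 0 <= x <= 1 -> (forall k, (k <= n)%N -> `|g k| <= M) ->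
  `|bernstein n g x| <= M.
Proof.
move=> hx gM.
have cst (c : R) : bernstein n (fun=> c) x = c.
  have := bernstein_affine n c 0 (fun=> 0) x.
  by rewrite !mul0r addr0.
rewrite ler_norml; apply/andP; split.
  by rewrite -(cst (- M)); apply: bernstein_le => // k /gM; rewrite ler_norml => /andP[].
by rewrite -[leRHS](cst M); apply: bernstein_le => // k /gM; rewrite ler_norml => /andP[].
Qed.

Local Arguments bernstein : simpl never.

(** Bernstein's estimate at the point [x]: the error [F (k / (n+1)) - F x] is at
    most [e / 2] for [k / (n+1)] at distance less than [d] from [x], and
    elsewhere it is bounded by [2 M ((k / (n+1) - x) / d)^2], whose mean is
    small. *)
Lemma bernstein_est (F : R -> R) (M x e d : R) (n : nat) : 0 < x < 1 ->
  (forall s, 0 <= s <= 1 -> `|F s| <= M) -> 0 < e -> 0 < d ->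
  (forall s, `|x - s| < d -> `|F x - F s| < e / 2) ->
  2 * M / d ^+ 2 * 2 / e < n.+1%:R ->
  `|F x - bernstein n.+1 (fun k => F (k%:R / n.+1%:R)) x| <= e.
Proof.
move=> /andP[x0 x1] FM e0 d0 hd.
have e2 : 0 < e / 2 by rewrite divr_gt0.
have M0 : 0 <= M by apply: le_trans (FM x _); rewrite ?normr_ge0 // (ltW x0) (ltW x1).
set K : R := 2 * M / d ^+ 2; set N : R := n.+1%:R => hn.
have K0 : 0 <= K by apply: divr_ge0; [exact: mulr_ge0|exact: sqr_ge0].
have N0 : 0 < N by rewrite ltr0n.
have dist k : (k <= n.+1)%N -> `|F (k%:R / N) - F x| <= e / 2 + K / N ^+ 2 * (k%:R - N * x) ^+ 2.
  move=> kn; have kN : 0 <= k%:R / N <= 1.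
    by rewrite divr_ge0 ?(ltW N0) //= ler_pdivrMr // mul1r ler_nat.
  have -> : K / N ^+ 2 * (k%:R - N * x) ^+ 2 = K * (k%:R / N - x) ^+ 2.
    by move: (k%:R) => k'; field; rewrite gt_eqF.
  have [near_|far] := ltP `|x - k%:R / N| d.
    have := hd _ near_; rewrite distrC => /ltW h; apply: (le_trans h).
    by rewrite lerDl mulr_ge0 ?sqr_ge0.
  apply: (@le_trans _ _ (2 * M)).
    rewrite (le_trans (ler_normB _ _)) // mulr2n mulrDl mul1r lerD ?FM //.
    by rewrite (ltW x0) (ltW x1).
  rewrite ler_wpDl ?(ltW e2) // /K -mulrA ler_peMr ?mulr_ge0 //.
  rewrite mulrC ler_pdivlMr ?exprn_gt0 // mul1r -[leRHS]real_normK ?num_real //.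
  by rewrite distrC lerXn2r ?nnegrE // ltW.
have x01 : 0 <= x <= 1 by rewrite (ltW x0) (ltW x1).
have var : bernstein n.+1 (fun k => (k%:R - N * x) ^+ 2) x = N * x * (1 - x).
  by rewrite bernstein_var subrr expr0n addr0.
move: N K hn N0 K0 dist var => N K hn N0 K0 dist var.
have fin : e / 2 + K / N ^+ 2 * (N * x * (1 - x)) <= e.
  have xx : x * (1 - x) <= 1 by nra.
  have xx0 : 0 <= x * (1 - x) by nra.
  have -> : K / N ^+ 2 * (N * x * (1 - x)) = K / N * (x * (1 - x)) by field; rewrite gt_eqF.
  have h : K / N <= e / 2.
    rewrite ler_pdivrMr //; move: hn; rewrite ltr_pdivrMr // => hn; lra.
  have KN0 : 0 <= K / N by rewrite divr_ge0 // ltW.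
  have := le_trans (ler_piMr KN0 xx) h; move: (K / N * _) => q hq; lra.
rewrite distrC ler_norml; apply/andP; split.
  have : bernstein n.+1 (fun k => (F x - e / 2) + - (K / N ^+ 2) * (k%:R - N * x) ^+ 2) x
      <= bernstein n.+1 (fun k => F (k%:R / N)) x.
    by apply: bernstein_le => // k /dist; rewrite ler_norml => /andP[h _]; lra.
  rewrite bernstein_affine var => h; lra.
have : bernstein n.+1 (fun k => F (k%:R / N)) x <=
    bernstein n.+1 (fun k => (F x + e / 2) + (K / N ^+ 2) * (k%:R - N * x) ^+ 2) x.
  by apply: bernstein_le => // k /dist; rewrite ler_norml => /andP[_ h]; lra.
rewrite bernstein_affine var => h; lra.
Qed.

Lemma bernstein_cvg (F : R -> R) (M x : R) : 0 < x < 1 -> (forall s, 0 <= s <= 1 -> `|F s| <= M) ->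
  {for x, continuous F} ->
  (fun n => bernstein n.+1 (fun k => F (k%:R / n.+1%:R)) x) @ \oo --> F x.
Proof.
move=> x01 FM cF; apply/cvgrPdist_le => e e0.
have /cvgrPdist_lt /(_ (e / 2)) := cF; rewrite divr_gt0 // => /(_ isT).
move=> /nbhs_ballP[d /= d0 hd].
pose m := Num.bound `|2 * M / d ^+ 2 * 2 / e|.
have hm : 2 * M / d ^+ 2 * 2 / e < m%:R.
  exact: (le_lt_trans (ler_norm _) (archi_boundP (normr_ge0 _))).
exists m => // n /= mn; apply: (bernstein_est x01 FM e0 d0 hd).
by apply: (lt_le_trans hm); rewrite ler_nat leqW.
Qed.

End Bernstein.

(** * Density of sine polynomials *)

Section SineSpan.
Variables (R : realType) (L : R).
Hypothesis L_gt0 : 0 < L.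
Notation sp := (dotL2 L).

(** The linear combinations of the sine modes. *)
Inductive sinspan : (R -> R) -> Prop :=
| sinspan_sin m : sinspan (sinm m)
| sinspan_add v w : sinspan v -> sinspan w -> sinspan (fun y => v y + w y)
| sinspan_scale (c : R) w : sinspan w -> sinspan (fun y => c * w y).

(** Sine polynomials are stable under multiplication by [cos (pi y)]. *)
Lemma sinspan_cos w : sinspan w -> sinspan (fun y => w y * cos (pi * y)).
Proof.
elim=> [[|m]|v u _ Hv _ Hu|c u _ Hu].
- have -> : (fun y => sinm 0 y * cos (pi * y)) = (fun y => 0 * sinm 0 y :> R).
    by apply/funext => y; rewrite /sinm mulr0 !mul0r sin0 mul0r.
  by apply: sinspan_scale; exact: sinspan_sin.
- have -> : (fun y => sinm m.+1 y * cos (pi * y)) = (fun y => 2^-1 * sinm m.+2 y + 2^-1 * sinm m y :> R).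
    apply/funext => y; rewrite /sinm.
    have -> : pi * m.+2%:R * y = pi * m.+1%:R * y + pi * y :> R by ring.
    have -> : pi * m%:R * y = pi * m.+1%:R * y - pi * y :> R by ring.
    by rewrite sinB sinD; field.
  by apply: sinspan_add; apply: sinspan_scale; exact: sinspan_sin.
- have -> : (fun y => (v y + u y) * cos (pi * y)) = (fun y => v y * cos (pi * y) + u y * cos (pi * y)).
    by apply/funext => y; rewrite mulrDl.
  exact: sinspan_add.
- have -> : (fun y => (c * u y) * cos (pi * y)) = (fun y => c * (u y * cos (pi * y))).
    by apply/funext => y; rewrite mulrA.
  exact: sinspan_scale.
Qed.

(** An increasing bijection from [[0, 1]] onto itself, affine in [cos (pi y)]. *)
Definition halfcos (y : R) : R := (1 - cos (pi * y)) / 2.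

(** The products of [sin (pi y)] and a polynomial in [cos (pi y)] are sine
    polynomials; this is the case of Bernstein polynomials. *)
Lemma sinspan_bernstein n g : sinspan (fun y => sinm 1 y * bernstein n g (halfcos y)).
Proof.
elim: n g => [|n IH] g /=.
  have -> : (fun y => sinm 1 y * g 0%N) = (fun y => g 0%N * sinm 1 y).
    by apply/funext => y; rewrite mulrC.
  by apply: sinspan_scale; exact: sinspan_sin.
pose A y := sinm 1 y * bernstein n (g \o S) (halfcos y).
pose B y := sinm 1 y * bernstein n g (halfcos y).
have -> : (fun y => sinm 1 y * (halfcos y * bernstein n (g \o S) (halfcos y)
      + (1 - halfcos y) * bernstein n g (halfcos y))) =
    (fun y => (2^-1 * A y + - 2^-1 * (A y * cos (pi * y))) + (2^-1 * B y + 2^-1 * (B y * cos (pi * y)))).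
  apply/funext => y; rewrite /A /B.
  move: (bernstein _ _ _) (bernstein _ _ _) => a b; rewrite /halfcos.
  by field.
have hA : sinspan A by exact: IH.
have hB : sinspan B by exact: IH.
by apply: sinspan_add; apply: sinspan_add; apply: sinspan_scale => //; exact: sinspan_cos.
Qed.

Lemma sinspan_smooth w : sinspan w -> smooth (vfun w).
Proof.
elim=> [m|v u _ Hv _ Hu|c u _ Hu].
- exact: smooth_sinm.
- exact: smoothD.
- exact: smoothZ.
Qed.

Lemma sinspan_ortho f w : inL2 L f -> (forall m, sp f (vfun (sinm m)) = 0) -> sinspan w ->
  sp f (vfun w) = 0.
Proof.
move=> Hf H; elim=> [//|v u Sv Hv Su Hu|c u Su Hu].
- have := spDr (smooth_inL2 L (sinspan_smooth Sv)) (smooth_inL2 L (sinspan_smooth Su)) Hf.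
  by rewrite Hv Hu addr0.
- have := spZr c (smooth_inL2 L (sinspan_smooth Su)) Hf.
  by rewrite Hu mulr0.
Qed.

(** A compactly supported smooth function [a] of [x_2] is a limit in [L^2] of
    sine polynomials, so it is orthogonal to everything orthogonal to the sine
    modes.  Writing [a y = sin (pi y) F (halfcos y)] with [F] bounded, and
    continuous inside [[0, 1]], the approximations are
    [sin (pi y) B_n (halfcos y)] with [B_n] the Bernstein polynomials of
    [F]. *)
Lemma vprof_ortho f d a : inL2 L f -> (forall m, sp f (vfun (sinm m)) = 0) ->
  0 < d -> vprof d a -> sp f (vfun a) = 0.
Proof.
move=> Hf H d0 ha.
have sa : smooth (vfun a) := ha.1.
have ca : continuous a.
  move=> y; apply: differentiable_continuous; apply/derivable1_diffP.
  exact: vprof_derivable ha.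
pose F (s : R) := a (acos (1 - 2 * s) / pi) / sin (acos (1 - 2 * s)).
have pi0 : 0 < pi :> R := pi_gt0 R.
have pin (y : R) : 0 < y < 1 -> 0 < pi * y < pi.
  by move=> /andP[y0 y1]; rewrite mulr_gt0 //= gtr_pMr.
have halfcos01 y : 0 <= halfcos y <= 1.
  by rewrite /halfcos; have := cos_le1 (pi * y); have := cos_geN1 (pi * y) => h1 h2; apply/andP; split; lra.
(* The numerator of [F] vanishes unless [acos (1 - 2 s) / pi] lies in
   [[d, 1 - d]], where the denominator is bounded below. *)
have [M hM] : exists M : R, forall s : R, 0 <= s <= 1 -> `|F s| <= M.
  have F0 (s : R) : ~~ (d <= acos (1 - 2 * s) / pi <= 1 - d) -> F s = 0.
    move=> h; rewrite /F; suff -> : a (acos (1 - 2 * s) / pi) = 0 by rewrite mul0r.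
    by apply/eqP; apply: contraNT h => /(ha.2).
  have [dd|dd] := leP d (1 - d); last first.
    exists 0 => s _; rewrite F0 ?normr0 //; apply: contraL dd => /andP[h1 h2].
    by rewrite -leNgt (le_trans h1 h2).
  have cs : {within `[d, 1 - d], continuous (fun y => sin (pi * y))}.
    apply: continuous_subspaceT => y.
    apply: (continuous_comp (f := fun y => pi * y) (g := sin)); last exact: continuous_sin.
    by apply: cvgM; [exact: cvg_cst|exact: cvg_id].
  have [c hc hmin] := EVT_min dd cs.
  have [e he hmax] := EVT_max dd (continuous_subspaceT (fun y => cvg_norm (ca y))).
  have sc : 0 < sin (pi * c).
    move: hc; rewrite in_itv /= => /andP[dc cd]; apply: sin_gt0_pi.
    by apply: pin; apply/andP; split; lra.
  exists (`|a e| / sin (pi * c)) => s hs.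
  have [hy|hy] := boolP (d <= acos (1 - 2 * s) / pi <= 1 - d); last first.
    by rewrite F0 // normr0 divr_ge0 // ltW.
  have hs1 := hmin _ hy; have hs2 := hmax _ hy.
  have py : pi * (acos (1 - 2 * s) / pi) = acos (1 - 2 * s) by rewrite mulrC divfK // gt_eqF.
  rewrite py in hs1.
  have sp0 : 0 < sin (acos (1 - 2 * s)) by exact: lt_le_trans hs1.
  rewrite /F normrM normfV (gtr0_norm sp0) ler_pM ?invr_ge0 ?(ltW sp0) //.
  by rewrite lef_pV2 ?posrE.
have FE (y : R) : 0 < y < 1 -> sinm 1 y * F (halfcos y) = a y.
  move=> /andP[y0 y1]; have -> : F (halfcos y) = a y / sin (pi * y).
    rewrite /F /halfcos; have -> : 1 - 2 * ((1 - cos (pi * y)) / 2) = cos (pi * y) by field.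
    rewrite cosK ?[pi * y / pi]mulrAC ?mulfV ?mul1r ?gt_eqF //.
    by rewrite in_itv /=; have /andP[h1 h2] := pin _ (introT andP (conj y0 y1)); rewrite !ltW.
  rewrite /sinm mulr1 mulrC divfK // gt_eqF // sin_gt0_pi //.
  by rewrite pin // y0.
have cF (s : R) : 0 < s < 1 -> {for s, continuous F}.
  move=> /andP[s0 s1].
  have hs : -1 < 1 - 2 * s < 1 by apply/andP; split; lra.
  have cac : {for s, continuous (fun r : R => acos (1 - 2 * r))}.
    apply: (continuous_comp (f := fun r : R => 1 - 2 * r) (g := acos)); last exact: continuous_acos.
    by apply: cvgB; [exact: cvg_cst|apply: cvgM; [exact: cvg_cst|exact: cvg_id]].
  have /andP[hs1 hs2] := hs.
  have sne : sin (acos (1 - 2 * s)) != 0.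
    rewrite gt_eqF // sin_gt0_pi // acos_gt0 ?acos_ltpi ?hs1 ?hs2 ?(ltW hs1) ?(ltW hs2) //.
  apply: cvgM.
    apply: (continuous_comp (f := fun r : R => acos (1 - 2 * r) / pi) (g := a)); last exact: ca.
    by apply: cvgM; [exact: cac|exact: cvg_cst].
  apply: cvgV => //.
  by apply: (continuous_comp (f := fun r : R => acos (1 - 2 * r)) (g := sin)); [exact: cac|exact: continuous_sin].
pose P n y := sinm 1 y * bernstein n.+1 (fun k => F (k%:R / n.+1%:R)) (halfcos y).
have hP n : sinspan (P n) by exact: sinspan_bernstein.
have kn (n k : nat) : (k <= n.+1)%N -> 0 <= (k%:R / n.+1%:R : R) <= 1.
  by move=> h; rewrite divr_ge0 //= ler_pdivrMr ?ltr0n // mul1r ler_nat.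
have cP : cvL2 L (fun n => vfun (P n)) (vfun a).
  apply: (cvL2_dct (C := M)).
  - by move=> n; apply: continuous_measOm; apply: smooth_cont; exact: sinspan_smooth.
  - by apply: continuous_measOm; exact: smooth_cont.
  - move=> n x _; rewrite /vfun /P normrM -[leRHS]mul1r ler_pM //; first exact: sin_max.
    by apply: bernstein_bound => // k h; apply: hM; exact: kn.
  - move=> x Ox; rewrite /vfun -(FE _ (Omega_snd Ox)).
    apply: cvgM; first exact: cvg_cst.
    have hc01 : 0 < halfcos x.2 < 1.
      have /andP[p0 p1] := pin _ (Omega_snd Ox).
      have px : pi * x.2 \in `[0, pi] by rewrite in_itv /= !ltW.
      have h0 : (0 : R) \in `[0, pi] by rewrite in_itv /= lexx ltW.
      have hpi : (pi : R) \in `[0, pi] by rewrite in_itv /= lexx ltW.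
      have c1 : cos (pi * x.2) < cos 0 by rewrite ltr_cos.
      have c2 : cos pi < cos (pi * x.2) by rewrite ltr_cos.
      by rewrite cos0 in c1; rewrite cospi in c2; rewrite /halfcos; apply/andP; split; lra.
    exact: (bernstein_cvg hc01 hM (cF _ hc01)).
apply: (cvL2_sp0 Hf (smooth_inL2 L sa) cP) => n.
exact: sinspan_ortho.
Qed.

End SineSpan.

(** * The velocity determines the temperature *)

Theorem proposition3p1 (R : realType) (L nu kappa : R)
    (L_gt0 : 0 < L) (nu_gt0 : 0 < nu) (kappa_gt0 : 0 < kappa)
    (A : set (state R)) (A_attractor : global_attractor L nu kappa A)
    (u1 u2 : R -> velocity R) (theta1 theta2 : R -> temperature R)
    (traj1 : trajectory_in L nu kappa A u1 theta1)
    (traj2 : trajectory_in L nu kappa A u2 theta2)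
    (equ : forall t : R, field_ae_eq L (u1 t) (u2 t)) :
  forall t : R, field_ae_eq L (theta1 t) (theta2 t).
Proof.
move=> t i; rewrite (ord1 i) {i}.
have [_ [M hM] _ _ _] := A_attractor.
have [sol1 in1] := traj1; have [sol2 in2] := traj2.
have bnd : exists M, forall t, normL2 L (theta1 t) <= M /\ normL2 L (theta2 t) <= M.
  exists M => s.
  have H z : A z -> normL2 L z.2 <= M.
    move=> /hM[_ _]; apply: le_trans.
    by rewrite -[leLHS]ger0_norm ?sqrtr_ge0 // -sqrtr_sqr ler_wsqrtr // lerDr sqr_ge0.
  by split; [exact: (H _ (in1 s))|exact: (H _ (in2 s))].
pose D := theta_diff theta1 theta2 t.
have DL2 : inL2 L D := theta_diff_L2 sol1 sol2 t.
have modes m : dotL2 L D (vfun (sinm m)) = 0 := mode_zero L_gt0 kappa_gt0 sol1 sol2 equ bnd m t.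
have DF phi : calF L phi -> dotL2 L D phi = 0.
  move=> hphi; have [d [a [psi [d0 ha hpsi phiE]]]] := calF_split L_gt0 hphi.
  have -> : phi = (fun x => vfun a x + 'D_(dir R ord0) psi x) by apply/funext => x; exact: phiE.
  rewrite spDr //.
  - rewrite (vprof_ortho DL2 modes d0 ha) add0r.
    exact: (theta_ortho L_gt0 sol1 sol2 equ t hpsi).
  - by apply: smooth_inL2; exact: ha.1.
  - by apply: smooth_inL2; apply: smooth_partial; case: hpsi.
have V (th : temperature R) : spV1 L th -> dotL2 L D (th ord0) = 0.
  move=> Vth; have [phi [hphi c _]] := seqV1 Vth.
  apply: (cvL2_sp0 DL2 (closureH1_L2 Vth ord0) c) => n; apply: DF; exact: hphi.
have V1 := theta1_V1 sol1 t; have V2 := theta2_V1 sol2 t.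
have DD0 : dotL2 L D D = 0.
  rewrite {2}/D /theta_diff spBr //; first by rewrite !V ?subrr.
  - exact: closureH1_L2 V1 ord0.
  - exact: closureH1_L2 V2 ord0.
have := sp_eq0 DL2 DD0; apply: filterS => x /= hx Ox.
by apply/eqP; rewrite -subr_eq0; apply/eqP; exact: hx.
Qed.
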